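(* Let $p$ be a prime number, let $k$ be an algebraically closed field of characteristic $p$, and let $\Omega$ be a space $L_{4p,2}$ of meromorphic differential forms on $\mathbb{P}^1_k$. Then $p\in\{2,3,5\}$. Moreover, if $p=5$, then $\Omega$ is equivalent to a standard $L_{20,2}$-space.
   Context: Meromorphic differential forms on $\mathbb{P}^1_k$ are $f(X)\,dX$, $f\in k(X)$; order at $\infty$ is $\mathrm{ord}_0(f(1/X))-2$. A form is logarithmic if it equals $dF/F$ for some nonzero $F\in k(X)$. For positive integers $m,n$, a space $L_{m+1,n}$ is an $n$-dimensional $\mathbb{F}_p$-vector space of meromorphic differential forms on $\mathbb{P}^1_k$ whose nonzero elements are all logarithmic and each have a unique zero, located at $\infty$, of order $m-1$. For such a space $\Omega$, $\mathcal{P}(\Omega)\subset k$ denotes the set of points that are poles of at least one nonzero element of $\Omega$. Two spaces $\Omega,\Omega'$ are equivalent if $\Omega'=\sigma^*\Omega$ for some automorphism $\sigma$ of $\mathbb{P}^1_k$ with $\sigma(\infty)=\infty$. A standard $L_{(p-1)p^{n-1},n}$-space is a space $L_{(p-1)p^{n-1},n}$ $\Omega$ for which there exist $\mathbb{F}_p$-linearly independent $a_1,\dots,a_n\in k$ with $\mathcal{P}(\Omega)=\langle a_1,\dots,a_n\rangle_{\mathbb{F}_p}\setminus\{0\}$. *)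

(* Defs.v *)
From HB Require Import structures.
From mathcomp Require Import all_boot all_order all_algebra.
From mathcomp Require Import generic_quotient fraction ring.

Set Implicit Arguments.
Unset Strict Implicit.
Unset Printing Implicit Defensive.

Import GRing.Theory.
Local Open Scope ring_scope.

(* The rational function field k(X).  A meromorphic differential form f dX on
   the projective line is represented by its coefficient f : ratfun k. *)
Notation ratfun k := {fraction {poly k}}.

Section RationalFunctions.
Variable k : fieldType.
Implicit Types (f g : ratfun k) (x : k).

Definition rnum f : {poly k} := \n_(repr f).
Definition rden f : {poly k} := \d_(repr f).

Definition rfrac (u v : {poly k}) : ratfun k := tofrac u / tofrac v.

(* rnum f / rden f is an arbitrary, not necessarily reduced, representative of
   f; rderivE, rcompE and rordE below show that the next three notions do not
   depend on it. *)
Definition rderiv f : ratfun k :=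
  rfrac ((rnum f)^`() * rden f - rnum f * (rden f)^`()) (rden f ^+ 2).

Definition poly_at (u : {poly k}) g : ratfun k :=
  (map_poly (@FracField.tofrac {poly k} \o polyC) u).[g].

(* f(g(X)); only meaningful if g is not constant. *)
Definition rcomp f g : ratfun k := poly_at (rnum f) g / poly_at (rden f) g.

(* Order of vanishing at x; junk value if f = 0. *)
Definition rord f x : int := (mup x (rnum f))%:Z - (mup x (rden f))%:Z.

(* Points of the projective line: Some x is the affine point x and None is the
   point at infinity. *)
Definition form_ord f (P : option k) : int :=
  if P is Some x then rord f x
  else rord (rcomp f (rfrac 1 'X)) 0 - 2.

Definition logarithmic f : Prop :=
  exists F : ratfun k, F != 0 /\ f = rderiv F / F.

(* An automorphism of the projective line is the Moebius transformation
   X |-> (aX + b)/(cX + d) of an invertible matrix. *)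
Definition mobius_pt (A : 'M[k]_2) (P : option k) : option k :=
  if P is Some x then
    if A 1 0 * x + A 1 1 == 0 then None
    else Some ((A 0 0 * x + A 0 1) / (A 1 0 * x + A 1 1))
  else if A 1 0 == 0 then None else Some (A 0 0 / A 1 0).

Definition mobius_fun (A : 'M[k]_2) : ratfun k :=
  rfrac (A 0 0 *: 'X + (A 0 1)%:P) (A 1 0 *: 'X + (A 1 1)%:P).

(* sigma^*(f dX) = f(sigma(X)) sigma'(X) dX *)
Definition pullback (A : 'M[k]_2) f : ratfun k :=
  rcomp f (mobius_fun A) * rderiv (mobius_fun A).

Definition equivalent_spaces (Om Om' : ratfun k -> Prop) : Prop :=
  exists A : 'M[k]_2, [/\ A \in unitmx, mobius_pt A None = None &
    forall g, Om' g <-> exists2 f, Om f & g = pullback A f].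

Definition poles (Om : ratfun k -> Prop) x : Prop :=
  exists f, [/\ Om f, f != 0 & form_ord f (Some x) < 0].

End RationalFunctions.

(* Linear algebra over 'F_p in an abelian group V killed by p: the scalar
   c : 'F_p acts on v as v *+ c through its natural representative. *)
Section FpSpaces.
Variables (p : nat) (V : zmodType) (n : nat).
Implicit Types (w : 'I_n -> V) (W : V -> Prop).

Definition Fp_comb w (c : 'I_n -> 'F_p) : V := \sum_(i < n) w i *+ c i.

Definition Fp_free w : Prop :=
  forall c : 'I_n -> 'F_p, Fp_comb w c = 0 -> forall i, c i = 0.

Definition Fp_span w : V -> Prop :=
  fun v => exists c : 'I_n -> 'F_p, v = Fp_comb w c.

Definition Fp_space_of_dim W : Prop :=
  exists w, Fp_free w /\ forall v, W v <-> Fp_span w v.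

End FpSpaces.

Section LSpaces.
Variables (p : nat) (k : fieldType).
Implicit Types Om : ratfun k -> Prop.

(* The spaces L_{M,n}, where M = m + 1 with m positive, so that the order
   m - 1 of the zero at infinity is M - 2. *)
Definition Lspace (M n : nat) Om : Prop :=
  [/\ (1 < M)%N, (0 < n)%N, Fp_space_of_dim p n Om &
      forall f, Om f -> f != 0 ->
        [/\ logarithmic f,
            forall P, 0 < form_ord f P -> P = None
          & form_ord f None = M%:Z - 2]].

Definition standard_Lspace (n : nat) Om : Prop :=
  Lspace (p.-1 * p ^ n.-1) n Om /\
  exists a : 'I_n -> k, Fp_free p a /\
    forall x, poles Om x <-> Fp_span p a x /\ x != 0.

End LSpaces.

Section Independence.
Variable k : fieldType.
Implicit Types (u v : {poly k}) (f g : ratfun k).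

Lemma rden_neq0 f : rden f != 0.
Proof. exact: denom_ratioP. Qed.

Lemma rfrac_numden f : f = rfrac (rnum f) (rden f).
Proof.
rewrite -[LHS]reprK -[repr f in LHS]Ratio_numden -/(rnum f) -/(rden f).
move: (rnum f) (rden f) (rden_neq0 f) => u v v0; rewrite /rfrac.
apply: (@mulIf _ (tofrac v)); rewrite ?tofrac_eq0 // divfK ?tofrac_eq0 //.
unlock FracField.tofrac; rewrite -[LHS]FracField.pi_mul.
apply/eqmodP; rewrite /= FracField.equivfE /FracField.mulf.
by rewrite !numden_Ratio ?mulr1 ?oner_eq0 // mulrC.
Qed.

Lemma rfrac_eq u v u' v' : v != 0 -> v' != 0 ->
  (rfrac u v == rfrac u' v') = (u * v' == u' * v).
Proof.
move=> v0 v0'; rewrite /rfrac eqr_div ?tofrac_eq0 //.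
by rewrite -!tofracM tofrac_eq.
Qed.

Lemma rfrac_cross u v : v != 0 ->
  u * rden (rfrac u v) = rnum (rfrac u v) * v.
Proof.
move=> v0; apply/eqP; rewrite -rfrac_eq ?rden_neq0 //.
by rewrite -rfrac_numden.
Qed.

Lemma rderivE u v : v != 0 ->
  rderiv (rfrac u v) = rfrac (u^`() * v - u * v^`()) (v ^+ 2).
Proof.
move=> v0; have := rfrac_cross u v0; rewrite /rderiv.
have := rden_neq0 (rfrac u v).
move: (rnum _) (rden _) => a b b0 E; apply/eqP.
rewrite rfrac_eq ?expf_neq0 //; apply/eqP.
have /(congr1 (@deriv k)) := E; rewrite !derivM => E'.
apply/esym/eqP; rewrite -subr_eq0; apply/eqP.
transitivity (v * b * (u^`() * b + u * b^`() - (a^`() * v + a * v^`()))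
              - (b * v^`() + v * b^`()) * (u * b - a * v)); first by ring.
by rewrite E' E !subrr !mulr0 subrr.
Qed.

Lemma rordE u v x : u != 0 -> v != 0 ->
  rord (rfrac u v) x = (mup x u)%:Z - (mup x v)%:Z.
Proof.
move=> u0 v0; have := rfrac_cross u v0; rewrite /rord.
have := rden_neq0 (rfrac u v).
move: (rnum _) (rden _) => a b b0 E.
have a0 : a != 0.
  by apply: contraNneq (mulf_neq0 u0 b0) => a0; rewrite E a0 mul0r.
have := congr1 (mup x) E; rewrite !mupM // => /(congr1 Posz).
rewrite !PoszD => E'; apply/eqP; rewrite -subr_eq0; apply/eqP.
transitivity ((mup x a)%:Z + (mup x v)%:Z - ((mup x u)%:Z + (mup x b)%:Z)).
  by ring.
by rewrite E' subrr.
Qed.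

Lemma poly_atM u v g : poly_at (u * v) g = poly_at u g * poly_at v g.
Proof. by rewrite /poly_at rmorphM hornerM. Qed.

End Independence.

Section Composition.
Variable k : closedFieldType.
Implicit Types (u v : {poly k}) (f g : ratfun k).

Lemma poly_atXsubC (c : k) g : poly_at ('X - c%:P) g = g - tofrac c%:P.
Proof. by rewrite /poly_at map_polyXsubC hornerXsubC. Qed.

Lemma poly_at_neq0 v g : (forall c : k, g != tofrac c%:P) ->
  v != 0 -> poly_at v g != 0.
Proof.
move=> gNc v0; have [s ->] := closed_field_poly_normal v.
rewrite -mul_polyC poly_atM mulf_neq0 //.
  by rewrite /poly_at map_polyC hornerC /= tofrac_eq0 polyC_eq0 lead_coef_eq0.
elim: s => [|c s IHs].
  by rewrite big_nil /poly_at rmorph1 hornerC oner_eq0.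
rewrite big_cons poly_atM; apply: mulf_neq0; last exact: IHs.
rewrite poly_atXsubC subr_eq0; exact: gNc.
Qed.

Lemma rcompE u v g : (forall c : k, g != tofrac c%:P) -> v != 0 ->
  rcomp (rfrac u v) g = poly_at u g / poly_at v g.
Proof.
move=> gNc v0; apply/eqP; rewrite eqr_div ?poly_at_neq0 ?rden_neq0 //.
by rewrite -!poly_atM rfrac_cross.
Qed.

End Composition.

(* Main.v *)
(** Write a basis of the space as 1/P1, 1/P2.  The residues lie in F_p, which
    forces P1 = Q1 H and P2 = Q2 H with H = Q2^(p-1) - Q1^(p-1) and Q1, Q2
    coprime quartics.  Invariance of 1/P1 under the Cartier operator becomes an
    identity
      1 = sum_j cart(R1^(j+1) R2^(p-1-j)) a^j b^(p-2-j),
    where R1, R2 is any basis over k of the pencil spanned by Q1 and Q2, and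
    a, b are the p-th roots of the coefficients of
    Q1 Q2^p - Q2 Q1^p = a^p R1 - b^p R2.  Take R2 of least degree.  Since the
    ratio of the leading coefficients of Q1 and Q2 is not in F_p, R1 occurs in
    a.  Expanding the identity as 1 = sum_i q_i R1^(p-2-i) R2^i and truncating
    it modulo powers of R2 excludes deg R2 = 3 and deg R2 = 1.  If deg R2 = 2,
    logarithmic differentiation of the truncations shows that, up to
    translation, the pencil consists of even polynomials (with one exception
    for p = 5); then the leading coefficient of the identity is known
    explicitly and has simple zeros only, whereas it vanishes to order
    (p-3)/2 at a = 0.  This excludes p >= 7, and an explicit computation
    excludes p = 5.  If R2 is constant, p = 5 and up to translation the pencil
    is spanned by X^4 and 1, so that X (Q1 Q2^5 - Q2 Q1^5) is an additive
    polynomial. *)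
Require Import Defs.
From mathcomp Require Import all_boot all_order all_algebra fraction.
From mathcomp Require Import separable ring zify.
Import GRing.Theory Num.Theory Order.TTheory.
Local Open Scope ring_scope.

Set Implicit Arguments.
Unset Strict Implicit.
Unset Printing Implicit Defensive.

(** * The Cartier operator *)

(** What makes the identity tractable is a gap of degrees. The Cartier operator divides degrees by
    about p, so for deg R2 <= 2 every q_i has degree at most 2, whereas R1 has degree 4. Comparing
    degrees modulo R2^(m+1) bounds the degree of the m-th truncation, m < p - 2, by (m+1) deg R2 -
    2. For deg R2 <= 1 the zeroth truncation is therefore 0. For deg R2 = 2 each truncation is
    determined by the preceding one up to one scalar. As the identity has degree p - 2 in R1 and R2,
    the exponents of R1 become small negative integers in k, and differentiating gives a relation
    modulo a power of R2. Each step thus yields two scalar equations for one new unknown, and the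
    surplus equation constrains the pencil. The prime 5 is delicate twice: the identity is a cubic
    form, so only the truncations of index at most 2 obey the bound, and (p-3)/2 = 1, so that simple
    zeros of the leading coefficient are no contradiction. *)

Section Cartier.
Variables (p : nat) (k : closedFieldType).
Hypothesis pk : p \in [pchar k].
Let pP : prime p := pcharf_prime pk.
Let p_gt0 : (0 < p)%N := prime_gt0 pP.

Lemma pchar_polyE : p \in [pchar {poly k}].
Proof. by rewrite (rmorph_pchar (@polyC k)). Qed.

Lemma exists_proot (x : k) : exists y, y ^+ p == x.
Proof.
have [y] := solve_monicpoly (fun i => if i == 0%N then x else 0) p_gt0.
case: p p_gt0 => // q _ E; exists y; rewrite E big_ord_recl /= mulr1 big1 ?addr0 //.
by move=> i _; rewrite mul0r.
Qed.

Definition proot x := xchoose (exists_proot x).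

Lemma prootK x : proot x ^+ p = x.
Proof. exact/eqP/(xchooseP (exists_proot x)). Qed.

Lemma exprp_inj (R : idomainType) (Rp : p \in [pchar R]) :
  injective (fun x : R => x ^+ p).
Proof.
move=> x y /= /eqP; rewrite -subr_eq0 -!(pFrobenius_autE Rp).
rewrite -(pFrobenius_autB_comm _ (mulrC _ _)) pFrobenius_autE expf_eq0.
by rewrite subr_eq0 => /andP[_ /eqP].
Qed.

Lemma exprDp (R : comNzRingType) (Rp : p \in [pchar R]) (x y : R) :
  (x + y) ^+ p = x ^+ p + y ^+ p.
Proof. by rewrite -!(pFrobenius_autE Rp) (pFrobenius_autD_comm _ (mulrC _ _)). Qed.

Lemma proot_expr x : proot (x ^+ p) = x.
Proof. by apply: (exprp_inj pk); rewrite prootK. Qed.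

Lemma prootD x y : proot (x + y) = proot x + proot y.
Proof. by apply: (exprp_inj pk); rewrite (exprDp pk) !prootK. Qed.

Lemma prootM x y : proot (x * y) = proot x * proot y.
Proof. by apply: (exprp_inj pk); rewrite exprMn !prootK. Qed.

Lemma proot0 : proot 0 = 0.
Proof. by apply: (exprp_inj pk); rewrite prootK expr0n (gtn_eqF p_gt0). Qed.

Lemma proot1 : proot 1 = 1.
Proof. by rewrite -{1}(expr1n _ p) proot_expr. Qed.

Lemma proot_eq0 x : (proot x == 0) = (x == 0).
Proof.
apply/eqP/eqP => [x0|->]; last exact: proot0.
by rewrite -[x]prootK x0 expr0n (gtn_eqF p_gt0).
Qed.

Lemma prootN x : proot (- x) = - proot x.
Proof. by apply/eqP; rewrite -addr_eq0 -prootD addNr proot0. Qed.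

(* The Cartier operator h dX |-> cart h dX. *)
Definition cart (h : {poly k}) : {poly k} :=
  \poly_(l < size h) proot h`_(l * p + p.-1).

Lemma coef_cart h l : (cart h)`_l = proot h`_(l * p + p.-1).
Proof.
rewrite coef_poly; case: ltnP => // hl.
by rewrite nth_default ?proot0 // (leq_trans hl) // (leq_trans _ (leq_addr _ _)) ?leq_pmulr.
Qed.

Lemma cartD g h : cart (g + h) = cart g + cart h.
Proof. by apply/polyP=> l; rewrite coefD !coef_cart coefD prootD. Qed.

Lemma cart0 : cart 0 = 0.
Proof. by apply/polyP=> l; rewrite coef_cart !coef0 proot0. Qed.

Lemma cart_sum I (s : seq I) (P : pred I) (F : I -> {poly k}) :
  cart (\sum_(i <- s | P i) F i) = \sum_(i <- s | P i) cart (F i).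
Proof. by apply: (big_morph cart cartD cart0). Qed.

Lemma cartZ c h : cart (c *: h) = proot c *: cart h.
Proof. by apply/polyP=> l; rewrite coefZ !coef_cart coefZ prootM. Qed.

Lemma cartXp h : cart ('X ^+ p * h) = 'X * cart h.
Proof.
apply/polyP=> l; rewrite coefXM !coef_cart coefXnM.
case: l => [|l] /=; first by rewrite mul0n add0n prednK // leqnn proot0.
by rewrite mulSn -addnA ltnNge leq_addr /= addKn.
Qed.

Lemma cart_expM u h : cart (u ^+ p * h) = u * cart h.
Proof.
elim/poly_ind: u => [|u c IH]; first by rewrite expr0n (gtn_eqF p_gt0) !mul0r cart0.
rewrite (exprDp pchar_polyE) mulrDl cartD exprMn.
have -> : u ^+ p * 'X ^+ p * h = 'X ^+ p * (u ^+ p * h) by ring.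
by rewrite cartXp IH -polyC_exp mul_polyC cartZ proot_expr -!mul_polyC; ring.
Qed.

Lemma size_cart (h : {poly k}) l : (size h <= l * p + p.-1)%N -> (size (cart h) <= l)%N.
Proof.
move=> hs; apply/leq_sizeP => j lj; rewrite coef_cart nth_default ?proot0 //.
by rewrite (leq_trans hs) // leq_add2r leq_mul2r lj orbT.
Qed.

Lemma cart_small (h : {poly k}) : (size h < p)%N -> cart h = 0.
Proof.
move=> hp; apply/eqP; rewrite -size_poly_leq0; apply: size_cart.
by rewrite mul0n add0n -ltnS prednK.
Qed.

(** Invariance of dF/F = F^(p-1) F' dX / F^p. Since dF/F turns products into sums, linear factors
    suffice; for X - x, only the leading coefficient of (X - x)^(p-1) has an index of the form l p +
    p - 1. *)
Lemma cart_dlog (F : {poly k}) : cart (F ^+ p.-1 * F^`()) = F^`().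
Proof.
have [s ->] := closed_field_poly_normal F.
rewrite derivZ exprZn -scalerAl -scalerAr scalerA -exprSr prednK // cartZ proot_expr.
congr (_ *: _); elim: s => [|x s IH].
  by rewrite big_nil derivC mulr0 cart0.
rewrite big_cons; set G := \prod_(z <- s) _ in IH *.
rewrite derivM derivXsubC mul1r exprMn.
have -> : ('X - x%:P) ^+ p.-1 * G ^+ p.-1 * (G + ('X - x%:P) * G^`()) =
   G ^+ p * (('X - x%:P) ^+ p.-1 * 1) + ('X - x%:P) ^+ p * (G ^+ p.-1 * G^`()).
  have Ep (u : {poly k}) : u ^+ p = u * u ^+ p.-1 by rewrite -exprS prednK.
  by rewrite !Ep; ring.
rewrite cartD !cart_expM IH mulr1; congr (_ + _).
suff -> : cart (('X - x%:P) ^+ p.-1) = 1 by rewrite mulr1.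
have sX : size (('X - x%:P) ^+ p.-1) = p by rewrite size_exp_XsubC prednK.
apply/polyP => l; rewrite coef_cart coef1; case: l => [|l] /=.
  rewrite mul0n add0n -{2}sX.
  have := monic_exp p.-1 (monicXsubC x); rewrite monicE lead_coefE sX => /eqP ->.
  exact: proot1.
rewrite nth_default ?proot0 // sX mulSn -addnA leq_addr //.
Qed.

(** The form dX/P = P^(p-1) dX / P^p equals dF/F, hence is fixed by the Cartier operator. *)
Lemma cart_log (P F : {poly k}) : F != 0 -> F = P * F^`() -> cart (P ^+ p.-1) = 1.
Proof.
move=> F0 E; have F'0 : F^`() != 0.
  by apply: contraNneq F0 => F'0; rewrite E F'0 mulr0.
have := cart_dlog F; rewrite {1}E exprMn.
have -> : P ^+ p.-1 * F^`() ^+ p.-1 * F^`() = F^`() ^+ p * P ^+ p.-1.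
  by rewrite -mulrA -exprSr prednK // mulrC.
by rewrite cart_expM -[RHS]mulr1 => /(mulfI F'0).
Qed.

End Cartier.

(** * The Cartier relation of a pencil *)

Section Pencil.
Variables (p : nat) (k : closedFieldType).
Hypothesis pk : p \in [pchar k].
Let pP : prime p := pcharf_prime pk.
Let p_gt0 : (0 < p)%N := prime_gt0 pP.
Let pr := proot pk.

Lemma exprBp_pred (x y : {poly k}) : x - y != 0 ->
  (x - y) ^+ p.-1 = \sum_(i < p) x ^+ i * y ^+ (p.-1 - i).
Proof.
move=> xy0; apply: (mulfI xy0); rewrite -exprS prednK //.
rewrite -(pFrobenius_autE (pchar_polyE pk)) (pFrobenius_autB_comm _ (mulrC _ _)).
rewrite !pFrobenius_autE subrXX; congr (_ * _).
rewrite [RHS](reindex_inj rev_ord_inj) /=; apply: eq_bigr => i _.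
by have := ltn_ord i => ip; congr (_ ^+ _ * _ ^+ _); lia.
Qed.

(** Multiplying [cart (P^(p-1)) = 1] by Q2 moves Q2^p inside, where Q2^p P^(p-1) = Q2 (Q2 P)^(p-1)
    is a polynomial in R1, R2, a^p and b^p; the p-th powers come out again as a and b. The basis R1,
    R2 is left free so that R2 can later be taken of low degree. *)
Lemma cart_pencil (m11 m12 m21 m22 : k) (R1 R2 P : {poly k}) :
  let Q1 := m11 *: R1 + m12 *: R2 in
  let Q2 := m21 *: R1 + m22 *: R2 in
  let a := pr (m11 * m21 ^+ p - m21 * m11 ^+ p) *: R1
           + pr (m11 * m22 ^+ p - m21 * m12 ^+ p) *: R2 in
  let b := pr (m22 * m11 ^+ p - m12 * m21 ^+ p) *: R1
           + pr (m22 * m12 ^+ p - m12 * m22 ^+ p) *: R2 in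
  P != 0 -> Q2 != 0 -> Q2 * P = Q1 * Q2 ^+ p - Q2 * Q1 ^+ p ->
  cart pk (P ^+ p.-1) = 1 ->
  pr (m11 * m22 - m12 * m21) *:
    \sum_(j < p.-1)
      cart pk (R1 ^+ j.+1 * R2 ^+ (p.-1 - j)) * a ^+ j * b ^+ (p.-2 - j) = 1.
Proof.
move=> Q1 Q2 a b P0 Q20 EL cP; set Psi := \sum_(j < _) _.
have cp := pchar_polyE pk.
have ZE c (u : {poly k}) : pr c *: u = (pr c)%:P * u by rewrite mul_polyC.
have prE c : (pr c)%:P ^+ p = c%:P :> {poly k} by rewrite -polyC_exp prootK.
have EA : a ^+ p = m11 *: Q2 ^+ p - m21 *: Q1 ^+ p.
  rewrite /a /Q1 /Q2 -!mul_polyC !(exprDp cp) !exprMn !prE.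
  by rewrite -!polyC_exp !polyCB !polyCM; ring.
have EB : b ^+ p = m22 *: Q1 ^+ p - m12 *: Q2 ^+ p.
  rewrite /b /Q1 /Q2 -!mul_polyC !(exprDp cp) !exprMn !prE.
  by rewrite -!polyC_exp !polyCB !polyCM; ring.
have EL' : Q2 * P = a ^+ p * R1 - b ^+ p * R2.
  by rewrite EL EA EB /Q1 /Q2 -!mul_polyC; ring.
have L0 : a ^+ p * R1 - b ^+ p * R2 != 0 by rewrite -EL' mulf_neq0.
(* Writing the outer factor Q2 as m21 R1 + m22 R2 will split the sum into multiples of b Psi and a
   Psi; this relation recombines them into a multiple of Q2 Psi, and Q2 cancels. *)
have Edet : pr m21 *: b + pr m22 *: a = pr (m11 * m22 - m12 * m21) *: Q2.
  apply: (exprp_inj cp); rewrite -!mul_polyC !(exprDp cp) !exprMn !prE EA EB.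
  by rewrite (exprDp cp) -!mul_polyC !exprMn polyCB !polyCM; ring.
(* The two extreme terms of the expansion vanish because [cart 1 = 0]; this lowers the degree of the
   form from p - 1 to p - 2. *)
have c1 : cart pk (R2 ^+ p) = 0.
  by rewrite -[_ ^+ p]mulr1 cart_expM cart_small ?mulr0 // size_poly1 prime_gt1.
have c2 : cart pk (R1 ^+ p) = 0.
  by rewrite -[_ ^+ p]mulr1 cart_expM cart_small ?mulr0 // size_poly1 prime_gt1.
apply: (mulfI Q20); rewrite mulr1 -{2}[Q2]mulr1 -cP -cart_expM.
have -> : Q2 ^+ p * P ^+ p.-1 = Q2 * (Q2 * P) ^+ p.-1.
  by rewrite exprMn mulrA -exprS prednK.
rewrite EL' (exprBp_pred L0) mulr_sumr cart_sum.
rewrite -scalerAr scalerAl -Edet mulrDl.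
under [in RHS]eq_bigr => i _.
  rewrite (_ : Q2 * _ = (a ^+ i * b ^+ (p.-1 - i)) ^+ p *
    (m21 *: (R1 ^+ i.+1 * R2 ^+ (p.-1 - i)) + m22 *: (R1 ^+ i * R2 ^+ (p.-1 - i).+1))); last
      first.
    rewrite /Q2 -!mul_polyC !exprMn !exprS -!exprM mulnC [X in b ^+ X]mulnC; ring.
  rewrite cart_expM cartD !cartZ mulrDr; over.
have splitr (F : nat -> {poly k}) : \sum_(i < p) F i = \sum_(i < p.-1) F i + F p.-1.
  by rewrite -[X in \sum_(i < X) F i](prednK p_gt0) big_ord_recr.
have splitl (F : nat -> {poly k}) : \sum_(i < p) F i = F 0%N + \sum_(i < p.-1) F i.+1.
  by rewrite -[X in \sum_(i < X) F i](prednK p_gt0) big_ord_recl.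
rewrite big_split /=; congr (_ + _).
  rewrite (splitr (fun i => a ^+ i * b ^+ (p.-1 - i) *
    (proot pk m21 *: cart pk (R1 ^+ i.+1 * R2 ^+ (p.-1 - i))))) /=.
  rewrite subnn expr0 !mulr1 !prednK // c2.
  rewrite scaler0 mulr0 addr0 /Psi mulr_sumr; apply: eq_bigr => i _.
  have -> : (p.-1 - i = (p.-2 - i).+1)%N by have := ltn_ord i; lia.
  by rewrite [b ^+ _.+1]exprS -!mul_polyC /pr; ring.
rewrite (splitl (fun i => a ^+ i * b ^+ (p.-1 - i) *
    (proot pk m22 *: cart pk (R1 ^+ i * R2 ^+ (p.-1 - i).+1)))) /=.
rewrite subn0 expr0 !mul1r !prednK // c1.
rewrite scaler0 mulr0 add0r /Psi mulr_sumr; apply: eq_bigr => i _.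
have -> : (p.-1 - i.+1 = p.-2 - i)%N by lia.
have -> : (p.-1 - i = (p.-2 - i).+1)%N by have := ltn_ord i; lia.
by rewrite [a ^+ _.+1]exprS -!mul_polyC /pr; ring.
Qed.

End Pencil.

(** * Binary forms in a pencil and their truncations *)

Section BinaryForms.
Variable k : fieldType.

(* The dehomogenization h of a binary form of degree n, evaluated at (S, T). *)
Definition bform n (h S T : {poly k}) : {poly k} :=
  \sum_(i < n.+1) h`_i *: (S ^+ (n - i) * T ^+ i).

Definition linform (c d : k) : {poly k} := c%:P + d *: 'X.

Lemma size_lin c d : (size (linform c d) <= 2)%N.
Proof.
rewrite (leq_trans (size_polyD _ _)) // geq_max (leq_trans (size_polyC_leq1 _)) //.
by rewrite (leq_trans (size_scale_leq _ _)) ?size_polyX.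
Qed.

Lemma size_linX c d c' d' i j : (size (linform c d ^+ i * linform c' d' ^+ j)%R <= (i +
  j).+1)%N.
Proof.
have sX (u : {poly k}) e : (size u <= 2 -> size (u ^+ e)%R <= e.+1)%N.
  move=> su; elim: e => [|e IH]; first by rewrite expr0 size_poly1.
  by rewrite exprS (leq_trans (size_polyMleq _ _)) //; lia.
rewrite (leq_trans (size_polyMleq _ _)) //.
have := sX _ i (size_lin c d); have := sX _ j (size_lin c' d'); lia.
Qed.

Lemma bform_lin n (h S T : {poly k}) c d : (size h <= n.+1)%N ->
  bform n.+1 (linform c d * h) S T = (c *: S + d *: T) * bform n h S T.
Proof.
move=> sh; rewrite /bform.
under eq_bigr => i _ do rewrite /linform mulrDl -scalerAl mul_polyC coefD !coefZ coefXM
  scalerDl.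
rewrite big_split mulrDl /=; congr (_ + _).
  rewrite big_ord_recr /= [h`_n.+1]nth_default // mulr0 scale0r addr0 mulr_sumr.
  apply: eq_bigr => i _; rewrite subSn ?leq_ord // exprS -!mul_polyC polyCM; ring.
rewrite big_ord_recl /= mulr0 scale0r add0r mulr_sumr.
apply: eq_bigr => i _; rewrite /bump add1n subSS exprS -!mul_polyC polyCM; ring.
Qed.

Lemma bform_linX i j (S T : {poly k}) c d c' d' :
  bform (i + j) (linform c d ^+ i * linform c' d' ^+ j) S T =
  (c *: S + d *: T) ^+ i * (c' *: S + d' *: T) ^+ j.
Proof.
elim: i => [|i IH]; last by rewrite !exprS -!mulrA bform_lin ?size_linX // IH.
elim: j => [|j IH]; first by rewrite /bform big_ord1 !expr0 !mulr1 coef1 scale1r.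
rewrite !expr0 !mul1r add0n in IH *; rewrite !exprS bform_lin ?IH //.
by have := size_linX 0 0 c' d' 0 j; rewrite expr0 mul1r.
Qed.

Lemma form_expansion n (cart_coef : nat -> {poly k}) (R1 R2 : {poly k}) a1 a2 b1 b2 :
  \sum_(j < n.+1) cart_coef j * (a1 *: R1 + a2 *: R2) ^+ j * (b1 *: R1 + b2 *: R2) ^+ (n - j)
  = \sum_(i < n.+1)
      (\sum_(j < n.+1) (linform a1 a2 ^+ j * linform b1 b2 ^+ (n - j))`_i *: cart_coef j)
       * R1 ^+ (n - i) * R2 ^+ i.
Proof.
under [in RHS]eq_bigr => i _ do rewrite -mulrA mulr_suml.
rewrite exchange_big /=; apply: eq_bigr => j _.
rewrite -mulrA -bform_linX subnKC ?leq_ord // /bform mulr_sumr.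
by apply: eq_bigr => i _; rewrite -scalerAr -scalerAl.
Qed.

End BinaryForms.

(** * Degree bounds and differential relations for truncations *)

Section Truncation.
Variables (k : fieldType) (n : nat) (q : nat -> {poly k}) (R1 R2 : {poly k}).
Hypothesis q_size : forall i, (size (q i) <= 3)%N.
Hypothesis R1_size : size R1 = 5%N.
Hypothesis R2_neq0 : R2 != 0.
Hypothesis R2_size : (size R2 <= 4)%N.
Hypothesis E1 : \sum_(i < n.+1) q i * R1 ^+ (n - i) * R2 ^+ i = 1.

Definition trunc m : {poly k} := \sum_(i < m.+1) q i * R1 ^+ (m - i) * R2 ^+ i.

Let R1_neq0 : R1 != 0. Proof. by rewrite -size_poly_eq0 R1_size. Qed.

Lemma trunc0 : trunc 0 = q 0%N.
Proof. by rewrite /trunc big_ord1 !expr0 !mulr1. Qed.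

Lemma truncS m : trunc m.+1 = R1 * trunc m + q m.+1 * R2 ^+ m.+1.
Proof.
rewrite /trunc big_ord_recr /= subnn expr0 mulr1; congr (_ + _).
rewrite mulr_sumr; apply: eq_bigr => i _.
by rewrite subSn ?leq_ord // exprS; ring.
Qed.

Lemma trunc_full : trunc n = 1. Proof. exact: E1. Qed.

(** The sum is cut after the term in R2^m. The i-th remaining term contributes to U a degree of at
    most 2 + 4(n-i) + 3(i-m-1), which is largest at i = m+1. *)
Lemma trunc_congr m : (m < n)%N -> exists2 U : {poly k},
  1 = R1 ^+ (n - m) * trunc m + R2 ^+ m.+1 * U & (size U <= 4 * (n - m) - 1)%N.
Proof.
move=> mn; pose G i := q i * R1 ^+ (n - i) * R2 ^+ (i - m.+1).
exists (\sum_(m.+1 <= i < n.+1) G i).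
  rewrite -[LHS]E1 -(big_mkord xpredT (fun i => q i * R1 ^+ (n - i) * R2 ^+ i)) /=.
  rewrite (big_cat_nat (n := m.+1)) //=; last by lia.
  congr (_ + _).
    rewrite big_mkord /trunc mulr_sumr; apply: eq_bigr => i _.
    have -> : (n - i = (n - m) + (m - i))%N by have := ltn_ord i; lia.
    by rewrite exprD; ring.
  rewrite mulr_sumr !big_seq; apply: eq_bigr => i; rewrite mem_index_iota => /andP[mi _].
  have {1}-> : R2 ^+ i = R2 ^+ m.+1 * R2 ^+ (i - m.+1) by rewrite -exprD subnKC.
  by rewrite /G; ring.
rewrite big_seq; elim/big_rec: _ => [|i u]; first by rewrite size_poly0.
rewrite mem_index_iota => /andP[mi i_n] su.
rewrite (leq_trans (size_polyD _ _)) // geq_max su andbT.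
have s2 : ((size (R2 ^+ (i - m.+1))).-1 <= 3 * (i - m.+1))%N.
  by rewrite size_exp leq_mul2r; apply/orP; right; move: R2_size; case: (size _).
have s1 : ((size (R1 ^+ (n - i))).-1 = 4 * (n - i))%N.
  by rewrite size_exp R1_size.
have p1 : (0 < size (R1 ^+ (n - i)))%N by rewrite lt0n size_poly_eq0 expf_neq0.
have p2 : (0 < size (R2 ^+ (i - m.+1)))%N by rewrite lt0n size_poly_eq0 expf_neq0.
have s3 := size_polyMleq (q i) (R1 ^+ (n - i)).
have s4 := size_polyMleq (q i * R1 ^+ (n - i)) (R2 ^+ (i - m.+1)).
have := q_size i; rewrite /G; lia.
Qed.

(** In R1^(n-m) V = 1 - R2^(m+1) U the factor U has degree at most 4(n-m) - 2, that is, two less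
    than R1^(n-m); the defect of 2 passes to V. *)
Lemma size_trunc m : (m < n)%N ->
  (size (trunc m) <= ((size R2).-1 * m.+1).-1)%N.
Proof.
move=> mn; have [->|V0] := eqVneq (trunc m) 0; first by rewrite size_poly0.
have [U EU sU] := trunc_congr mn.
have e0 : R1 ^+ (n - m) != 0 by rewrite expf_neq0.
have s1 : ((size (R1 ^+ (n - m))).-1 = 4 * (n - m))%N by rewrite size_exp R1_size.
have p1 : (0 < size (R1 ^+ (n - m)))%N by rewrite lt0n size_poly_eq0.
have s2 := size_mul e0 V0.
have pV : (0 < size (trunc m))%N by rewrite lt0n size_poly_eq0.
have s3 : ((size (R2 ^+ m.+1)).-1 = (size R2).-1 * m.+1)%N by rewrite size_exp.
have p3 : (0 < size (R2 ^+ m.+1))%N by rewrite lt0n size_poly_eq0 expf_neq0.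
have s4 := size_polyMleq (R2 ^+ m.+1) U.
have E : R1 ^+ (n - m) * trunc m = 1 - R2 ^+ m.+1 * U by rewrite EU addrK.
have s5 := size_polyD 1 (- (R2 ^+ m.+1 * U)).
rewrite size_polyN size_poly1 -E in s5.
move: s5 s1 p1 s2 pV s3 p3 s4 sU mn; rewrite leq_max.
move: ((size R2).-1 * m.+1)%N (size (R1 ^+ _)) (size (R2 ^+ _)) (size (_ * U)) (size U) (size
  (trunc m)) (size (_ * trunc m)) => D x y z u v w.
lia.
Qed.

Lemma pencil_coprime : (0 < n)%N -> coprimep R1 R2.
Proof.
move=> n0; have [U EU _] := trunc_congr n0; rewrite subn0 in EU.
apply/Bezout_eq1_coprimepP; exists (R1 ^+ n.-1 * trunc 0, U); rewrite /= [RHS]EU.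
by rewrite -{2}(prednK n0) exprS expr1; ring.
Qed.

(** Derivative of 1 = R1^(n-m) V modulo R2^(m+1). As n = -2 in k, the exponent n - m becomes -(m+2),
    and the common power of R1 is invertible modulo R2^m. *)
Lemma trunc_deriv m : (m < n)%N -> (n.+2)%:R = 0 :> k ->
  R2 ^+ m %| m.+2%:R *: (R1^`() * trunc m) - R1 * (trunc m)^`().
Proof.
move=> mn n2; have [U /(congr1 (@deriv k)) EU _] := trunc_congr mn.
have co : coprimep (R2 ^+ m) (R1 ^+ (n - m).-1).
  by rewrite coprimep_expl // coprimep_expr // coprimep_sym pencil_coprime //; lia.
rewrite -(Gauss_dvdpr _ co).
have nm : (n - m)%:R = - (m.+2)%:R :> k.
  by apply/eqP; rewrite -addr_eq0 -natrD; apply/eqP; rewrite -[RHS]n2; congr _%:R; lia.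
move: EU; rewrite derivD !derivM !deriv_exp derivC -!scaler_nat -!mul_polyC nm.
have -> : R1 ^+ (n - m) = R1 * R1 ^+ (n - m).-1 by rewrite -exprS prednK // subn_gt0.
rewrite /= => EU.
apply/dvdpP; exists (m.+1%:R%:P * R2^`() * U + R2 * U^`()).
apply/eqP; rewrite -subr_eq0; apply/eqP.
by rewrite -[X in _ = X]oppr0 [X in _ = - X]EU polyCN [R2 ^+ m.+1]exprS; ring.
Qed.

End Truncation.

(** * Pencils through a quadratic polynomial: the odd part *)

Lemma natr_small_neq0 (k : fieldType) p m : p \in [pchar k] ->
  (0 < m)%N -> (m < p)%N -> m%:R != 0 :> k.
Proof. by move=> pk m0 mp; rewrite -(dvdn_pcharf pk) gtnNdvd. Qed.

Lemma closed_sqrt (k : closedFieldType) (x : k) : exists y, y ^+ 2 = x.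
Proof.
have [y] := @GRing.solve_monicpoly k 2 (fun i => if i == 0%N then x else 0) isT.
by rewrite !big_ord_recl big_ord0 /= mul0r mulr1 !addr0 => E; exists y.
Qed.

Section QuadraticRemainders.
Variables (k : fieldType) (e : k).
Local Notation Y := ('X : {poly k}).
Local Notation r := ('X ^+ 2 - e%:P : {poly k}).

Lemma size_quad : size r = 3%N.
Proof. by rewrite size_XnsubC. Qed.

Lemma quad_neq0 : r != 0.
Proof. by rewrite -size_poly_eq0 size_quad. Qed.

Lemma size_quadX m : size (r ^+ m) = m.*2.+1.
Proof.
have := size_exp r m; rewrite size_quad /=.
have : (0 < size (r ^+ m))%N by rewrite lt0n size_poly_eq0 expf_neq0 ?quad_neq0.
by case: (size _) => //= s _ ->; rewrite mul2n.
Qed.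

Lemma dvdp_quadX_size m (w : {poly k}) : r ^+ m %| w -> (size w <= m.*2.+1)%N ->
  exists d : k, w = d%:P * r ^+ m.
Proof.
move=> /dvdpP[u ->] su; exists u`_0; congr (_ * _); apply: size1_polyC.
have [->|u0] := eqVneq u 0; first by rewrite size_poly0.
have r0 : r ^+ m != 0 by rewrite expf_neq0 ?quad_neq0.
by move: su; rewrite size_mul // size_quadX; move: (size u) => s; lia.
Qed.

Lemma dvdp_quad_lin (u v : k) : r %| u%:P + v%:P * Y -> u = 0 /\ v = 0.
Proof.
move=> d; have E : u%:P + v%:P * Y = 0.
  apply/eqP; apply: contraTT d => E0; apply/negP => /(dvdp_leq E0).
  rewrite size_quad leqNgt ltnS (leq_trans (size_polyD _ _)) // geq_max.
  by rewrite (leq_trans (size_polyC_leq1 _)) //= mul_polyC (leq_trans (size_scale_leq _ _))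
    // size_polyX.
have := congr1 (fun f : {poly k} => f`_0) E; have := congr1 (fun f : {poly k} => f`_1) E.
by rewrite /= !coefD !coefMX !coef0 !coefC /= add0r addr0 => -> ->.
Qed.

Lemma size_quad_horner s (u v : k) (w : {poly k}) : (size w <= s)%N ->
  (size (u%:P + v%:P * Y + w * r)%R <= s.+2)%N.
Proof.
move=> sw; rewrite (leq_trans (size_polyD _ _)) // geq_max; apply/andP; split.
  rewrite (leq_trans (size_polyD _ _)) // geq_max (leq_trans (size_polyC_leq1 _)) //.
  by rewrite mul_polyC (leq_trans (size_scale_leq _ _)) // size_polyX.
rewrite (leq_trans (size_polyMleq _ _)) // size_quad addnC /=; exact: sw.
Qed.

Lemma size_quad_base (u v : k) : (size (u%:P + v%:P * Y)%R <= 2)%N.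
Proof. by have := @size_quad_horner 0 u v 0; rewrite mul0r addr0 size_poly0; apply. Qed.

Lemma dvdp_quadX_lin m (u v : k) (w z : {poly k}) : r ^+ m.+1 %| w ->
  w = (u%:P + v%:P * Y + z * r) * r ^+ m -> u = 0 /\ v = 0.
Proof.
rewrite exprS => + E; rewrite E dvdp_mul2r ?expf_neq0 ?quad_neq0 // => d.
by apply: dvdp_quad_lin; rewrite -(dvdp_addl _ (dvdp_mull z (dvdpp r))).
Qed.

End QuadraticRemainders.

Section OddPart.
Variables (p : nat) (k : closedFieldType) (n : nat) (q : nat -> {poly k}).
Hypothesis pk : p \in [pchar k].
Hypothesis p_n : p = n.+2.
Hypothesis p_ge5 : (4 < p)%N.
Variables al mu nu e : k.
Local Notation Y := ('X : {poly k}).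
Local Notation r := ('X ^+ 2 - e%:P : {poly k}).
(** A monic quartic in base r. The digit of r has no constant term because adding a multiple of r to
    R1 does not change the pencil. *)
Local Notation R1 := (r ^+ 2 + al%:P * Y * r + mu%:P * Y + nu%:P).
Hypothesis q_size : forall i, (size (q i) <= 3)%N.
Hypothesis E1 : \sum_(i < n.+1) q i * R1 ^+ (n - i) * r ^+ i = 1.
Local Notation V := (trunc q R1 r).

Let nz2 : 2%:R != 0 :> k. Proof. by apply: (natr_small_neq0 pk) => //; lia. Qed.
Let nz3 : 3%:R != 0 :> k. Proof. by apply: (natr_small_neq0 pk) => //; lia. Qed.
Let n2 : n.+2%:R = 0 :> k. Proof. by rewrite -p_n (pcharf0 pk). Qed.
Let r_size : size r = 3%N := size_quad e.
Let r_neq0 : r != 0 := quad_neq0 e.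

Lemma size_quartic_low : (size (al%:P * Y * r + (mu%:P * Y + nu%:P))%R < size (r ^+ 2))%N.
Proof.
rewrite size_quadX (leq_ltn_trans (size_polyD _ _)) // gtn_max; apply/andP; split.
  rewrite (leq_ltn_trans (size_polyMleq _ _)) // size_quad mul_polyC.
  by have := size_scale_leq al Y; rewrite size_polyX; case: (size _) => [|[|[|]]].
rewrite (leq_ltn_trans (size_polyD _ _)) // gtn_max (leq_ltn_trans (size_polyC_leq1 _)) //
  andbT.
by rewrite mul_polyC (leq_ltn_trans (size_scale_leq _ _)) // size_polyX.
Qed.

Lemma size_quartic : size R1 = 5%N.
Proof. by rewrite -!addrA size_polyDl ?size_quartic_low // size_quadX. Qed.

Lemma monic_quartic : R1 \is monic.
Proof.
rewrite -!addrA monicE lead_coefDl ?size_quartic_low //; apply/eqP/monicP.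
by rewrite monic_exp // monicXnsubC.
Qed.

Lemma deriv_quartic : R1^`() = 4 * Y * r + al%:P * (r + 2 * Y ^+ 2) + mu%:P.
Proof. rewrite !derivE; ring. Qed.

Lemma coprime_quartic : coprimep R1 r.
Proof. by apply: (pencil_coprime q_size size_quartic r_neq0 _ E1); rewrite ?r_size //; lia. Qed.

Lemma size_trunc_quartic m : (m < n)%N -> (size (V m) <= m.*2.+1)%N.
Proof.
move=> mn; have := size_trunc q_size size_quartic r_neq0 _ E1 mn.
by rewrite r_size => /(_ isT); lia.
Qed.

Lemma trunc_deriv_quartic m : (m < n)%N -> r ^+ m %| m.+2%:R *: (R1^`() * V m) - R1 * (V m)^`().
Proof.
by move=> mn; apply: (trunc_deriv q_size size_quartic r_neq0 _ E1); rewrite ?r_size.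
Qed.

(** If x^2 = e, then nu + mu x and nu - mu x are the values of R1 at the two roots of r, and R1 is
    coprime to r. *)
Lemma resultant_neq0 : nu ^+ 2 - mu ^+ 2 * e != 0.
Proof.
have [y yE] := closed_sqrt e; apply/eqP => E.
have : (nu - mu * y) * (nu + mu * y) = 0 by rewrite -E -yE; ring.
have ev x : x ^+ 2 = e -> nu + mu * x <> 0.
  move=> xE E0; have rx : root r x by rewrite /root !hornerE xE subrr.
  have := coprimep_root (p := r) (q := R1) _ rx; rewrite coprimep_sym coprime_quartic.
  by move=> /(_ isT)/eqP; apply; rewrite !hornerE xE subrr -[RHS]E0 expr0n /=; ring.
move/eqP; rewrite mulf_eq0 => /orP[] /eqP.
  by rewrite -mulrN; apply: ev; rewrite sqrrN.
exact: ev.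
Qed.

Lemma trunc0_const : exists2 c : k, c != 0 & V 0 = c%:P.
Proof.
have n0 : (0 < n)%N by lia.
have /size1_polyC V0 := size_trunc_quartic n0; exists (V 0)`_0 => //.
apply/eqP => c0; have [|U] := trunc_congr q_size size_quartic r_neq0 _ E1 n0.
  by rewrite r_size.
rewrite V0 c0 mulr0 add0r expr1 => E _.
have : r %| 1 by rewrite E dvdp_mulr.
by rewrite dvdp1 r_size.
Qed.

(** W stands for the remainder of R1 V_m modulo r^(m+1). The next truncation agrees with it modulo
    r^(m+1) and has degree at most 2(m+1), which leaves one free scalar d. *)
Lemma truncS_quartic m (W Z : {poly k}) : (m.+1 < n)%N -> R1 * V m = W + Z * r ^+ m.+1 ->
  (size W <= m.+1.*2.+1)%N -> exists d : k, V m.+1 = W + d%:P * r ^+ m.+1.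
Proof.
move=> mn E sW; have : r ^+ m.+1 %| V m.+1 - W.
  have -> : V m.+1 - W = (Z + q m.+1) * r ^+ m.+1 by rewrite truncS E; ring.
  exact: dvdp_mulIr.
move=> /dvdp_quadX_size[|d Ed]; last by exists d; rewrite -Ed; ring.
by rewrite (leq_trans (size_polyD _ _)) // size_polyN geq_max size_trunc_quartic.
Qed.

Lemma truncS_scaled m (c : k) (W Z : {poly k}) : c != 0 -> (m.+1 < n)%N ->
  R1 * V m = c%:P * (W + Z * r ^+ m.+1) -> (size W <= m.+1.*2)%N ->
  exists d : k, V m.+1 = c%:P * (W + d%:P * r ^+ m.+1).
Proof.
move=> c0 mn E sW.
have [||d ->] := @truncS_quartic m (c%:P * W) (c%:P * Z) mn; first by rewrite E; ring.
  by rewrite mul_polyC (leq_trans (size_scale_leq _ _)) // leqW.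
by exists (d / c); rewrite mulrDr mulrA -polyCM [c * _]mulrC divfK.
Qed.

(** The left side is divisible by r^(m+1) although its expansion in base r starts at r^m, so the
    first digit u + v X must vanish. These are the two scalar equations of each step. *)
Lemma trunc_relation m (c u v : k) (W z : {poly k}) : c != 0 -> (m.+1 < n)%N -> V m.+1 = c%:P
  * W ->
  m.+3%:R * (R1^`() * W) - R1 * W^`() = (u%:P + v%:P * Y + z * r) * r ^+ m ->
  u = 0 /\ v = 0.
Proof.
move=> c0 mn E Ew; have := trunc_deriv_quartic mn; rewrite E derivM derivC mul0r add0r.
rewrite (_ : _ *: _ - _ = c *: (m.+3%:R * (R1^`() * W) - R1 * W^`())); last first.
  by rewrite scaler_nat -mul_polyC -mulr_natl; ring.
by rewrite dvdpZr // => /dvdp_quadX_lin; apply; exact: Ew.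
Qed.

Lemma trunc1_quartic : exists2 c : k, c != 0 & mu = - 3 * al * e /\ V 1 = c%:P * (mu%:P * Y +
  nu%:P).
Proof.
have [c c0 V0] := trunc0_const; exists c => //.
have n1 : (1 < n)%N by lia.
have [||d Vd] := @truncS_quartic 0 (c%:P * (mu%:P * Y + nu%:P)) (c%:P * (r + al%:P * Y)) n1.
- by rewrite V0 expr1; ring.
- rewrite mul_polyC (leq_trans (size_scale_leq _ _)) // (leq_trans (size_polyD _ _)) // geq_max.
  by rewrite (leq_trans (size_polyC_leq1 _)) // mul_polyC (leq_trans (size_scale_leq _ _))
    ?size_polyX.
have := trunc_deriv_quartic n1; rewrite Vd !expr1.
(* Modulo r the relation is R1 times a linear polynomial. As R1 is invertible there, both
   coefficients vanish: one gives mu, the other d = 0. *)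
rewrite (_ : _ *: _ - _ = R1 * ((c * (6 * al * e + 2 * mu))%:P + (- 2 * d)%:P * Y)
  + (3 * (d%:P - c%:P * (r + al%:P * Y)) * R1^`() + 3 * c%:P * R1 * (4 * Y + 3 * al%:P)) *
    r); last first.
  rewrite scaler_nat deriv_quartic !derivE !polyCM polyCD !polyCM; ring.
rewrite (dvdp_addl _ (dvdp_mull _ (dvdpp _))) Gauss_dvdpr 1?coprimep_sym ?coprime_quartic //.
case/dvdp_quad_lin => /eqP; rewrite mulf_eq0 (negPf c0) /= => /eqP Emu Ed.
have d0 : d = 0 by apply/eqP; move/eqP: Ed; rewrite mulf_eq0 oppr_eq0 (negPf nz2).
rewrite d0 mul0r addr0; split=> //.
apply: (mulfI nz2); apply/eqP; rewrite -subr_eq0; apply/eqP; rewrite -[RHS]Emu; ring.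
Qed.

End OddPart.

Section Coprime.
Variables (p : nat) (k : closedFieldType) (n : nat) (q : nat -> {poly k}).
Hypothesis pk : p \in [pchar k].
Hypothesis p_n : p = n.+2.
Hypothesis p_ge5 : (4 < p)%N.
Hypothesis q_size : forall i, (size (q i) <= 3)%N.
Local Notation Y := ('X : {poly k}).
Local Notation quad e := ('X ^+ 2 - e%:P : {poly k}).
Local Notation quart al mu nu e :=
  (quad e ^+ 2 + al%:P * Y * quad e + mu%:P * Y + nu%:P).
Local Notation one_eq al mu nu e :=
  (\sum_(i < n.+1) q i * quart al mu nu e ^+ (n - i) * quad e ^+ i = 1).

(* Here and below, the coefficients of the truncations and of their relations
   come from expanding in powers of the quadratic polynomial, with remainders
   of degree at most 1. *)
Lemma trunc2_quartic (al nu e : k) : one_eq al (- 3 * al * e) nu e ->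
  exists c d, [/\ c != 0,
    trunc q (quart al (- 3 * al * e) nu e) (quad e) 2 = c%:P *
     ((9 * al ^+ 2 * e ^+ 3 + nu ^+ 2)%:P + (- 6 * al * nu * e)%:P * Y
      + ((6 * al ^+ 2 * e ^+ 2)%:P + (al * nu)%:P * Y) * quad e + d%:P * quad e ^+ 2),
    al * (108 * al ^+ 2 * e ^+ 3 + 9 * nu ^+ 2 - 96 * nu * e ^+ 2 + 12 * d * e ^+ 2) = 0 &
    - 63 * al ^+ 2 * nu * e + 144 * al ^+ 2 * e ^+ 3 + 16 * nu ^+ 2 - 4 * nu * d = 0].
Proof.
move=> E1; have [c c0 [_ V1]] := trunc1_quartic pk p_n p_ge5 q_size E1.
have n2 : (2 < n)%N by lia.
pose W := (9 * al ^+ 2 * e ^+ 3 + nu ^+ 2)%:P + (- 6 * al * nu * e)%:P * Y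
      + ((6 * al ^+ 2 * e ^+ 2)%:P + (al * nu)%:P * Y) * quad e.
pose Z := (- 3 * al ^+ 2 * e + nu)%:P + (- 3 * al * e)%:P * Y.
have [||d V2] := @truncS_scaled p _ n q pk p_n p_ge5 al (- 3 * al * e) nu e q_size E1 1 c W Z
  c0 n2.
- by rewrite V1 /W /Z; ring.
- by rewrite /W size_quad_horner ?size_quad_base.
exists c, d.
pose u := al * (108 * al ^+ 2 * e ^+ 3 + 9 * nu ^+ 2 - 96 * nu * e ^+ 2 + 12 * d * e ^+ 2).
pose v := - 63 * al ^+ 2 * nu * e + 144 * al ^+ 2 * e ^+ 3 + 16 * nu ^+ 2 - 4 * nu * d.
pose z := ((60 * al ^+ 3 * e ^+ 2 - 76 * al * nu * e + 4 * al * d * e)%:P + (9 * al ^+ 2 * nu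
  + 84 * al ^+ 2 * e ^+ 2)%:P * Y + ((13 * al * nu + 8 * al * d)%:P + (12 * d)%:P * Y) * quad
  e).
have [] := @trunc_relation p _ n q pk p_n al (- 3 * al * e) nu e q_size E1 1 c u v _ z c0 n2 V2.
  by rewrite deriv_quartic /W /u /v /z !derivE; ring.
by move=> Eu Ev; split.
Qed.

(** For al != 0, eliminating d from the two equations of [trunc2_quartic] leaves 3 (3 nu - 16 e^2)
    times the resultant nu^2 - mu^2 e, which is not zero. *)
Lemma odd_dichotomy (al mu nu e : k) : one_eq al mu nu e ->
  mu = - 3 * al * e /\ (al = 0 \/ 3 * nu = 16 * e ^+ 2).
Proof.
move=> E1; have [_ _ [Emu _]] := trunc1_quartic pk p_n p_ge5 q_size E1.
rewrite {}Emu in E1 *; split=> //.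
have [c [d [_ _ Eu Ev]]] := trunc2_quartic E1.
have res := resultant_neq0 pk p_n p_ge5 q_size E1.
have [->|al0] := eqVneq al 0; [by left | right].
move/eqP: Eu; rewrite mulf_eq0 (negPf al0) /= => /eqP Eu.
have nz3 : 3%:R != 0 :> k by apply: (natr_small_neq0 pk) => //; lia.
apply/eqP; rewrite -subr_eq0 -(mulIr_eq0 _ (mulIf res)) -(mulrI_eq0 _ (mulfI nz3)).
apply/eqP; transitivity (nu * (108 * al ^+ 2 * e ^+ 3 + 9 * nu ^+ 2 - 96 * nu * e ^+ 2 + 12 *
  d * e ^+ 2)
 + 3 * e ^+ 2 * (- 63 * al ^+ 2 * nu * e + 144 * al ^+ 2 * e ^+ 3 + 16 * nu ^+ 2 - 4 * nu *
   d)); first by ring.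
by rewrite Eu Ev !mulr0 addr0.
Qed.

End Coprime.

Section Coprime2.
Variables (p : nat) (k : closedFieldType) (n : nat) (q : nat -> {poly k}).
Hypothesis pk : p \in [pchar k].
Hypothesis p_n : p = n.+2.
Hypothesis p_ge5 : (4 < p)%N.
Hypothesis q_size : forall i, (size (q i) <= 3)%N.
Local Notation Y := ('X : {poly k}).
Local Notation quad e := ('X ^+ 2 - e%:P : {poly k}).
Local Notation quart al mu nu e :=
  (quad e ^+ 2 + al%:P * Y * quad e + mu%:P * Y + nu%:P).
Local Notation one_eq al mu nu e :=
  (\sum_(i < n.+1) q i * quart al mu nu e ^+ (n - i) * quad e ^+ i = 1).

(** The one family on which the fourth truncation gives no contradiction for p = 11. Modulo r the
    constant term of R1^2 is -144 * 11 * b^8 = 0, so R1^2 is t X and R1^8 is the constant t^4 e^2.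
    Then c1 R1^9 = 1 would make R1 constant modulo r, but its coefficient of X is 36 b^3. *)
Lemma odd_part_eleven (b : k) : p = 11%N ->
  one_eq (4 * b) (- 3 * (4 * b) * (3 * - b ^+ 2)) (48 * (- b ^+ 2) ^+ 2) (3 * - b ^+ 2) -> b
    = 0.
Proof.
move=> p11 E1; apply/eqP/negPn/negP => b0.
have n9 : n = 9%N by lia.
have E11 : 11%:R = 0 :> {poly k} by apply/eqP; rewrite -(dvdn_pcharf (rmorph_pchar polyC pk))
  p11.
have [c1 c10 V0] := trunc0_const pk p_n p_ge5 q_size E1.
have n0 : (0 < n)%N by rewrite n9.
have [|U EU _] := trunc_congr q_size (size_quartic _ _ _ _) (quad_neq0 _) _ E1 n0.
  by rewrite size_quad.
rewrite V0 subn0 n9 expr1 in EU.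
set r : {poly k} := quad (3 * - b ^+ 2) in EU; set R := quart _ _ _ _ in EU.
pose t := 128 * 27 * b ^+ 7.
have d2 : r %| R ^+ 2 - t%:P * Y.
  apply/dvdpP; exists (216 * 6 * b%:P ^+ 6 + (r + 4 * b%:P * Y) * (2 * (36 * b%:P ^+ 3 * Y +
    48 * b%:P ^+ 4) + r * (r + 4 * b%:P * Y))).
  apply/eqP; rewrite -subr_eq0; apply/eqP.
  transitivity (11%:R * (- 144 * b%:P ^+ 8 : {poly k})); last by rewrite E11 mul0r.
  by rewrite /R /r /t; ring.
have d8 : r %| R ^+ 8 - (9 * t ^+ 4 * b ^+ 4)%:P.
  rewrite (_ : _ - _ = ((R ^+ 2) ^+ 4 - (t%:P * Y) ^+ 4) + (t%:P ^+ 4 * (Y ^+ 2 - 3 * b%:P ^+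
    2)) * r).
    by rewrite dvdp_add ?dvdp_mull // subrXX dvdp_mulr.
  by rewrite /r; ring.
have : r %| (9 * t ^+ 4 * b ^+ 4 * c1 * (48 * b ^+ 4) - 1)%:P + (9 * t ^+ 4 * b ^+ 4 * c1 *
  (36 * b ^+ 3))%:P * Y.
  rewrite (_ : _ + _ = r * (- U - (9 * t ^+ 4 * b ^+ 4 * c1)%:P * (r + 4 * b%:P * Y)) - (R ^+
    8 - (9 * t ^+ 4 * b ^+ 4)%:P) * (R * c1%:P)).
    by rewrite dvdp_sub ?dvdp_mulr.
  have {}EU : R ^+ 8 * R * c1%:P = 1 - r * U by rewrite [X in X - _]EU; ring.
  transitivity (- (r * U) - (1 - r * U) - (9 * t ^+ 4 * b ^+ 4 * c1)%:P * (r * (r + 4 * b%:P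
    * Y) - R)); last by rewrite -EU; ring.
  by rewrite /R -/r; ring.
case/dvdp_quad_lin => _ /eqP; rewrite /t !(mulf_eq0, expf_eq0) (negPf c10) (negPf b0) /=.
rewrite ?andbF ?orbF -!(dvdn_pcharf pk) p11.
by [].
Qed.


(** The parameter h solves 3 nu = 16 e^2 without denominators. If al != 0, the third truncation
    gives (27 al^2 - 256 h)(al^2 + 16 h) = 0. The first factor divides the resultant; on the second,
    al = 4 b and h = - b^2, and the fourth truncation, available since n >= 5, gives 11 * 43 = 0. *)
Lemma odd_part_large (al h : k) : (6 < p)%N ->
  one_eq al (- 3 * al * (3 * h)) (48 * h ^+ 2) (3 * h) -> al = 0.
Proof.
move=> p7 E1; apply/eqP/negPn/negP => al0.
have nz2 : 2%:R != 0 :> k by apply: (natr_small_neq0 pk) => //; lia.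
have nz3 : 3%:R != 0 :> k by apply: (natr_small_neq0 pk) => //; lia.
have nz5 : 5%:R != 0 :> k by apply: (natr_small_neq0 pk) => //; lia.
have res := resultant_neq0 pk p_n p_ge5 q_size E1.
have h0 : h != 0.
  by apply: contraNneq res => ->; rewrite !mulr0 !expr0n /= !mulr0 subr0 expr0n.
have [c [d [c0 V2 Eu _]]] := trunc2_quartic pk p_n p_ge5 q_size E1.
have Ed : d = 192 * h ^+ 2 - 27 * al ^+ 2 * h.
  apply/eqP; rewrite -subr_eq0.
  rewrite -(mulrI_eq0 _ (mulfI nz2)) -(mulrI_eq0 _ (mulfI nz2)).
  rewrite -(mulrI_eq0 _ (mulfI nz3)) -(mulrI_eq0 _ (mulfI nz3)) -(mulrI_eq0 _ (mulfI nz3)).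
  rewrite -(mulrI_eq0 _ (mulfI h0)) -(mulrI_eq0 _ (mulfI h0)) -(mulrI_eq0 _ (mulfI al0)).
  by rewrite -[X in _ == X]Eu; apply/eqP; ring.
rewrite {}Ed in V2 => {Eu}.
have n3 : (3 < n)%N by lia.
pose W := ((243 * 144) * al ^+ 2 * h ^+ 5 + (256 * (216 * 2)) * h ^+ 6)%:P + (- (243 * 9) *
  al ^+ 3 * h ^+ 4 - (256 * 243) * al * h ^+ 5)%:P * Y + (((240 * 27) * al ^+ 2 * h ^+ 4)%:P
  + (- 243 * al ^+ 3 * h ^+ 3 + (256 * 18) * al * h ^+ 4)%:P * Y + ((- (245 * 9) * al ^+ 2 *
  h ^+ 3 + (256 * 45) * h ^+ 4)%:P + ((99 * 3) * al ^+ 3 * h ^+ 2 - (216 * 12) * al * h ^+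
  3)%:P * Y) * quad (3 * h)) * quad (3 * h).
pose Z := (102 * al ^+ 2 * h ^+ 2)%:P + (- 27 * al ^+ 3 * h + 240 * al * h ^+ 2)%:P * Y + ((-
  27 * al ^+ 2 * h + 192 * h ^+ 2)%:P) * quad (3 * h).
have [||d3 V3] := @truncS_scaled p _ n q pk p_n p_ge5 _ _ _ _ q_size E1 2 c W Z c0 n3.
- by rewrite V2 /W /Z; ring.
- by rewrite /W !size_quad_horner ?size_quad_base.
pose u := al * (- (228 * (135 * 2)) * al ^+ 2 * h ^+ 4 + 162 * d3 * h ^+ 2 - (256 * (162 *
  5)) * h ^+ 5).
pose v := (243 * 10) * al ^+ 4 * h ^+ 3 + (240 * (174 * 3)) * al ^+ 2 * h ^+ 4 - (144 * 2) *
  d3 * h ^+ 2.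
pose z := ((- (157 * 90) * al ^+ 3 * h ^+ 3 + 21 * al * d3 * h + (256 * (105 * 3)) * al * h
  ^+ 4)%:P + ((198 * 15) * al ^+ 4 * h ^+ 2 - (255 * 240) * al ^+ 2 * h ^+ 3 + (256 * (240 *
  3)) * h ^+ 4)%:P * Y + (((165 * 27) * al ^+ 3 * h ^+ 2 + 9 * al * d3 - (243 * 160) * al * h
  ^+ 3)%:P + (14 * d3)%:P * Y) * quad (3 * h)).
have [] := @trunc_relation p _ n q pk p_n _ _ _ _ q_size E1 2 c u v _ z c0 n3 V3.
  by rewrite deriv_quartic /W /u /v /z !derivE; ring.
move=> /eqP; rewrite mulf_eq0 (negPf al0) /= => /eqP Eu Ev.
have Ed3 : 9 * d3 = (171 * 20) * al ^+ 2 * h ^+ 2 + (256 * 45) * h ^+ 3.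
  apply/eqP; rewrite -subr_eq0.
  rewrite -(mulrI_eq0 _ (mulfI nz2)) -(mulrI_eq0 _ (mulfI nz3)) -(mulrI_eq0 _ (mulfI nz3)).
  rewrite -(mulrI_eq0 _ (mulfI h0)) -(mulrI_eq0 _ (mulfI h0)).
  by rewrite -[X in _ == X]Eu; apply/eqP; ring.
have : (27 * al ^+ 2 - 256 * h) * (al ^+ 2 + 16 * h) = 0.
  apply/eqP; rewrite -(mulrI_eq0 _ (mulfI nz2)) -(mulrI_eq0 _ (mulfI nz5)) -(mulrI_eq0 _
    (mulfI nz3)) -(mulrI_eq0 _ (mulfI nz3)).
  rewrite -(mulrI_eq0 _ (mulfI h0)) -(mulrI_eq0 _ (mulfI h0)) -(mulrI_eq0 _ (mulfI h0)).
  (* The multiple 32 h^2 of the equation for d3 cancels d3 in v. *)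
  apply/eqP; transitivity (v + 32 * h ^+ 2 * (9 * d3 - ((171 * 20) * al ^+ 2 * h ^+ 2 + (256
    * 45) * h ^+ 3))).
    by rewrite /v; ring.
  by rewrite Ed3 subrr mulr0 addr0 Ev.
move/eqP; rewrite mulf_eq0 => /orP[/eqP E27|/eqP E16].
  case/negP: res; apply/eqP; transitivity (- 9 * h ^+ 3 * (27 * al ^+ 2 - 256 * h)); first by
    ring.
  by rewrite E27 mulr0.
pose b := al / 2 / 2.
have Eal : al = 4 * b.
  by rewrite /b (_ : 4 = 2%:R * 2%:R) ?[2%:R * 2%:R * _]mulrC ?mulrA ?divfK //; ring.
have Eh : h = - b ^+ 2.
  apply/eqP; rewrite -subr_eq0; do 4 rewrite -(mulrI_eq0 _ (mulfI nz2)).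
  by rewrite -[X in _ == X]E16 Eal; apply/eqP; ring.
have b0 : b != 0 by apply: contraNneq al0 => b0; rewrite Eal b0 mulr0.
move: b Eal Eh b0 => b Eal Eh b0; subst al h.
have Ed3' : d3 = (240 * 20) * b ^+ 6.
  apply/eqP; rewrite -subr_eq0; do 2 rewrite -(mulrI_eq0 _ (mulfI nz3)).
  by apply/eqP; transitivity (9 * d3 - (9 * (240 * 20)) * b ^+ 6); [ring | rewrite Ed3; ring].
rewrite {}Ed3' in V3.
have n4 : (4 < n)%N by lia.
pose W4 := (- (256 * (81 * (16 * 100 + 7))) * b ^+ 16)%:P + (- (256 * (243 * 176)) * b ^+
  15)%:P * Y + (((256 * (243 * 63)) * b ^+ 14)%:P + ((256 * (172 * 81)) * b ^+ 13)%:P * Y +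
  ((- (256 * (243 * 2)) * b ^+ 12)%:P + ((216 * (48 * (3 * 100 + 49))) * b ^+ 11)%:P * Y +
  (((256 * (255 * 18)) * b ^+ 10)%:P + ((256 * (171 * 9)) * b ^+ 9)%:P * Y) * quad (3 * - b
  ^+ 2)) * quad (3 * - b ^+ 2)) * quad (3 * - b ^+ 2).
pose Z4 := ((252 * (163 * 4)) * b ^+ 8)%:P + ((253 * 192) * b ^+ 7)%:P * Y + (((240 * 20) * b
  ^+ 6)%:P) * quad (3 * - b ^+ 2).
have [||d4 V4] := @truncS_scaled p _ n q pk p_n p_ge5 _ _ _ _ q_size E1 3 c W4 Z4 c0 n4.
- by rewrite V3 /W /W4 /Z4; ring.
- by rewrite /W4 !size_quad_horner ?size_quad_base.
pose u4 := - (256 * (243 * (218 * 27))) * b ^+ 13 + (216 * 4) * b ^+ 5 * d4.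
pose v4 := (256 * (238 * (87 * 27))) * b ^+ 12 - (192 * 2) * b ^+ 4 * d4.
pose z4 := (((233 * (216 * (172 * 12))) * b ^+ 11 - 120 * b ^+ 3 * d4)%:P + ((256 * (232 *
  (216 * 3))) * b ^+ 10)%:P * Y + (((256 * (171 * 153)) * b ^+ 9 + 40 * b * d4)%:P + (16 *
  d4)%:P * Y) * quad (3 * - b ^+ 2)).
have [] := @trunc_relation p _ n q pk p_n _ _ _ _ q_size E1 3 c u4 v4 _ z4 c0 n4 V4.
  by rewrite deriv_quartic /W4 /u4 /v4 /z4 !derivE; ring.
move=> Eu4 Ev4.
have E473 : 11%:R * 43%:R = 0 :> k.
  apply/eqP; rewrite -(mulIr_eq0 _ (mulIf (expf_neq0 13 b0))).
  do 9 rewrite -(mulrI_eq0 _ (mulfI nz2)); do 6 rewrite -(mulrI_eq0 _ (mulfI nz3)).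
  (* This combination cancels d4; what remains is -2^9 3^6 * 11 * 43 * b^13. *)
  rewrite -oppr_eq0; apply/eqP; transitivity (4 * u4 + 9 * b * v4); first by rewrite /u4 /v4;
    ring.
  by rewrite Eu4 Ev4 !mulr0 addr0.
move/eqP: E473; rewrite mulf_eq0 => /orP[|/eqP E43]; last first.
  (* On this family the resultant itself is a multiple of 43. *)
  case/negP: res; apply/eqP; transitivity (43%:R * (144 * b ^+ 8)); first by ring.
  by rewrite E43 mul0r.
rewrite -(dvdn_pcharf pk) dvdn_prime2 ?(pcharf_prime pk) // => /eqP p11.
by case/negP: b0; apply/eqP/(odd_part_eleven p11 E1).
Qed.

End Coprime2.

(** * Pencils through a quadratic polynomial: the even part *)

(** If f were nonzero, f X + 1 would be nonconstant and have a root; that root is not 0, and f does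
    not vanish there. *)
Lemma poly_eq0_horner (k : closedFieldType) (f : {poly k}) :
  (forall x, x != 0 -> f.[x] = 0) -> f = 0.
Proof.
move=> fx; apply/eqP/negPn/negP => f0.
have : size (f * 'X + 1) != 1%N.
  by rewrite size_MXaddC (negPf f0) /= eqSS size_poly_eq0.
case/closed_rootP => x; rewrite /root !hornerE.
by have [->|/fx ->] := eqVneq x 0; rewrite ?mulr0 ?mul0r add0r oner_eq0.
Qed.

Section Even.
Variables (p : nat) (k : closedFieldType) (n : nat).
Hypothesis pk : p \in [pchar k].
Hypothesis p_n : p = n.+2.
Hypothesis p_ge5 : (4 < p)%N.
Variables (nu : k).
Hypothesis nu0 : nu != 0.

(* y |-> nu / y fixes the point (y^2 + nu : y) of the projective line, so that
   the identity determines F2. *)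
Lemma even_flip (F2 F0 : k -> k -> k) (e : k) :
  (forall c s t, F2 (c * s) (c * t) = c ^+ n * F2 s t) ->
  (forall c s t, F0 (c * s) (c * t) = c ^+ n * F0 s t) ->
  (forall y, F2 (y ^+ 2 + nu) y * (y + e) + F0 (y ^+ 2 + nu) y = 1) ->
  forall y, y != 0 ->
    nu ^+ n * (y ^+ 2 - nu) * F2 (y ^+ 2 + nu) y = y * (nu ^+ n - y ^+ (2 * n)).
Proof.
move=> h2 h0 E y y0; have Ey := E y; have := E (nu / y).
have e1 : (nu / y) ^+ 2 + nu = (nu / y ^+ 2) * (y ^+ 2 + nu) by field.
have e2 : nu / y = (nu / y ^+ 2) * y by field.
rewrite e1 [X in F2 _ X]e2 [X in F0 _ X]e2 h2 h0 expr_div_n -exprM.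
set f2 := F2 _ _ in Ey *; set f0 := F0 _ _ in Ey *.
have -> : f0 = 1 - f2 * (y + e) by rewrite -Ey; ring.
have yn : y ^+ (2 * n) != 0 by rewrite expf_neq0.
move=> /(congr1 (fun z => z * (y ^+ (2 * n) * y))).
have -> : (nu ^+ n / y ^+ (2 * n) * f2 * (nu / y + e) + nu ^+ n / y ^+ (2 * n) * (1 - f2 * (y
  + e))) * (y ^+ (2 * n) * y) = nu ^+ n * (f2 * (nu - y ^+ 2) + y) by field; rewrite yn.
move=> E3; transitivity (nu ^+ n * y - nu ^+ n * (f2 * (nu - y ^+ 2) + y)); first by ring.
by rewrite E3; ring.
Qed.

Variables (e : k) (cart_coef : nat -> {poly k}) (g a1 a2 b1 b2 : k).
Hypothesis size_cart_coef : forall j, (size (cart_coef j) <= 3)%N.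
Hypothesis a1_neq0 : a1 != 0.
Local Notation r := ('X ^+ 2 - e%:P : {poly k}).
Local Notation R1 := (r ^+ 2 + nu%:P).
Hypothesis E1 : g *: (\sum_(j < n.+1) cart_coef j * (a1 *: R1 + a2 *: r) ^+ j
   * (b1 *: R1 + b2 *: r) ^+ (n - j)) = 1.

(** The coefficient of x^l when the identity is evaluated at x: a form of degree n in the values s
    of R1 and t of r. *)
Definition kform l (s t : k) := g * \sum_(j < n.+1) (cart_coef j)`_l *
  (a1 * s + a2 * t) ^+ j * (b1 * s + b2 * t) ^+ (n - j).

Lemma kform_hom l c s t : kform l (c * s) (c * t) = c ^+ n * kform l s t.
Proof.
rewrite /kform [RHS]mulrCA; congr (_ * _); rewrite mulr_sumr; apply: eq_bigr => j _.
have -> : c ^+ n = c ^+ j * c ^+ (n - j) by rewrite -exprD subnKC ?leq_ord.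
have -> : a1 * (c * s) + a2 * (c * t) = c * (a1 * s + a2 * t) by ring.
have -> : b1 * (c * s) + b2 * (c * t) = c * (b1 * s + b2 * t) by ring.
by rewrite !exprMn; ring.
Qed.

(** With y = r(x), R1 takes the value y^2 + nu at both x and -x. Averaging the identity over the two
    points removes the term that is odd in x. *)
Lemma kform_eq y : kform 2 (y ^+ 2 + nu) y * (y + e) + kform 0 (y ^+ 2 + nu) y = 1.
Proof.
have nz2 : 2%:R != 0 :> k by apply: (natr_small_neq0 pk) => //; lia.
have ev x : x ^+ 2 = y + e -> kform 2 (y ^+ 2 + nu) y * (y + e) + kform 1 (y ^+ 2 + nu) y * x
  + kform 0 (y ^+ 2 + nu) y = 1.
  move=> xE; have := congr1 (fun f : {poly k} => f.[x]) E1; rewrite hornerC hornerZ => <-.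
  rewrite horner_sum /kform -!mulrA -!mulrDr !mulr_suml -!big_split /=; congr (_ * _).
  apply: eq_bigr => j _; rewrite !hornerE xE addrK.
  have -> : (cart_coef j).[x] = (cart_coef j)`_0 + (cart_coef j)`_1 * x + (cart_coef j)`_2 *
    x ^+ 2.
    rewrite (horner_coef_wide _ (size_cart_coef j)) !big_ord_recl big_ord0 /=; ring.
  by rewrite xE; ring.
have [x xE] := closed_sqrt (y + e).
have E2 := ev x xE; have := ev (- x); rewrite sqrrN => /(_ xE) E3.
apply: (mulfI nz2); rewrite mulr1; transitivity (1 + 1 : k); last by ring.
by have <- := congr2 +%R E2 E3; ring.
Qed.

Lemma sum_ord_shift2 (F : nat -> k) : (1 < n)%N ->
  \sum_(j < n.+1) F j = F 0%N + F 1%N + \sum_(j < n.-1) F j.+2.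
Proof. by case: n => [|[|m]] // _; rewrite !big_ord_recl /= addrA. Qed.

(** The two hypotheses say that a^2 divides the form of x^2. By [even_flip], A^2 then divides X
    (nu^n - X^(2n)), so a root of A is a double root of it; but its nonzero roots are simple, as p
    does not divide 2n. *)
Lemma even_part_large : (cart_coef 0%N)`_2 = 0 -> (cart_coef 1%N)`_2 = 0 -> False.
Proof.
move=> k0 k1.
pose A : {poly k} := a1 *: ('X ^+ 2 + nu%:P) + a2 *: 'X.
pose B : {poly k} := b1 *: ('X ^+ 2 + nu%:P) + b2 *: 'X.
pose C := g *: \sum_(j < n.-1) (cart_coef j.+2)`_2 *: (A ^+ j * B ^+ (n - j.+2)).
have AE x : A.[x] = a1 * (x ^+ 2 + nu) + a2 * x by rewrite /A !hornerE.
have BE x : B.[x] = b1 * (x ^+ 2 + nu) + b2 * x by rewrite /B !hornerE.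
have CE x : kform 2 (x ^+ 2 + nu) x = (A ^+ 2 * C).[x].
  rewrite /kform (sum_ord_shift2 (fun j => (cart_coef j)`_2 * _ ^+ j * _ ^+ (n - j))); last
    by lia.
  rewrite k0 k1 !mul0r !add0r /C -scalerAr hornerZ [A ^+ 2 * _]mulr_sumr horner_sum; congr (_
    * _).
  apply: eq_bigr => j _; rewrite -AE -BE -scalerAr !hornerZ !hornerM !horner_exp [_ ^+
    j.+2]exprS [_ ^+ j.+1]exprS; ring.
have EC : nu ^+ n *: (('X ^+ 2 - nu%:P) * (A ^+ 2 * C)) = 'X * ((nu ^+ n)%:P - 'X ^+ (2 * n)).
  apply/eqP; rewrite -subr_eq0; apply/eqP/poly_eq0_horner => x x0.
  have := even_flip (kform_hom 2) (kform_hom 0) kform_eq x0; rewrite CE => E.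
  rewrite hornerD hornerN hornerZ hornerM [_.[x] in X in _ - X]hornerM !hornerD !hornerN
    !hornerXn hornerX !hornerC.
  by rewrite -E; ring.
have : size A != 1%N.
  apply: contra_neq a1_neq0 => sA; have : A`_2 = 0 by rewrite nth_default ?sA.
  by rewrite !(coefE, coefC) /= addr0 mulr1 mulr0 addr0.
case/closed_rootP => y /rootP Ay.
(* The value of A at 0 is a1 nu. *)
have y0 : y != 0.
  apply: contra_eq_neq Ay => ->; rewrite AE expr0n /= add0r mulr0 addr0.
  by rewrite mulf_neq0.
have Ey : nu ^+ n = y ^+ (2 * n).
  have := congr1 (fun f : {poly k} => f.[y]) EC.
  rewrite !(hornerZ, hornerM, horner_exp, Ay) ?expr0n /= !(mul0r, mulr0) => /esym/eqP.
  by rewrite hornerX mulf_eq0 (negPf y0) hornerD hornerN hornerC hornerXn subr_eq0 => /eqP.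
have := congr1 (fun f : {poly k} => f^`().[y]) EC.
have -> : ('X ^+ 2 - nu%:P) * (A ^+ 2 * C) = A * (A * (('X ^+ 2 - nu%:P) * C)) by ring.
rewrite derivZ hornerZ derivM hornerD !hornerM Ay mul0r !mulr0 mul0r addr0 mulr0.
rewrite derivM derivX derivB derivC derivXn -scaler_nat !(hornerD, hornerM, hornerN, hornerZ,
  hornerC, hornerXn, hornerX).
rewrite Ey subrr mulr0 add0r sub0r mulrN => /esym/eqP; rewrite oppr_eq0 mulrCA mulf_eq0
  -exprS prednK; last by lia.
rewrite expf_eq0 (negPf y0) andbF orbF -(dvdn_pcharf pk) Euclid_dvdM ?(pcharf_prime pk) //.
by rewrite !gtnNdvd //; lia.
Qed.

End Even.

(** * Characteristic five *)

Lemma MXaddC_eq0 (R : nzRingType) (f : {poly R}) c : f * 'X + c%:P = 0 -> f = 0 /\ c = 0.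
Proof.
move=> E; have c0 : c = 0.
  by have := congr1 (fun g : {poly R} => g`_0) E; rewrite coefD coefMX coefC coef0 /= add0r.
split=> //; apply/polyP => i; have := congr1 (fun g : {poly R} => g`_i.+1) E.
by rewrite c0 coefD coefMX coefC !coef0 /= addr0.
Qed.

Section Five.
Variable k : closedFieldType.
Hypothesis k5 : 5%N \in [pchar k].

Let five : 5%:R = 0 :> k. Proof. by rewrite (pcharf0 k5). Qed.
Let nz2 : 2%:R != 0 :> k. Proof. exact: (natr_small_neq0 k5). Qed.
Let nz3 : 3%:R != 0 :> k. Proof. exact: (natr_small_neq0 k5). Qed.

Lemma five_eq (x y z : k) : x - y = 5%:R * z -> x = y.
Proof. by rewrite five mul0r => /eqP; rewrite subr_eq0 => /eqP. Qed.

(** At (y^2 + nu, y) a cubic form becomes a sextic that y |-> nu / y preserves up to a factor, so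
    the four upper coefficients already determine the form. The exempted points y^2 = nu are
    absorbed by the factor X^2 - nu. *)
Lemma cubic_form_eq (nu h0 h1 h2 h3 w0 w1 w2 w3 w4 w5 w6 : k) :
  (forall y, y != 0 -> y ^+ 2 != nu -> h0 * (y ^+ 2 + nu) ^+ 3 + h1 * (y ^+ 2 + nu) ^+ 2 * y
    + h2 * (y ^+ 2 + nu) * y ^+ 2 + h3 * y ^+ 3 =
    w6 * y ^+ 6 + w5 * y ^+ 5 + w4 * y ^+ 4 + w3 * y ^+ 3 + w2 * y ^+ 2 + w1 * y + w0) ->
  [/\ h0 = w6, h1 = w5, 3 * nu * h0 + h2 = w4 & 2 * nu * h1 + h3 = w3].
Proof.
move=> E; pose f : {poly k} := (((((((h0 - w6)%:P * 'X + (h1 - w5)%:P) * 'X + (3 * nu * h0 +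
  h2 - w4)%:P) * 'X
  + (2 * nu * h1 + h3 - w3)%:P) * 'X + (3 * nu ^+ 2 * h0 + nu * h2 - w2)%:P) * 'X + (nu ^+ 2
    * h1 - w1)%:P) * 'X
  + (nu ^+ 3 * h0 - w0)%:P).
have : ('X ^+ 2 - nu%:P) * f = 0.
  apply: poly_eq0_horner => x x0; rewrite hornerM.
  have [xn|xn] := eqVneq (x ^+ 2) nu; first by rewrite hornerD hornerXn hornerN hornerC xn
    subrr mul0r.
  have -> : f.[x] = (h0 * (x ^+ 2 + nu) ^+ 3 + h1 * (x ^+ 2 + nu) ^+ 2 * x
    + h2 * (x ^+ 2 + nu) * x ^+ 2 + h3 * x ^+ 3) - (w6 * x ^+ 6 + w5 * x ^+ 5 + w4 * x ^+ 4 +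
      w3 * x ^+ 3 + w2 * x ^+ 2 + w1 * x + w0).
    by rewrite /f !(hornerD, hornerM, hornerX, hornerC); ring.
  by rewrite (E x x0 xn) subrr mulr0.
move/eqP; rewrite mulf_eq0 (negPf (quad_neq0 nu)) /= => /eqP.
move=> /MXaddC_eq0[/MXaddC_eq0[/MXaddC_eq0[/MXaddC_eq0[/MXaddC_eq0[/MXaddC_eq0[]]]]]].
move=> /polyC_inj /eqP; rewrite subr_eq0 => /eqP E0 /eqP; rewrite subr_eq0 => /eqP E1.
by move=> /eqP; rewrite subr_eq0 => /eqP E2 /eqP; rewrite subr_eq0 => /eqP E3 _ _ _.
Qed.

(** The hypothesis is the identity with its four Cartier images reduced modulo 5, ep and th being
    the fifth roots of e and nu. [even_flip] determines the part linear in y, hence also the rest;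
    comparing both with the known sextics overdetermines the parameters. *)
Lemma even_part_five (nu th ep g a1 a2 b1 b2 : k) : nu != 0 -> a1 != 0 ->
  (forall y, let s := y ^+ 2 + nu in let a := a1 * s + a2 * y in let b := b1 * s + b2 * y in
   g * (th * ep ^+ 2 * b ^+ 3 + (y + 2 * th ^+ 2 * ep) * a * b ^+ 2
     + (2 * ep * y + 3 * th ^+ 2 * ep ^+ 2 + th ^+ 3) * a ^+ 2 * b
     + ((ep ^+ 2 - th) * y + 3 * th ^+ 3 * ep) * a ^+ 3) = 1) -> False.
Proof.
move=> nu0 a10 E.
pose F2 s t : k := let a := a1 * s + a2 * t in let b := b1 * s + b2 * t in
  g * (a * (b ^+ 2 + 2 * ep * a * b + (ep ^+ 2 - th) * a ^+ 2)).
pose F0 s t : k := let a := a1 * s + a2 * t in let b := b1 * s + b2 * t in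
  g * (th * ep ^+ 2 * b ^+ 3 + 2 * th ^+ 2 * ep * a * b ^+ 2
     + (3 * th ^+ 2 * ep ^+ 2 + th ^+ 3) * a ^+ 2 * b + 3 * th ^+ 3 * ep * a ^+ 3).
(* [even_flip] is applied with 0 for its parameter e, because the identity is already written in y
   instead of x^2 = y + e. *)
have E' y : F2 (y ^+ 2 + nu) y * (y + 0) + F0 (y ^+ 2 + nu) y = 1.
  by rewrite -[RHS](E y) /F2 /F0; ring.
have hom2 c s t : F2 (c * s) (c * t) = c ^+ 3 * F2 s t by rewrite /F2; ring.
have hom0 c s t : F0 (c * s) (c * t) = c ^+ 3 * F0 s t by rewrite /F0; ring.
have flip := even_flip hom2 hom0 E'.
have E2 y : y != 0 -> y ^+ 2 != nu -> nu ^+ 3 * F2 (y ^+ 2 + nu) y = - (y ^+ 5 + nu * y ^+ 3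
  + nu ^+ 2 * y).
  move=> y0 yn; have yn0 : y ^+ 2 - nu != 0 by rewrite subr_eq0.
  apply: (mulfI yn0); rewrite mulrCA mulrA flip //; ring.
have E0 y : y != 0 -> y ^+ 2 != nu -> nu ^+ 3 * F0 (y ^+ 2 + nu) y = nu ^+ 3 + (y ^+ 6 + nu *
  y ^+ 4 + nu ^+ 2 * y ^+ 2).
  move=> y0 yn; have -> : F0 (y ^+ 2 + nu) y = 1 - F2 (y ^+ 2 + nu) y * y by rewrite -(E' y);
    ring.
  by rewrite mulrBr mulrA E2 //; ring.
(* Completing the square: the quadratic factor of F2 is (b + ep a)^2 - th a^2, and c1, c2 are the
   coefficients of b + ep a. *)
have [c1 c1D] : exists c, c = b1 + ep * a1 by eexists.
have [c2 c2D] : exists c, c = b2 + ep * a2 by eexists.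
have [G GE] : exists G, G = nu ^+ 3 * g by exists (nu ^+ 3 * g).
have [] := @cubic_form_eq nu (G * (a1 * (c1 ^+ 2 - th * a1 ^+ 2)))
  (G * (a2 * (c1 ^+ 2 - th * a1 ^+ 2) + a1 * (2 * c1 * c2 - 2 * th * a1 * a2)))
  (G * (a1 * (c2 ^+ 2 - th * a2 ^+ 2) + a2 * (2 * c1 * c2 - 2 * th * a1 * a2)))
  (G * (a2 * (c2 ^+ 2 - th * a2 ^+ 2))) 0 (- nu ^+ 2) 0 (- nu) 0 (- 1) 0.
  move=> y y0 yn; transitivity (nu ^+ 3 * F2 (y ^+ 2 + nu) y); last by rewrite E2 //; ring.
  by rewrite /F2 GE c1D c2D; ring.
move=> H0 H1 H2 H3.
have G0 : G != 0.
  apply: contra_eq_neq H1 => ->; rewrite mul0r eq_sym oppr_eq0; exact: oner_neq0.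
have [de c1E] : exists de, c1 = de * a1 by exists (c1 / a1); rewrite divfK.
have thE : th = de ^+ 2.
  move/eqP: H0; rewrite !mulf_eq0 (negPf G0) (negPf a10) /= subr_eq0 => /eqP H0.
  by apply: (mulIf (expf_neq0 2 a10)); rewrite -H0 c1E; ring.
have [be c2E] : exists be, c2 = be + de * a2 by exists (c2 - de * a2); rewrite subrK.
have {}H1 : G * 2 * de * be * a1 ^+ 2 = - 1 by rewrite -[RHS]H1 c1E c2E thE; ring.
have nz : G * 2 * de * be * a1 ^+ 2 != 0 by rewrite H1 oppr_eq0 oner_neq0.
have be0 : be != 0 by apply: contraNneq nz => ->; rewrite mulr0 mul0r.
have de0 : de != 0 by apply: contraNneq nz => ->; rewrite mulr0 !mul0r.
have {}H2 : be + 4 * de * a2 = 0.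
  apply/eqP; rewrite -(mulrI_eq0 _ (mulfI (mulf_neq0 (mulf_neq0 G0 be0) a10))).
  by rewrite -[X in _ == X]H2 c1E c2E thE; apply/eqP; ring.
have beE : be = de * a2.
  apply: (@five_eq _ _ (- de * a2)); transitivity (be + 4 * de * a2 - 5 * de * a2); first by
    ring.
  by rewrite H2; ring.
have a20 : a2 != 0 by apply: contraNneq be0 => a20; rewrite beE a20 mulr0.
have Ea2 : a2 ^+ 2 = nu * a1 ^+ 2.
  have H3' : G * de ^+ 2 * a2 * (3 * a2 ^+ 2 + 2 * nu * a1 ^+ 2) = 0.
    transitivity (G * (a2 * (c2 ^+ 2 - th * a2 ^+ 2)) + nu * (G * 2 * de * be * a1 ^+ 2)).
      by rewrite c2E thE beE; ring.
    rewrite H1 -[G * (a2 * _)](addKr (2 * nu * (G * (a2 * (c1 ^+ 2 - th * a1 ^+ 2) + a1 * (2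
      * c1 * c2 - 2 * th * a1 * a2))))) H3.
    transitivity (- nu - nu - 2 * nu * (G * 2 * de * be * a1 ^+ 2)).
      by rewrite c1E c2E thE; ring.
    by rewrite H1; ring.
  move/eqP: H3'; rewrite !(mulf_eq0, expf_eq0) (negPf G0) (negPf de0) (negPf a20) /= => /eqP
    H3'.
  apply: (@five_eq _ _ (- a2 ^+ 2 - nu * a1 ^+ 2)).
  transitivity (2 * (3 * a2 ^+ 2 + 2 * nu * a1 ^+ 2) - 5 * a2 ^+ 2 - 5 * nu * a1 ^+ 2); first
    by ring.
  by rewrite H3'; ring.
have b1E : b1 = (de - ep) * a1 by rewrite mulrBl -c1E c1D; ring.
have b2E : b2 = (2 * de - ep) * a2.
  have : c2 = 2 * de * a2 by rewrite c2E beE; ring.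
  by rewrite c2D => /(canRL (addrK _)) ->; ring.
(* Now b1 = u a1 and b2 = v a2, so up to the factor g the form F0 is the sum of t_i (a1 s)^(3-i) (a2
   y)^i. *)
pose u := de - ep; pose v := 2 * de - ep.
pose A3 := th * ep ^+ 2; pose A2 := 2 * th ^+ 2 * ep; pose A1 := 3 * th ^+ 2 * ep ^+ 2 + th
  ^+ 3; pose A0 := 3 * th ^+ 3 * ep.
pose t0 := A3 * u ^+ 3 + A2 * u ^+ 2 + A1 * u + A0.
pose t1 := 3 * A3 * u ^+ 2 * v + A2 * (u ^+ 2 + 2 * u * v) + A1 * (2 * u + v) + 3 * A0.
pose t2 := 3 * A3 * u * v ^+ 2 + A2 * (v ^+ 2 + 2 * u * v) + A1 * (2 * v + u) + 3 * A0.
pose t3 := A3 * v ^+ 3 + A2 * v ^+ 2 + A1 * v + A0.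
have [] := @cubic_form_eq nu (G * a1 ^+ 3 * t0) (G * a1 ^+ 2 * a2 * t1) (G * a1 * a2 ^+ 2 *
  t2) (G * a2 ^+ 3 * t3)
  (nu ^+ 3) 0 (nu ^+ 2) 0 nu 0 1.
  move=> y y0 yn; transitivity (nu ^+ 3 * F0 (y ^+ 2 + nu) y); last by rewrite E0 //; ring.
  by rewrite /F0 GE b1E b2E /t0 /t1 /t2 /t3 /u /v /A0 /A1 /A2 /A3; ring.
move=> K0 /eqP; rewrite !(mulf_eq0, expf_eq0) (negPf G0) (negPf a10) (negPf a20) /= => /eqP
  K1 K2.
rewrite K1 !mulr0 add0r => /eqP; rewrite !(mulf_eq0, expf_eq0) (negPf G0) (negPf a20) /= =>
  /eqP K3.
have {K0}K2 : t2 + 2 * t0 = 0.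
  apply/eqP; rewrite -(mulrI_eq0 _ (mulfI (mulf_neq0 (mulf_neq0 G0 (expf_neq0 3 a10)) nu0))).
  apply/eqP; transitivity (G * a1 * a2 ^+ 2 * t2 + 2 * nu * (G * a1 ^+ 3 * t0)); first by
    rewrite Ea2; ring.
  have -> : G * a1 * a2 ^+ 2 * t2 = nu - 3 * nu * (G * a1 ^+ 3 * t0) by rewrite -[X in X -
    _]K2; ring.
  by rewrite K0; ring.
have Q2 : 3 * ep ^+ 4 + de ^+ 2 * ep ^+ 2 + de ^+ 4 = 0.
  apply: (mulfI (mulf_neq0 nz2 (expf_neq0 3 de0))); rewrite mulr0.
  apply/esym/(@five_eq _ _ (de^+7 + 6*de^+6*ep + de^+5*ep^+2 -7*de^+4*ep^+3 + 3*de^+3*ep^+4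
    -de^+2*ep^+5)).
  by rewrite -K2 /t2 /t0 /A0 /A1 /A2 /A3 /u /v thE; ring.
have ep0 : ep != 0.
  apply/eqP => ep0; move/eqP: Q2; rewrite ep0 !expr0n /= !mulr0 !add0r expf_eq0 (negPf de0).
  by [].
have Q1 : ep ^+ 2 + ep * de + de ^+ 2 = 0.
  apply: (mulfI (mulf_neq0 nz3 (mulf_neq0 ep0 (expf_neq0 4 de0)))); rewrite mulr0.
  apply/esym/(@five_eq _ _ (- de^+6*ep -de^+5*ep^+2)).
  transitivity (t3 + 3 * t1 - 2 * (t2 + 2 * t0) - 3 * ep * de ^+ 4 * (ep ^+ 2 + ep * de + de
    ^+ 2)).
    by rewrite K2 K1 K3; ring.
  by rewrite /t0 /t1 /t2 /t3 /A0 /A1 /A2 /A3 /u /v thE; ring.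
(* The remainder of the quartic relation on division by the quadratic one, which is nonzero. *)
have : 2%:R * ep * de ^+ 3 = 0.
  transitivity (3 * ep ^+ 4 + de ^+ 2 * ep ^+ 2 + de ^+ 4 - (ep ^+ 2 + ep * de + de ^+ 2) *
    (3 * ep ^+ 2 - 3 * ep * de + de ^+ 2)); first by ring.
  by rewrite Q1 Q2 mul0r subr0.
by apply/eqP; rewrite !mulf_neq0 ?expf_neq0.
Qed.

End Five.

(** * Odd pencils in characteristic five *)

Section OddFive.
Variables (k : closedFieldType) (q : nat -> {poly k}).
Hypothesis k5 : 5%N \in [pchar k].
Hypothesis q_size : forall i, (size (q i) <= 3)%N.
Local Notation Y := ('X : {poly k}).
Local Notation quad e := ('X ^+ 2 - e%:P : {poly k}).
Local Notation quart al mu nu e :=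
  (quad e ^+ 2 + al%:P * Y * quad e + mu%:P * Y + nu%:P).

Lemma coef_mul_quadX (e : k) (f : {poly k}) m : (size f <= 3)%N ->
  (f * quad e ^+ m)`_(m.*2.+2) = f`_2.
Proof.
move=> sf; have mr : quad e ^+ m \is monic by rewrite monic_exp // monicXnsubC.
have [f2|f2] := eqVneq f`_2 0.
  rewrite f2 nth_default // (leq_trans (size_polyMleq _ _)) // size_quadX.
  suff : (size f <= 2)%N by case: (size f) => [|[|[|]]] //= _; lia.
  by apply/leq_sizeP => j; rewrite leq_eqVlt => /orP[/eqP <-|/(leq_trans sf)/leq_sizeP ->].
have sf3 : size f = 3%N.
  by apply/eqP; rewrite eqn_leq sf ltnNge; apply: contraNN f2 => /leq_sizeP ->.
have f0 : f != 0 by rewrite -size_poly_eq0 sf3.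
have := lead_coef_Mmonic f mr; rewrite !lead_coefE size_Mmonic // size_quadX sf3 /= => <-.
by congr (_ `_ _).
Qed.

(** The missing third step is replaced by V_3 = 1: modulo r its coefficient of X gives nu^2 + 3 al^2
    e^3 = 0, hence d = 0 and a drop in the degree of V_2. The coefficients of X^2 are then the top
    coefficients in q_i r^i = V_i - R1 V_(i-1). *)
Lemma odd_part_five (al nu e : k) : al != 0 -> 3 * nu = 16 * e ^+ 2 ->
  \sum_(i < 4) q i * quart al (- 3 * al * e) nu e ^+ (3 - i) * quad e ^+ i = 1 ->
  exists2 c, c != 0 & [/\ (q 0%N)`_2 = 0, (q 1%N)`_2 = - c, (q 2%N)`_2 = 0 & (q 3%N)`_2 = 0].
Proof.
move=> al0 Enu E1.
have nz n : (0 < n < 5)%N -> n%:R != 0 :> k by case/andP=> *; apply: (natr_small_neq0 k5).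
have res := resultant_neq0 k5 (erefl : 5%N = 3.+2) (isT : (4 < 5)%N) q_size E1.
have [c0 c00 V0] := trunc0_const k5 (erefl : 5%N = 3.+2) (isT : (4 < 5)%N) q_size E1.
have [c1 c10 [_ V1]] := trunc1_quartic k5 (erefl : 5%N = 3.+2) (isT : (4 < 5)%N) q_size E1.
have [c [d [cn0 V2 Eu _]]] := trunc2_quartic k5 (erefl : 5%N = 3.+2) (isT : (4 < 5)%N) q_size
  E1.
have V3 := trunc_full E1.
have T0 := trunc0 q (quart al (- 3 * al * e) nu e) (quad e).
have T1 := truncS q (quart al (- 3 * al * e) nu e) (quad e) 0.
have T2 := truncS q (quart al (- 3 * al * e) nu e) (quad e) 1.
have T3 := truncS q (quart al (- 3 * al * e) nu e) (quad e) 2.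
have nuE : nu = 2 * e ^+ 2.
  apply: (@five_eq _ k5 _ _ (6 * e ^+ 2 - nu)).
  transitivity (2 * (3 * nu) - 2 * e ^+ 2 - 5 * nu); first by ring.
  by rewrite Enu; ring.
have e0 : e != 0.
  by apply: contraNneq res => e0; rewrite nuE e0 !expr0n /= !mulr0 expr0n subr0.
have Enu2 : nu ^+ 2 + 3 * al ^+ 2 * e ^+ 3 = 0.
  have : quad e %| (c * (27 * al ^+ 2 * nu * e ^+ 3 + nu ^+ 3) - 1)%:P + (c * (- 9 * al * e *
    (nu ^+ 2 + 3 * al ^+ 2 * e ^+ 3)))%:P * Y.
    rewrite V3 V2 in T3; set r := quad e in T3 *.
    pose M := (9 * al ^+ 2 * e ^+ 3 + nu ^+ 2)%:P + (- 6 * al * nu * e)%:P * Y.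
    pose L := nu%:P + (- 3 * al * e)%:P * Y.
    pose h := (6 * al ^+ 2 * e ^+ 2)%:P + (al * nu)%:P * Y + d%:P * r.
    pose Z := c%:P * ((18 * al ^+ 2 * nu * e ^+ 2)%:P + L * h + (r + al%:P * Y) * M + r * (r
      + al%:P * Y) * h).
    apply/dvdpP; exists (- (Z + q 3%N * r ^+ 2)); apply/eqP; rewrite -subr_eq0; apply/eqP.
    rewrite -[RHS](subrr 1) [X in _ = X - 1]T3 /Z /M /L /h /r; ring.
  case/dvdp_quad_lin => _ /eqP; rewrite !mulf_eq0 (negPf cn0) (negPf al0) (negPf e0) oppr_eq0
    ?orbF /=.
  by rewrite -(dvdn_pcharf k5) /= => /eqP.
have d0 : d = 0.
  move/eqP: Eu; rewrite mulf_eq0 (negPf al0) /= => /eqP Eu.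
  have Ea : 3 * al ^+ 2 = e.
    apply: (mulIf (expf_neq0 3 e0)); apply: (@five_eq _ k5 _ _ (- e ^+ 4)).
    transitivity (nu ^+ 2 + 3 * al ^+ 2 * e ^+ 3 - nu ^+ 2 - e ^+ 4); first by ring.
    by rewrite Enu2 nuE; ring.
  apply: (mulfI (mulf_neq0 (nz 2%N isT) (expf_neq0 2 e0))); rewrite mulr0.
  apply: (@five_eq _ k5 _ _ (24 * e ^+ 4 - 2 * d * e ^+ 2)).
  transitivity (- 10 * d * e ^+ 2 + (108 * al ^+ 2 * e ^+ 3 + 9 * nu ^+ 2 - 96 * nu * e ^+ 2
    + 12 * d * e ^+ 2) - 36 * (3 * al ^+ 2) * e ^+ 3 - 9 * nu ^+ 2 + 96 * nu * e ^+ 2); first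
    by ring.
  by rewrite Eu Ea nuE; ring.
have s1 (u v : k) : (size (u%:P * Y + v%:P)%R <= 2)%N by rewrite addrC size_quad_base.
have sR : size (quart al (- 3 * al * e) nu e) = 5%N by exact: size_quartic.
have R4 : (quart al (- 3 * al * e) nu e)`_4 = 1.
  by have := monic_quartic al (- 3 * al * e) nu e; rewrite monicE lead_coefE sR => /eqP.
exists c0 => //; split.
- by rewrite -T0 V0 coefC.
- rewrite -(coef_mul_quadX e 1 (q_size 1)).
  have -> : q 1%N * quad e ^+ 1 = c1%:P * ((- 3 * al * e)%:P * Y + nu%:P) - c0%:P * quart al
    (- 3 * al * e) nu e.
    by rewrite -V1 T1 V0; ring.
  rewrite coefB !coefCM R4 mulr1 nth_default ?mulr0 ?sub0r //; exact: leq_trans (s1 _ _) _.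
- rewrite -(coef_mul_quadX e 2 (q_size 2)).
  have -> : q 2%N * quad e ^+ 2 = trunc q (quart al (- 3 * al * e) nu e) (quad e) 2 - c1%:P *
    (quart al (- 3 * al * e) nu e * ((- 3 * al * e)%:P * Y + nu%:P)).
    by rewrite T2 V1; ring.
  rewrite coefB coefCM nth_default ?sub0r; last first.
    exact: leq_trans (size_trunc_quartic k5 (erefl : 5%N = 3.+2) (isT : (4 < 5)%N) q_size E1
      (isT : (2 < 3)%N)) _.
  rewrite nth_default ?mulr0 ?oppr0 // (leq_trans (size_polyMleq _ _)) // sR.
  by have := s1 (- 3 * al * e) nu; case: (size _) => [|[|[|]]].
- rewrite -(coef_mul_quadX e 3 (q_size 3)).
  have -> : q 3%N * quad e ^+ 3 = 1 - quart al (- 3 * al * e) nu e * trunc q (quart al (- 3 *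
    al * e) nu e) (quad e) 2.
    by apply/eqP; rewrite eq_sym subr_eq; apply/eqP; rewrite -V3 T3; ring.
  rewrite coefB coef1 /= sub0r nth_default ?oppr0 // (leq_trans (size_polyMleq _ _)) // sR.
  have : (size (trunc q (quart al (- 3 * al * e) nu e) (quad e) 2) <= 4)%N.
    rewrite V2 d0 mul0r addr0 mul_polyC (leq_trans (size_scale_leq _ _)) //.
    by rewrite size_quad_horner ?size_quad_base.
  by case: (size _) => [|[|[|[|[|]]]]].
Qed.

End OddFive.

(** * Classification of logarithmic pencils *)

Lemma size_exp2_leq (k : idomainType) (f g : {poly k}) c d i j :
  (size f <= c.+1)%N -> (size g <= d.+1)%N ->
  (size (f ^+ i * g ^+ j)%R <= (c * i + d * j).+1)%N.
Proof.
move=> sf sg; rewrite (leq_trans (size_polyMleq _ _)) //.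
have h1 : (size (f ^+ i) <= (c * i).+1)%N.
  rewrite (leq_trans (size_poly_exp_leq _ _)) // ltnS leq_mul2r; apply/orP; right.
  by case: (size f) sf.
have h2 : (size (g ^+ j) <= (d * j).+1)%N.
  rewrite (leq_trans (size_poly_exp_leq _ _)) // ltnS leq_mul2r; apply/orP; right.
  by case: (size g) sg.
move: h1 h2; move: (size (f ^+ i)) (size (g ^+ j)) (c * i)%N (d * j)%N => x y z t; lia.
Qed.

Section Cases.
Variables (p : nat) (k : closedFieldType) (n : nat).
Hypothesis pk : p \in [pchar k].
Hypothesis p_n : p = n.+2.
Hypothesis p_ge5 : (4 < p)%N.
Variables (R1 R2 : {poly k}) (g a1 a2 b1 b2 : k).
Hypothesis R1_size : size R1 = 5%N.
Hypothesis R1_monic : R1 \is monic.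
Hypothesis R2_monic : R2 \is monic.
Hypothesis a1_neq0 : a1 != 0.
Local Notation a := (a1 *: R1 + a2 *: R2).
Local Notation b := (b1 *: R1 + b2 *: R2).

Definition cart_coef j : {poly k} :=
  if (j <= n)%N then cart pk (R1 ^+ j.+1 * R2 ^+ (n.+1 - j)) else 0.

Hypothesis E1 : g *: \sum_(j < n.+1) cart_coef j * a ^+ j * b ^+ (n - j) = 1.

Let R2_neq0 : R2 != 0. Proof. exact: monic_neq0. Qed.

Lemma pencil_scale_neq0 : g != 0.
Proof.
apply/eqP => g0; move/eqP: E1; rewrite g0 scale0r eq_sym; exact/negP/oner_neq0.
Qed.

Lemma size_cart_coef_le d l j : (size R2 <= d.+1)%N -> (j <= n)%N ->
  (4 * j.+1 + d * (n.+1 - j) < l * p + p.-1)%N -> (size (cart_coef j) <= l)%N.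
Proof.
move=> sR2 jn h; rewrite /cart_coef jn; apply: size_cart; apply: leq_trans h.
by apply: size_exp2_leq; rewrite ?R1_size.
Qed.

Lemma size_comb (c d : k) : (size R2 <= 5)%N -> (size (c *: R1 + d *: R2)%R <= 5)%N.
Proof.
move=> s2; rewrite (leq_trans (size_polyD _ _)) // geq_max.
by rewrite !(leq_trans (size_scale_leq _ _)) ?R1_size.
Qed.

(** Only the term j = n reaches degree 4n + 3: R1^(n+1) R2 is monic of degree 4p - 1 = 3p + (p-1),
    so its Cartier image has degree 3, whereas the others have degree at most 2. The coefficient of
    X^(4n+3) in the identity would be g a1^n. *)
Lemma pencil_size_neq4 : size R2 <> 4%N.
Proof.
move=> s4; have s2 : (size R2 <= 5)%N by rewrite s4.
have := congr1 (fun f : {poly k} => f`_(4 * n + 3)) E1.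
rewrite coefZ coef1 addn_eq0 andbF /= => /eqP; rewrite mulf_eq0 (negPf pencil_scale_neq0) /=.
rewrite coef_sum big_ord_recr /= subnn expr0 mulr1 big1 ?add0r; last first.
  move=> j _; rewrite nth_default // -mulrA (leq_trans (size_polyMleq _ _)) //.
  have s3 : (size (cart_coef j) <= 3)%N.
    apply: (@size_cart_coef_le 3); rewrite ?s4 //; have := ltn_ord j; lia.
  have := size_exp2_leq j (n - j) (size_comb a1 a2 s2) (size_comb b1 b2 s2).
  move: (ltn_ord j) s3; move: (size (cart_coef j)) (size (a ^+ j * b ^+ (n - j))) => x y; lia.
apply/negP.
have k3 : (size (cart_coef n) <= 4)%N by apply: (@size_cart_coef_le 3); rewrite ?s4 //; lia.
have mon : R1 ^+ n.+1 * R2 \is monic by rewrite monicMl // monic_exp.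
have kl : (cart_coef n)`_3 = 1.
  rewrite /cart_coef leqnn coef_cart subSnn expr1 -(proot1 pk); congr proot.
  have := mon; rewrite monicE lead_coefE => /eqP <-; congr (_ `_ _).
  rewrite size_Mmonic ?monic_neq0 ?monic_exp // s4.
  have := size_exp R1 n.+1; rewrite R1_size /=.
  have : (0 < size (R1 ^+ n.+1))%N by rewrite lt0n size_poly_eq0 monic_neq0 ?monic_exp.
  by move: (size _) => x; lia.
have sk : size (cart_coef n) = 4%N.
  apply/eqP; rewrite eqn_leq k3 ltnNge; apply/negP => /leq_sizeP/(_ 3%N (leqnn _)).
  by rewrite kl; apply/eqP/oner_neq0.
have sa : size a = 5%N.
  rewrite size_polyDl ?(size_scale R1 a1_neq0) ?R1_size //.
  by rewrite (leq_ltn_trans (size_scale_leq _ _)) ?s4.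
have la : lead_coef a = a1.
  rewrite lead_coefDl ?lead_coefZ ?(monicP R1_monic) ?mulr1 //.
  by rewrite (size_scale R1 a1_neq0) R1_size (leq_ltn_trans (size_scale_leq _ _)) ?s4.
have := lead_coefM (cart_coef n) (a ^+ n); rewrite lead_coef_exp la [lead_coef (cart_coef
  n)]lead_coefE sk kl mul1r lead_coefE.
have kn0 : cart_coef n != 0 by rewrite -size_poly_eq0 sk.
have a0 : a ^+ n != 0 by rewrite expf_neq0 // -size_poly_eq0 sa.
have sX : size (a ^+ n) = (4 * n).+1.
  have := size_exp a n; rewrite sa; move: a0; rewrite -size_poly_eq0; move: (size _) => x; lia.
rewrite size_mul // sk sX (_ : (4 + (4 * n).+1).-1.-1 = 4 * n + 3)%N; last by lia.
by move=> ->; rewrite expf_neq0.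
Qed.

Definition qcoef i : {poly k} :=
  g *: \sum_(j < n.+1) (linform a1 a2 ^+ j * linform b1 b2 ^+ (n - j))`_i *: cart_coef j.

Lemma qcoef_eq1 : \sum_(i < n.+1) qcoef i * R1 ^+ (n - i) * R2 ^+ i = 1.
Proof.
rewrite -E1 form_expansion scaler_sumr; apply: eq_bigr => i _.
by rewrite /qcoef -!scalerAl.
Qed.

Lemma coef_qcoef i l : (qcoef i)`_l =
  (g *: \sum_(j < n.+1) (cart_coef j)`_l *: (linform a1 a2 ^+ j * linform b1 b2 ^+ (n - j)))`_i.
Proof.
rewrite /qcoef !coefZ !coef_sum; congr (_ * _); apply: eq_bigr => j _.
by rewrite !coefZ mulrC.
Qed.

Section SizeLe3.
Hypothesis R2_size : (size R2 <= 3)%N.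

Lemma size_cart_coef j : (size (cart_coef j) <= 3)%N.
Proof.
have [jn|nj] := leqP j n; last by rewrite /cart_coef (leqNgt j n) nj size_poly0.
by apply: (@size_cart_coef_le 2); rewrite ?R2_size //; clear -p_n p_ge5 jn; lia.
Qed.

Lemma qcoef_size i : (size (qcoef i) <= 3)%N.
Proof.
rewrite (leq_trans (size_scale_leq _ _)) // (leq_trans (size_sum _ _ _)) //.
by apply/bigmax_leqP => j _; rewrite (leq_trans (size_scale_leq _ _)) ?size_cart_coef.
Qed.

Let R2_size4 : (size R2 <= 4)%N. Proof. exact: leq_trans R2_size _. Qed.

(** The degree bound for the zeroth truncation is negative, so that truncation is 0 and R2 divides
    1. *)
Lemma pencil_size_neq2 : size R2 <> 2%N.
Proof.
move=> s2; have n0 : (0 < n)%N by lia.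
have := size_trunc qcoef_size R1_size R2_neq0 R2_size4 qcoef_eq1 n0.
rewrite s2 leqn0 size_poly_eq0 => /eqP V0.
have [U] := trunc_congr qcoef_size R1_size R2_neq0 R2_size4 qcoef_eq1 n0.
rewrite V0 mulr0 add0r expr1 => E _.
have : R2 %| 1 by rewrite E dvdp_mulr.
by rewrite dvdp1 s2.
Qed.

Section SizeOne.
Hypothesis R2_1 : R2 = 1.

(** For R2 = 1 every truncation of index below n is 0, and [truncS] recovers q_i from two
    consecutive ones. *)
Lemma qcoef_const i : (i < n)%N -> qcoef i = 0.
Proof.
have V m : (m < n)%N -> trunc qcoef R1 R2 m = 0.
  move=> mn; have := size_trunc qcoef_size R1_size R2_neq0 R2_size4 qcoef_eq1 mn.
  by rewrite R2_1 size_poly1 mul0n leqn0 size_poly_eq0 => /eqP.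
case: i => [|i] ni; first by rewrite -(trunc0 qcoef R1 R2) V.
have := truncS qcoef R1 R2 i; rewrite !V // 1?ltnW // mulr0 add0r R2_1 expr1n mulr1.
by move=> <-.
Qed.

Lemma qcoef_last : qcoef n = 1.
Proof.
have := qcoef_eq1; rewrite big_ord_recr /= subnn expr0 mulr1 R2_1 expr1n mulr1 big1 ?add0r //.
by move=> i _; rewrite qcoef_const ?mul0r.
Qed.

Lemma size_pencil_lin : size a = 5%N.
Proof.
rewrite size_polyDl ?(size_scale R1 a1_neq0) ?R1_size //.
by rewrite (leq_ltn_trans (size_scale_leq _ _)) ?R2_1 ?size_poly1.
Qed.

Lemma pencil_lin_ndvd1 : a %| 1 -> False.
Proof. by rewrite dvdp1 size_pencil_lin. Qed.

(** For p > 5 the Cartier image of R1 is 0, as 4 < p - 1; all other terms of the identity are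
    divisible by the quartic a. *)
Lemma constant_pencil_char5 : p = 5%N.
Proof.
apply/eqP; rewrite eqn_leq p_ge5 andbT leqNgt; apply/negP => p5.
apply: pencil_lin_ndvd1; rewrite -E1 dvdpZr ?pencil_scale_neq0 // big_ord_recl /= [cart_coef
  0]/cart_coef leq0n.
rewrite R2_1 expr1n mulr1 expr1 cart_small ?R1_size // mul0r mul0r add0r.
elim/big_ind: _ => [|x y|i _]; rewrite ?dvdp0 //; first exact: dvdp_add.
by rewrite /bump add1n exprS -mulrA dvdp_mull // -mulrA dvdp_mulr.
Qed.

Lemma kform_eq0 l : (0 < l)%N ->
  \sum_(j < n.+1) (cart_coef j)`_l *: (linform a1 a2 ^+ j * linform b1 b2 ^+ (n - j)) = 0.
Proof.
move=> l0; apply: (scalerI pencil_scale_neq0); rewrite scaler0; apply/polyP => i; rewrite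
  coef0 -coef_qcoef.
case: (ltngtP i n) => [i_n|n_i|->].
- by rewrite qcoef_const ?coef0.
- rewrite coef_qcoef nth_default // (leq_trans (size_scale_leq _ _)) // (leq_trans (size_sum
  _ _ _)) //.
  apply/bigmax_leqP => j _; rewrite (leq_trans (size_scale_leq _ _)) // (leq_trans (size_linX
    _ _ _ _ _ _)) //.
  by rewrite subnKC ?leq_ord.
- by rewrite qcoef_last coef1 (gtn_eqF l0).
Qed.

(** The forms attached to X^2 and X vanish by [kform_eq0]. They kill the coefficient of X^14 in R1^4
    and of X^9 in R1^3, which are 4 u (once v = 0) and 3 v. *)
Lemma constant_pencil_class (u v : k) : R1 = 'X ^+ 4 + u *: 'X ^+ 2 + v *: 'X ->
  [/\ R1 = 'X ^+ 4 & b1 = 0].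
Proof.
move=> R1E; have p5 := constant_pencil_char5; have n3 : n = 3%N by lia.
have k5 : 5%N \in [pchar k] by rewrite -p5.
have nz m : (0 < m < 5)%N -> m%:R != 0 :> k by case/andP=> *; apply: (natr_small_neq0 k5).
have la0 : linform a1 a2 != 0.
  apply: contraNneq a1_neq0 => /(congr1 (fun f : {poly k} => f`_0)).
  by rewrite coefD coefC coefZ coefX coef0 mulr0 addr0 => /eqP.
have R2s : (size R2 <= 1)%N by rewrite R2_1 size_poly1.
have kz l j : (j <= 3)%N -> (4 * j.+1 < l * 5 + 4)%N -> (cart_coef j)`_l = 0.
  move=> j3 h; rewrite nth_default //; apply: (@size_cart_coef_le 0); rewrite ?n3 ?p5 //; lia.
have E l : (0 < l)%N -> (cart_coef 0)`_l *: linform b1 b2 ^+ 3 + (cart_coef 1)`_l *: (linform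
  a1 a2 * linform b1 b2 ^+ 2)
  + (cart_coef 2)`_l *: (linform a1 a2 ^+ 2 * linform b1 b2) + (cart_coef 3)`_l *: linform a1
    a2 ^+ 3 = 0.
  move=> /kform_eq0; rewrite n3 !big_ord_recl big_ord0 /= /bump /= !add1n !expr0 !expr1 mul1r
    mulr1 addr0.
  by rewrite !addrA.
have k32 : (cart_coef 3)`_2 = 0.
  have := E 2%N isT; rewrite [(cart_coef 0)`_2]kz // [(cart_coef 1)`_2]kz // [(cart_coef
    2)`_2]kz // !scale0r !add0r => /eqP.
  by rewrite scaler_eq0 expf_eq0 (negPf la0) orbF => /eqP.
have k21 : (cart_coef 2)`_1 = 0.
  have := E 1%N isT; rewrite [(cart_coef 0)`_1]kz // [(cart_coef 1)`_1]kz // !scale0r !add0r.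
  have -> : (cart_coef 2)`_1 *: (linform a1 a2 ^+ 2 * linform b1 b2) + (cart_coef 3)`_1 *:
    linform a1 a2 ^+ 3
    = linform a1 a2 ^+ 2 * ((cart_coef 2)`_1 *: linform b1 b2 + (cart_coef 3)`_1 *: linform
      a1 a2).
    by rewrite -!mul_polyC; ring.
  move/eqP; rewrite mulf_eq0 expf_eq0 (negPf la0) /= => /eqP El.
  (* Otherwise b is a multiple of a, and a divides every term of the identity. *)
  apply/eqP/negPn/negP => k21; pose c := - ((cart_coef 3)`_1 / (cart_coef 2)`_1).
  have Eb : linform b1 b2 = c *: linform a1 a2.
    apply: (scalerI k21); rewrite scalerA /c mulrN mulrC divfK // scaleNr.
    by apply/eqP; rewrite -addr_eq0 El.
  have := congr1 (fun f : {poly k} => f`_0) Eb; rewrite !(coefD, coefZ, coefX, coefC) /=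
    !mulr0 !addr0 => b1E.
  have := congr1 (fun f : {poly k} => f`_1) Eb; rewrite !(coefD, coefZ, coefX, coefC) /=
    !mulr1 !add0r => b2E.
  have bE : b = c *: a by rewrite b1E b2E scalerDr !scalerA.
  apply: pencil_lin_ndvd1; rewrite -E1 dvdpZr ?pencil_scale_neq0 // bE n3.
  elim/big_ind: _ => [|x y|i _]; rewrite ?dvdp0 //; first exact: dvdp_add.
  rewrite -mulrA dvdp_mull // exprZn -scalerAr -exprD -[c ^+ _ *: _]mul_polyC dvdp_mull //.
  by rewrite subnKC ?leq_ord // exprS dvdp_mulr.
have v0 : v = 0.
  move/eqP: k21; rewrite /cart_coef n3 /= coef_cart proot_eq0 R2_1 expr1n mulr1 p5 R1E.
  rewrite (_ : _ ^+ 3 = 'X ^+ 12 + (3 * u) *: 'X ^+ 10 + (3 * v) *: 'X ^+ 9 + (3 * u ^+ 2) *: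
    'X ^+ 8
   + (6 * u * v) *: 'X ^+ 7 + (3 * v ^+ 2 + u ^+ 3) *: 'X ^+ 6 + (3 * u ^+ 2 * v) *: 'X ^+ 5
   + (3 * u * v ^+ 2) *: 'X ^+ 4 + v ^+ 3 *: 'X ^+ 3); last by rewrite -!mul_polyC; ring.
  rewrite !(coefD, coefZ, coefXn) /= !(mulr0, add0r, addr0) mulr1 mulf_eq0.
  by rewrite (negPf (nz 3%N isT)) => /eqP.
have u0 : u = 0.
  move/eqP: k32; rewrite /cart_coef n3 /= coef_cart proot_eq0 R2_1 expr1n mulr1 p5 R1E v0
    scale0r addr0.
  rewrite (_ : _ ^+ 4 = 'X ^+ 16 + (4 * u) *: 'X ^+ 14 + (6 * u ^+ 2) *: 'X ^+ 12 + (4 * u ^+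
    3) *: 'X ^+ 10
   + u ^+ 4 *: 'X ^+ 8); last by rewrite -!mul_polyC; ring.
  rewrite !(coefD, coefZ, coefXn) /= !(mulr0, add0r, addr0) mulr1 mulf_eq0.
  by rewrite (negPf (nz 4%N isT)) => /eqP.
have R1E' : R1 = 'X ^+ 4 by rewrite R1E u0 v0 !scale0r !addr0.
split=> //.
have k0 : cart_coef 0 = 1.
  apply/polyP => l; rewrite /cart_coef leq0n coef_cart R2_1 expr1n mulr1 expr1 R1E' coefXn
    coef1.
  rewrite (_ : (l * p + p.-1 == 4)%N = (l == 0%N)); last by rewrite p5; lia.
  by case: (l == 0%N); rewrite ?proot1 ?proot0.
have kj j : (0 < j <= 3)%N -> cart_coef j = 0.
  move=> /andP[j0 j3]; apply/polyP => l; rewrite /cart_coef n3 j3 coef_cart R2_1 expr1n mulr1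
    R1E' -exprM coefXn coef0.
  by rewrite (_ : (_ == _) = false) ?proot0 // p5; lia.
(* For R1 = X^4 the only nonzero Cartier image is that of R1 itself, and the identity reads g b^3 =
   1. *)
apply/eqP/negPn/negP => b10.
have := E1; rewrite n3 !big_ord_recl big_ord0 /= /bump /= !add1n k0 (kj 1%N) // (kj 2%N) //
  (kj 3%N) // !mul0r !addr0 mul1r expr0 mul1r => Eb.
have sb : size b = 5%N.
  rewrite size_polyDl ?(size_scale R1 b10) ?R1_size //.
  by rewrite (leq_ltn_trans (size_scale_leq _ _)) ?R2_1 ?size_poly1.
have : b %| 1 by rewrite -Eb -[g *: _]mul_polyC dvdp_mull // exprS dvdp_mulr.
by rewrite dvdp1 sb.
Qed.
End SizeOne.
End SizeLe3.
End Cases.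

Lemma proot_nat p (k : closedFieldType) (pk : p \in [pchar k]) m : proot pk m%:R = m%:R.
Proof. by elim: m => [|m IH]; rewrite ?proot0 // -natr1 prootD IH proot1. Qed.

(** * Cartier images for even pencils in characteristic five *)

Section QuadCart.
Variables (k : closedFieldType) (k5 : 5%N \in [pchar k]) (e : k).
Local Notation r := ('X ^+ 2 - e%:P : {poly k}).
Local Notation ct := (cart k5).
Local Notation ep := (proot k5 e).

Let cart_idx4 l : (l * 5 + 4 == 4)%N = (l == 0%N). Proof. lia. Qed.
Let cart_idx_false l i : (i \in [:: 0; 2; 6; 8])%N -> (l * 5 + 4 == i)%N = false.
Proof. by rewrite !inE => /or4P[]/eqP->; lia. Qed.

Lemma cart_quad2 : ct (r ^+ 2) = 1.
Proof.
apply/polyP => l; rewrite coef_cart coef1.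
rewrite (_ : r ^+ 2 = 'X ^+ 4 + (- 2 * e) *: 'X ^+ 2 + (e ^+ 2)%:P); last by rewrite
  -mul_polyC; ring.
rewrite !(coefD, coefZ, coefXn, coefC) cart_idx4 !cart_idx_false // !mulr0 !addr0.
by case: (l == 0%N); rewrite ?proot1 ?proot0.
Qed.

Lemma cart_quad3 : ct (r ^+ 3) = (- 3 * ep)%:P.
Proof.
apply/polyP => l; rewrite coef_cart coefC.
rewrite (_ : r ^+ 3 = 'X ^+ 6 + (- 3 * e) *: 'X ^+ 4 + (3 * e ^+ 2) *: 'X ^+ 2 + (- e ^+
  3)%:P); last by rewrite -!mul_polyC; ring.
rewrite !(coefD, coefZ, coefXn, coefC) cart_idx4 !cart_idx_false // ?mulr0 ?add0r ?addr0.
by case: (l == 0%N); rewrite ?mulr1 ?mulr0 ?proot0 // prootM prootN proot_nat.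
Qed.

Lemma cart_quad4 : ct (r ^+ 4) = (6 * ep ^+ 2)%:P.
Proof.
apply/polyP => l; rewrite coef_cart coefC.
rewrite (_ : r ^+ 4 = 'X ^+ 8 + (- 4 * e) *: 'X ^+ 6 + (6 * e ^+ 2) *: 'X ^+ 4 + (- 4 * e ^+
  3) *: 'X ^+ 2 + (e ^+ 4)%:P); last by rewrite -!mul_polyC; ring.
rewrite !(coefD, coefZ, coefXn, coefC) cart_idx4 !cart_idx_false // ?mulr0 ?add0r ?addr0.
by case: (l == 0%N); rewrite ?mulr1 ?mulr0 ?proot0 // !prootM proot_nat.
Qed.

Lemma cart_quad1 : ct r = 0.
Proof. by rewrite cart_small // size_quad. Qed.

Variable nu : k.
Local Notation R1 := (r ^+ 2 + nu%:P).
Local Notation th := (proot k5 nu).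

Lemma cart_coef0_five : ct (R1 ^+ 1 * r ^+ 4) = (th * (6 * ep ^+ 2))%:P.
Proof.
rewrite (_ : _ * _ = r ^+ 5 * r + nu *: r ^+ 4); last by rewrite -mul_polyC; ring.
by rewrite cartD cart_expM cartZ cart_quad1 cart_quad4 mulr0 add0r -mul_polyC; ring.
Qed.

Lemma cart_expn5 : ct (r ^+ 5) = 0.
Proof. by rewrite -[_ ^+ 5]mulr1 cart_expM cart_small ?mulr0 // size_poly1. Qed.

Lemma cart_coef1_five : ct (R1 ^+ 2 * r ^+ 3) = r + (th ^+ 2 * (- 3 * ep))%:P.
Proof.
rewrite (_ : _ * _ = r ^+ 5 * r ^+ 2 + (2 * nu) *: r ^+ 5 + nu ^+ 2 *: r ^+ 3); last by
  rewrite -!mul_polyC; ring.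
rewrite !cartD cart_expM !cartZ cart_expn5 cart_quad2 cart_quad3 mulr1 scaler0 addr0.
by rewrite -mul_polyC prootM; ring.
Qed.

Lemma cart_coef2_five : ct (R1 ^+ 3 * r ^+ 2) = (- 3 * ep)%:P * r + (3 * th ^+ 2 * (6 * ep ^+
  2) + th ^+ 3)%:P.
Proof.
rewrite (_ : _ * _ = r ^+ 5 * r ^+ 3 + (3 * nu) *: (r ^+ 5 * r) + (3 * (nu * nu)) *: r ^+ 4 +
  (nu * (nu * nu)) *: r ^+ 2); last by rewrite -!mul_polyC; ring.
rewrite !cartD !cart_expM !cartZ !cart_expM cart_quad1 cart_quad2 cart_quad3 cart_quad4 mulr0
  scaler0 addr0.
by rewrite -!mul_polyC !prootM proot_nat; ring.
Qed.

Lemma cart_coef3_five : ct (R1 ^+ 4 * r ^+ 1) = (6 * ep ^+ 2 + 4 * th)%:P * r + (4 * th ^+ 3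
  * (- 3 * ep))%:P.
Proof.
rewrite (_ : _ * _ = r ^+ 5 * r ^+ 4 + (4 * nu) *: (r ^+ 5 * r ^+ 2) + (6 * (nu * nu)) *: r
  ^+ 5 + (4 * (nu * (nu * nu))) *: r ^+ 3 + nu ^+ 4 *: r); last by rewrite -!mul_polyC; ring.
rewrite !cartD !cartZ !cart_expM cart_expn5 cart_quad1 cart_quad2 cart_quad3 cart_quad4
  !scaler0 !addr0.
by rewrite -!mul_polyC !prootM proot_nat; ring.
Qed.

End QuadCart.

(** * Exclusion of quadratic pencils in characteristic five *)

Section QuadFive.
Variables (k : closedFieldType) (k5 : 5%N \in [pchar k]).
Variables (nu e g a1 a2 b1 b2 : k).
Hypothesis a1_neq0 : a1 != 0.
Local Notation r := ('X ^+ 2 - e%:P : {poly k}).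

Lemma no_even_quadratic_pencil5 : nu != 0 ->
  g *: \sum_(j < 4) cart_coef 3 k5 (r ^+ 2 + nu%:P) r j * (a1 *: (r ^+ 2 + nu%:P) + a2 *: r)
    ^+ j
   * (b1 *: (r ^+ 2 + nu%:P) + b2 *: r) ^+ (3 - j) = 1 -> False.
Proof.
move=> nu0 E1; pose th := proot k5 nu; pose ep := proot k5 e.
apply: (@even_part_five k k5 nu th ep g a1 a2 b1 b2 nu0 a1_neq0) => y s a b.
have [x xE] := closed_sqrt (y + e).
have rx : r.[x] = y by rewrite !hornerE xE addrK.
have Rx : (r ^+ 2 + nu%:P).[x] = s by rewrite hornerD horner_exp rx hornerC.
have := congr1 (fun f : {poly k} => f.[x]) E1.
rewrite hornerZ hornerC !big_ord_recl big_ord0 /= /bump /= /cart_coef /= !add1n !subn0.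
rewrite cart_coef0_five cart_coef1_five cart_coef2_five cart_coef3_five addr0.
rewrite !(hornerD, hornerXn, hornerN, horner_exp, hornerM, hornerZ, hornerX, hornerC) xE
  addrK -/th -/ep -/s => E.

(* The witness is one fifth of the difference between the reduced integer coefficients and those of
   the Cartier images. *)
apply: (@five_eq _ k5 _ _ (g * (- th * ep ^+ 2 * b ^+ 3 + th ^+ 2 * ep * a * b ^+ 2 + (ep * y
  - 3 * th ^+ 2 * ep ^+ 2) * a ^+ 2 * b
  + (- ep ^+ 2 * y - th * y + 3 * th ^+ 3 * ep) * a ^+ 3))).
by rewrite -[X in _ - X]E /a /b /s; ring.
Qed.

(** By [odd_part_five] the form of X^2 is f = -c X. The Cartier image for j = 0 has no X^2 term, so
    the linear form a1 + a2 X divides f; as a1 != 0, this forces a2 = 0. Then the coefficient b2^2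
    of X^2 vanishes, and f would be constant. *)
Lemma no_odd_quadratic_pencil5 (al : k) :
  let R1 := r ^+ 2 + al%:P * 'X * r + (- 3 * al * e)%:P * 'X + nu%:P in
  al != 0 -> 3 * nu = 16 * e ^+ 2 ->
  g *: \sum_(j < 4) cart_coef 3 k5 R1 r j * (a1 *: R1 + a2 *: r) ^+ j
   * (b1 *: R1 + b2 *: r) ^+ (3 - j) = 1 -> False.
Proof.
move=> R1 al0 nuE E1.
have sR : size R1 = 5%N by apply: size_quartic.
have mR : R1 \is monic by apply: monic_quartic.
have sr := size_quad e; have mr : r \is monic by rewrite monicXnsubC.
have sr3 : (size r <= 3)%N by rewrite sr.
have qs := @qcoef_size _ _ 3 k5 erefl isT R1 r g a1 a2 b1 b2 sR sr3.
have q1 := qcoef_eq1 E1.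
have g0 := pencil_scale_neq0 E1.
have [c c0 []] := odd_part_five k5 qs al0 nuE q1.
set f := g *: \sum_(j < 4) (cart_coef 3 k5 R1 r j)`_2 *: (linform a1 a2 ^+ j * linform b1 b2
  ^+ (3 - j)).
rewrite !coef_qcoef -/f => f0 f1 f2 f3.
have k0 : (cart_coef 3 k5 R1 r 0)`_2 = 0.
  by rewrite nth_default //; apply: (@size_cart_coef_le _ _ _ _ _ _ sR 2); rewrite ?sr.
(* R1^2 r^3 is monic of degree 14 = 2 * 5 + 4. *)
have k1 : (cart_coef 3 k5 R1 r 1)`_2 = 1.
  rewrite /cart_coef /= coef_cart -(proot1 k5); congr proot.
  have : R1 ^+ 2 * r ^+ 3 \is monic by rewrite monicMl ?monic_exp.
  rewrite monicE lead_coefE => /eqP <-; congr (_ `_ _).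
  rewrite size_Mmonic ?monic_neq0 ?monic_exp // size_quadX.
  have := size_exp R1 2; rewrite sR /=.
  have : (0 < size (R1 ^+ 2))%N by rewrite lt0n size_poly_eq0 monic_neq0 ?monic_exp.
  by move: (size _) => x; lia.
have fE : f = g *: (linform a1 a2 * (linform b1 b2 ^+ 2 + (cart_coef 3 k5 R1 r 2)`_2 *:
  (linform a1 a2 * linform b1 b2)
   + (cart_coef 3 k5 R1 r 3)`_2 *: linform a1 a2 ^+ 2)).
  rewrite /f !big_ord_recl big_ord0 /= /bump /= !add1n k0 k1 !subn0; congr (_ *: _).
  by rewrite -!mul_polyC; ring.
have a20 : a2 = 0.
  apply/eqP/negPn/negP => a20.
  have fX : f = (- c) *: 'X.
    apply/polyP => i; rewrite [RHS]coefZ coefX; case: i => [|[|[|[|i]]]] /=; rewrite ?mulr0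
      ?mulr1 //.
    rewrite nth_default // (leq_trans (size_scale_leq _ _)) // (leq_trans (size_sum _ _ _)) //.
    apply/bigmax_leqP => j _; rewrite (leq_trans (size_scale_leq _ _)) // (leq_trans
      (size_linX _ _ _ _ _ _)) //.
    by rewrite subnKC ?leq_ord.
  have := congr1 (fun h : {poly k} => h.[- (a1 / a2)]) (etrans (esym fX) fE); rewrite
    !hornerZ hornerM.
  have -> : (linform a1 a2).[- (a1 / a2)] = 0.
    by rewrite /linform hornerD hornerC hornerZ hornerX mulrN mulrC divfK // subrr.
  rewrite hornerX mul0r mulr0 mulrNN => /eqP.
  by rewrite !mulf_eq0 invr_eq0 (negPf c0) (negPf a1_neq0) (negPf a20).
have la : linform a1 a2 = a1%:P by rewrite /linform a20 scale0r addr0.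
have b20 : b2 = 0.
  move/eqP: f2; rewrite fE la coefZ coefCM !(coefD, coefZ) coefCM -polyC_exp coefC /=
    !mulf_eq0 (negPf g0) (negPf a1_neq0) /=.
  have -> : linform b1 b2 ^+ 2 = (b1 ^+ 2)%:P + (2 * b1 * b2) *: 'X + b2 ^+ 2 *: 'X ^+ 2 by
    rewrite /linform -!mul_polyC; ring.
  rewrite /linform !(coefD, coefZ, coefC, coefX, coefXn) /= !(mulr0, addr0, add0r, mulr1)
    expf_eq0.
  by move=> /andP[_ /eqP].
move/eqP: f1; rewrite fE la /linform b20 scale0r addr0 -!polyC_exp -!mul_polyC -!(polyCM,
  polyCD) coefC /= eq_sym oppr_eq0.
by rewrite (negPf c0).
Qed.

End QuadFive.

Lemma no_quadratic_pencil (p : nat) (k : closedFieldType) (n : nat) (pk : p \in [pchar k])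
    (al mu nu e g a1 a2 b1 b2 : k) :
  let r := 'X ^+ 2 - e%:P : {poly k} in
  let R1 := r ^+ 2 + al%:P * 'X * r + mu%:P * 'X + nu%:P in
  p = n.+2 -> (4 < p)%N -> a1 != 0 ->
  g *: \sum_(j < n.+1) cart_coef n pk R1 r j * (a1 *: R1 + a2 *: r) ^+ j
   * (b1 *: R1 + b2 *: r) ^+ (n - j) = 1 -> False.
Proof.
move=> r R1 p_n p_ge5 a1_neq0 E1.
have sR : size R1 = 5%N by apply: size_quartic.
have mR : R1 \is monic by apply: monic_quartic.
have sr := size_quad e; have mr : r \is monic by rewrite monicXnsubC.
have sr3 : (size r <= 3)%N by rewrite sr.
have qs := @qcoef_size _ _ n pk p_n p_ge5 R1 r g a1 a2 b1 b2 sR sr3.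
have q1 := qcoef_eq1 E1.
have ks := size_cart_coef pk p_n p_ge5 sR sr3.
have p57 : p = 5%N \/ (6 < p)%N.
  move: p_ge5 (pcharf_prime pk); clear; case: (p) => [|[|[|[|[|[|[|q]]]]]]] // _ _; [by left
    | by right].
have [muE nuE] := odd_dichotomy pk p_n p_ge5 qs q1.
have [al0|al0] := eqVneq al 0.
  have nu0 : nu != 0.
    have := resultant_neq0 pk p_n p_ge5 qs q1; apply: contraNneq => nu0.
    by rewrite muE al0 nu0 mulr0 !mul0r expr0n /= mul0r subrr.
  have R1E : R1 = r ^+ 2 + nu%:P by rewrite /R1 muE al0 mulr0 !mul0r !addr0.
  rewrite R1E in E1 ks.
  have [p5|p7] := p57.
    have n3 : n = 3%N by lia.
    by clear ks qs q1; subst n p; apply: no_even_quadratic_pencil5 E1.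
  (* The products R1 r^(p-1) and R1^2 r^(p-2) have degrees 2p + 2 and 2p + 4, both below 3p - 1
     because p >= 7. *)
  apply: (even_part_large pk p_n p_ge5 nu0 ks a1_neq0 E1).
    by rewrite nth_default // -R1E; apply: (@size_cart_coef_le _ _ _ _ _ _ sR 2); rewrite ?sr
      //; lia.
  by rewrite nth_default // -R1E; apply: (@size_cart_coef_le _ _ _ _ _ _ sR 2); rewrite ?sr
    //; lia.
case: nuE => [/eqP|nuE]; first by rewrite (negPf al0).
have [p5|p7] := p57.
  have n3 : n = 3%N by lia.
  by clear ks qs q1 sR mR; subst n p mu; apply: no_odd_quadratic_pencil5 E1.
have nz3 : 3%:R != 0 :> k by apply: (natr_small_neq0 pk) => //; lia.
pose h := e / 3%:R; have eE : e = 3 * h by rewrite /h mulrC divfK.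
have nuE' : nu = 48 * h ^+ 2.
  by apply: (mulfI nz3); rewrite nuE eE; ring.
case/eqP: al0; clearbody h; subst mu nu e.
exact: (odd_part_large pk p_n p_ge5 qs p7 q1).
Qed.

(* F = P * F' says that dX/P = dF/F, where dX/P = Q2 dX/(Q1 Q2^p - Q2 Q1^p). *)
Definition log_pencil p (k : fieldType) (Q1 Q2 : {poly k}) : Prop :=
  [/\ size Q1 = 5%N, size Q2 = 5%N, coprimep Q1 Q2,
      size (Q1 * Q2 ^+ p - Q2 * Q1 ^+ p) = (4 * p).+4.+1 &
      exists P F : {poly k}, [/\ F != 0, F = P * F^`() &
        Q2 * P = Q1 * Q2 ^+ p - Q2 * Q1 ^+ p]].

Lemma size_comp_XaddC (k : fieldType) (f : {poly k}) t : size (f \Po ('X + t%:P)) = size f.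
Proof. exact: size_comp_poly2 (size_XaddC t). Qed.

Lemma comp_poly_expn (k : fieldType) (f g : {poly k}) m : (f ^+ m) \Po g = (f \Po g) ^+ m.
Proof. exact: (rmorphXn (comp_poly g)). Qed.

Lemma log_pencil_translate p (k : fieldType) (Q1 Q2 : {poly k}) t : log_pencil p Q1 Q2 ->
  log_pencil p (Q1 \Po ('X + t%:P)) (Q2 \Po ('X + t%:P)).
Proof.
case=> s1 s2 co sL [P [F [F0 EF EP]]]; split; rewrite ?size_comp_XaddC ?coprimep_comp_poly //.
  by rewrite -!comp_poly_expn -!comp_polyM -comp_polyB size_comp_XaddC.
exists (P \Po ('X + t%:P)), (F \Po ('X + t%:P)); split.
- by rewrite -size_poly_eq0 size_comp_XaddC size_poly_eq0.
- by rewrite deriv_comp derivD derivX derivC addr0 mulr1 -comp_polyM -EF.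
- by rewrite -!comp_poly_expn -!comp_polyM -comp_polyB EP.
Qed.

(** * Normal forms of logarithmic pencils *)

Section LogPencil.
Variables (p : nat) (k : closedFieldType) (pk : p \in [pchar k]).
Hypothesis p_ge5 : (4 < p)%N.
Let n := p.-2.
Let p_n : p = n.+2. Proof. by rewrite /n; lia. Qed.

(** a1 is the p-th root of the leading coefficient of Q1 Q2^p - Q2 Q1^p, so the size condition in
    [log_pencil] gives a1 != 0. *)
Lemma log_pencil_rel (R1 R2 : {poly k}) (m11 m12 m21 m22 : k) :
  size R1 = 5%N -> R1 \is monic -> (size R2 <= 4)%N ->
  log_pencil p (m11 *: R1 + m12 *: R2) (m21 *: R1 + m22 *: R2) ->
  exists g a1 a2 b2, a1 != 0 /\
    let b1 := proot pk (m22 * m11 ^+ p - m12 * m21 ^+ p) in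
    g *: \sum_(j < n.+1) cart_coef n pk R1 R2 j * (a1 *: R1 + a2 *: R2) ^+ j
      * (b1 *: R1 + b2 *: R2) ^+ (n - j) = 1.
Proof.
move=> sR mR s2 [sQ1 sQ2 _ sL [P [F [F0 EF EP]]]].
set Q1 := m11 *: R1 + _ in sQ1 sL EP; set Q2 := m21 *: R1 + _ in sQ2 sL EP.
have Q20 : Q2 != 0 by rewrite -size_poly_eq0 sQ2.
have Q10 : Q1 != 0 by rewrite -size_poly_eq0 sQ1.
have P0 : P != 0 by apply: contraNneq F0 => P0; rewrite EF P0 mul0r.
have E := cart_pencil P0 Q20 EP (cart_log pk F0 EF).
exists (proot pk (m11 * m22 - m12 * m21)), (proot pk (m11 * m21 ^+ p - m21 * m11 ^+ p)).
exists (proot pk (m11 * m22 ^+ p - m21 * m12 ^+ p)), (proot pk (m22 * m12 ^+ p - m12 * m22 ^+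
  p)).
split; last first.
  move: E; rewrite (_ : p.-1 = n.+1); last by rewrite /n; lia.
  move=> <-; congr (_ *: _); apply: eq_bigr => j _; rewrite /cart_coef leq_ord.
  by congr (_ * _ ^+ _ * _ ^+ _).
rewrite proot_eq0.
have R14 : R1`_4 = 1 by have := mR; rewrite monicE lead_coefE sR => /eqP.
have R24 : R2`_4 = 0 by rewrite nth_default.
have l1 : lead_coef Q1 = m11 by rewrite lead_coefE sQ1 coefD !coefZ R14 R24 mulr0 addr0 mulr1.
have l2 : lead_coef Q2 = m21 by rewrite lead_coefE sQ2 coefD !coefZ R14 R24 mulr0 addr0 mulr1.
have sX (A B : {poly k}) : size A = 5%N -> size B = 5%N -> size (A * B ^+ p) = (4 * p).+4.+1.
  move=> sA sB; have A0 : A != 0 by rewrite -size_poly_eq0 sA.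
  have B0 : B ^+ p != 0 by rewrite expf_neq0 // -size_poly_eq0 sB.
  rewrite size_mul // sA; have := size_exp B p; rewrite sB.
  by move: B0; rewrite -size_poly_eq0; move: (size _) => x; lia.
have lX (A B : {poly k}) : size A = 5%N -> size B = 5%N -> (A * B ^+ p)`_(4 * p).+4 =
  lead_coef A * lead_coef B ^+ p.
  by move=> sA sB; rewrite -lead_coef_exp -lead_coefM lead_coefE sX.
apply/eqP => N0.
have : lead_coef (Q1 * Q2 ^+ p - Q2 * Q1 ^+ p) = 0.
  by rewrite lead_coefE sL /= coefB !lX // l1 l2 N0.
by move/eqP; rewrite lead_coef_eq0 -size_poly_eq0 sL.
Qed.

Lemma poly5E (f : {poly k}) : (size f <= 5)%N ->
  f = f`_4 *: 'X ^+ 4 + f`_3 *: 'X ^+ 3 + f`_2 *: 'X ^+ 2 + f`_1 *: 'X + (f`_0)%:P.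
Proof.
move=> sf; rewrite -{1}[f](coefK) poly_def (big_ord_widen 5%N (fun i => f`_i *: 'X^i)) //
  big_mkcond /=.
rewrite !big_ord_recl big_ord0 /=.
have h i : (if (i < size f)%N then f`_i *: 'X^i else 0) = f`_i *: 'X^i.
  by case: ltnP => // /(nth_default 0) ->; rewrite scale0r.
by rewrite !h /bump /= expr0 alg_polyC; ring.
Qed.

Theorem log_pencil_class (Q1 Q2 : {poly k}) : log_pencil p Q1 Q2 ->
  p = 5%N /\ exists t m11 m12 m21 m22,
   [/\ Q1 \Po ('X + t%:P) = m11 *: 'X ^+ 4 + m12%:P,
       Q2 \Po ('X + t%:P) = m21 *: 'X ^+ 4 + m22%:P &
       m22 * m11 ^+ p = m12 * m21 ^+ p].
Proof.
move=> LP; have [s1 s2 co _ _] := LP.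
have nz m : (0 < m < 5)%N -> m%:R != 0 :> k.
  by case/andP=> m0 m5; apply: (natr_small_neq0 pk) => //; apply: leq_trans m5 _.
have Q10 : Q1 != 0 by rewrite -size_poly_eq0 s1.
pose m11 := lead_coef Q1; have m11_0 : m11 != 0 by rewrite lead_coef_eq0.
pose R1 := m11^-1 *: Q1.
have Q1E : Q1 = m11 *: R1 by rewrite scalerA divff // scale1r.
have sR : size R1 = 5%N by rewrite size_scale ?invr_eq0.
have mR : R1 \is monic by rewrite monicE lead_coefZ mulVf.
pose m21 := lead_coef Q2; pose R0 := Q2 - m21 *: R1.
have Q2E : Q2 = m21 *: R1 + R0 by rewrite /R0; ring.
have R00 : R0 != 0.
  apply/eqP => R00; move: co; rewrite Q2E R00 addr0 Q1E coprimepZl // coprimepZr.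
    by rewrite coprimepp sR.
  by rewrite lead_coef_eq0 -size_poly_eq0 s2.
have sR0 : (size R0 <= 4)%N.
  apply/leq_sizeP => j; rewrite leq_eqVlt => /orP[/eqP <-|j5].
    rewrite coefB coefZ; have := mR; rewrite monicE lead_coefE sR => /eqP -> /=.
    by rewrite mulr1 /m21 lead_coefE s2 subrr.
  by rewrite coefB coefZ !nth_default ?sR ?s2 // mulr0 subrr.
pose m22 := lead_coef R0; have m22_0 : m22 != 0 by rewrite lead_coef_eq0.
pose R2 := m22^-1 *: R0.
have R0E : R0 = m22 *: R2 by rewrite scalerA divff // scale1r.
have sR2 : size R2 = size R0 by rewrite size_scale ?invr_eq0.
have mR2 : R2 \is monic by rewrite monicE lead_coefZ mulVf.
have LP0 : log_pencil p (m11 *: R1 + 0 *: R2) (m21 *: R1 + m22 *: R2).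
  by rewrite scale0r addr0 -Q1E -R0E -Q2E.
rewrite -sR2 in sR0; rewrite R0E in Q2E.
clearbody R2 m22; clear R00 sR2 R0E; clearbody R0; clear R0; clearbody R1 m11 m21.
have szR2 : size R2 = 1%N \/ size R2 = 3%N.
  have [//|g [a1 [a2 [b2 [a10 E1]]]]] := log_pencil_rel sR mR _ LP0.
  have n4 := pencil_size_neq4 p_n p_ge5 sR mR mR2 a10 E1.
  have n2 := pencil_size_neq2 p_n p_ge5 sR mR mR2 a10 E1.
  move: n4 n2 sR0 (monic_neq0 mR2); rewrite -size_poly_eq0; move: (size R2) => s n4 n2 s4 s0;
    lia.
pose tr t f : {poly k} := f \Po ('X + t%:P).
have tr1 t : tr t Q1 = m11 *: tr t R1 by rewrite /tr Q1E comp_polyZ.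
have tr2 t : tr t Q2 = m21 *: tr t R1 + m22 *: tr t R2.
  by rewrite /tr Q2E comp_polyD !comp_polyZ.
have str t f : size (tr t f) = size f by apply: size_comp_XaddC.
have mtr t f : f \is monic -> tr t f \is monic.
  by rewrite !monicE lead_coef_comp ?size_XaddC // lead_coefXaddC expr1n mulr1.
have tr4E t : exists f3 f2 f1 f0, tr t R1 = 'X ^+ 4 + f3 *: 'X ^+ 3 + f2 *: 'X ^+ 2 + f1 *:
  'X + f0%:P.
  exists (tr t R1)`_3, (tr t R1)`_2, (tr t R1)`_1, (tr t R1)`_0.
  have := mtr t _ mR; rewrite monicE lead_coefE str sR /= => /eqP E4.
  by have := @poly5E (tr t R1); rewrite str sR E4 scale1r; apply.
case: szR2 => sz; last first.
  (* The translation completes the square in R2. *)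
  exfalso; pose t := - (R2`_1 / 2%:R).
  have [e R2E] : exists e, tr t R2 = 'X ^+ 2 - e%:P.
    have := mR2; rewrite monicE lead_coefE sz => /eqP R22.
    exists (t ^+ 2 - R2`_0).
    have := @poly5E R2; rewrite sz [R2`_2]R22 => /(_ isT).
    rewrite [R2`_4]nth_default ?sz // [R2`_3]nth_default ?sz // !scale0r !add0r => R2E.
    rewrite /tr {1}R2E !(comp_polyD, comp_polyZ, comp_poly_expn, comp_polyC, comp_polyX).
    have -> : R2`_1 = - 2 * t by rewrite /t mulrN mulNr opprK mulrC divfK ?nz.
    by rewrite -!mul_polyC; ring.
  have [f3 [f2 [f1 [f0 R1E]]]] := tr4E t.
  (* la is the constant term in the digit of r of the translated R1; la r is moved into the second
     basis vector. *)
  pose la := f2 + 2 * e; pose mu := f1 + f3 * e; pose nu := f0 - e ^+ 2 + la * e.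
  pose r : {poly k} := 'X ^+ 2 - e%:P.
  pose R := r ^+ 2 + f3%:P * 'X * r + mu%:P * 'X + nu%:P.
  have R1E' : tr t R1 = R + la *: r.
    by rewrite R1E /R /r /nu /mu /la -!mul_polyC; ring.
  have := log_pencil_translate t LP; rewrite -/(tr t Q1) -/(tr t Q2) tr1 tr2 R2E -/r R1E'.
  have -> : m11 *: (R + la *: r) = m11 *: R + (m11 * la) *: r by rewrite scalerDr scalerA.
  have -> : m21 *: (R + la *: r) + m22 *: r = m21 *: R + (m21 * la + m22) *: r.
    by rewrite scalerDr scalerA scalerDl addrA.
  case/log_pencil_rel; rewrite ?size_quartic ?monic_quartic ?size_quad // => g [a1 [a2 [b2
    [a10 E1]]]].
  exact: no_quadratic_pencil p_n p_ge5 a10 E1.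
(* The translation removes the cubic term of R1; the constant term f0 is moved into the second basis
   vector. *)
pose t := - (R1`_3 / 4%:R).
have R2E u : tr u R2 = 1.
  have := mtr u _ mR2; rewrite monicE lead_coefE str sz => /eqP E0.
  by rewrite [LHS]size1_polyC ?str ?sz // E0.
have [f2 [f1 [f0 R1E]]] : exists f2 f1 f0, tr t R1 = 'X ^+ 4 + f2 *: 'X ^+ 2 + f1 *: 'X + f0%:P.
  have [g3 [g2 [g1 [g0 R1E]]]] := tr4E t; exists g2, g1, g0; rewrite R1E.
  suff -> : g3 = 0 by rewrite scale0r addr0.
  have := congr1 (fun f : {poly k} => f`_3) R1E.
  rewrite !(coefD, coefZ, coefXn, coefX, coefC) /= !(mulr0, addr0, add0r) mulr1 => <-.
  have := mR; rewrite monicE lead_coefE sR => /eqP R14.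
  have := @poly5E R1; rewrite sR R14 => /(_ isT) R1E'.
  rewrite /tr {1}R1E' !(comp_polyD, comp_polyZ, comp_poly_expn, comp_polyC, comp_polyX).
  rewrite (_ : _ + _ = 'X ^+ 4 + (4 * t + R1`_3) *: 'X ^+ 3 + (6 * t ^+ 2 + 3 * t * R1`_3 +
    R1`_2) *: 'X ^+ 2
    + (4 * t ^+ 3 + 3 * t ^+ 2 * R1`_3 + 2 * t * R1`_2 + R1`_1) *: 'X
    + (t ^+ 4 + t ^+ 3 * R1`_3 + t ^+ 2 * R1`_2 + t * R1`_1 + R1`_0)%:P); last by rewrite
      -!mul_polyC; ring.
  rewrite !(coefD, coefZ, coefXn, coefX, coefC) /= !(mulr0, addr0, add0r) mulr1.
  by rewrite /t mulrN mulrC divfK ?nz // addNr.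
pose R := 'X ^+ 4 + f2 *: 'X ^+ 2 + f1 *: 'X.
have Q1t : tr t Q1 = m11 *: R + (m11 * f0) *: 1.
  by rewrite tr1 R1E /R -!mul_polyC; ring.
have Q2t : tr t Q2 = m21 *: R + (m21 * f0 + m22) *: 1.
  by rewrite tr2 R1E R2E /R -!mul_polyC; ring.
have sRn : size R = 5%N.
  have -> : R = tr t R1 - f0%:P by rewrite R1E /R; ring.
  rewrite size_polyDl str sR // size_polyN (leq_ltn_trans (size_polyC_leq1 _)) //.
have mRn : R \is monic.
  rewrite monicE lead_coefE sRn /R !(coefD, coefZ, coefXn, coefX) /=.
  by rewrite !mulr0 !addr0.
have := log_pencil_translate t LP; rewrite -/(tr t Q1) -/(tr t Q2) Q1t Q2t.
case/log_pencil_rel; rewrite ?size_poly1 // => g [a1 [a2 [b2 [a10 E1]]]].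
have p5 := constant_pencil_char5 p_ge5 sRn a10 E1 erefl.
have [|R4 b10] := constant_pencil_class p_n p_ge5 sRn mRn (monic1 _) a10 E1 _ erefl erefl;
  first by rewrite size_poly1.
split=> //; exists t, m11, (m11 * f0), m21, (m21 * f0 + m22).
rewrite -/(tr t Q1) -/(tr t Q2) Q1t Q2t R4 !alg_polyC; split=> //.
by move/eqP: b10; rewrite proot_eq0 subr_eq0 => /eqP.
Qed.

End LogPencil.

(** * Logarithmic forms *)

Lemma frac_step (K : fieldType) (x y z r : K) : x != 0 -> y != 0 ->
  (1 / x - z) * (r / y) = (1 - z * x) * r / (x * y).
Proof. by move=> x0 y0; field; apply/andP. Qed.

Lemma frac_dlog (K : fieldType) (d u v : K) : u != 0 -> v != 0 ->
  d / (v * v) / (u / v) = d / (u * v).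
Proof. by move=> u0 v0; field; apply/andP. Qed.

Section Forms.
Variable k : closedFieldType.
Implicit Types (P F u v : {poly k}) (f : ratfun k).

Lemma tofrac_neq0 u : u != 0 -> tofrac u != 0 :> ratfun k.
Proof. by rewrite tofrac_eq0. Qed.

Lemma invX_nonconst (c : k) : rfrac 1 'X != tofrac c%:P.
Proof.
rewrite /rfrac tofrac1 mul1r; apply/eqP => /(congr1 (fun z => z * tofrac 'X)).
rewrite mulVf ?tofrac_neq0 ?polyX_eq0 // -tofracM -tofrac1 => /eqP; rewrite tofrac_eq =>
  /eqP/(congr1 (fun w : {poly k} => w`_0)).
by rewrite coef1 coefMX /=; apply/eqP/oner_neq0.
Qed.

Lemma poly_at_invX P : P != 0 -> exists2 R : {poly k}, R.[0] != 0 &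
  poly_at P (rfrac 1 'X) = rfrac R ('X ^+ (size P).-1).
Proof.
move=> P0; have [s] := closed_field_poly_normal P.
set c := lead_coef P => PE; have c0 : c != 0 by rewrite lead_coef_eq0.
have -> : (size P).-1 = size s by rewrite PE size_scale // size_prod_XsubC.
rewrite {P0}PE -mul_polyC poly_atM /poly_at map_polyC hornerC /= -/(poly_at _ _).
suff [R R0 ->] : exists2 R : {poly k}, R.[0] != 0 & poly_at (\prod_(z <- s) ('X - z%:P))
  (rfrac 1 'X) = rfrac R ('X ^+ size s).
  by exists (c%:P * R); rewrite ?hornerM ?hornerC ?mulf_neq0 // /rfrac tofracM mulrA.
elim: s => [|z s [R R0 IH]].
  by exists 1; rewrite ?hornerC ?oner_neq0 // big_nil /poly_at rmorph1 hornerC /rfrac expr0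
    divff ?tofrac_neq0 ?oner_neq0.
exists ((1 - z *: 'X) * R); first by rewrite hornerM hornerD hornerN hornerZ hornerX hornerC
  mulr0 subr0 mul1r.
rewrite big_cons poly_atM IH poly_atXsubC /rfrac /= exprS !tofracM tofracB -mul_polyC tofracM
  tofrac1.
by rewrite frac_step ?tofrac_neq0 ?expf_neq0 ?polyX_eq0.
Qed.

Lemma form_ord_inf P : P != 0 -> form_ord (rfrac 1 P) None = (size P).-1%:Z - 2.
Proof.
move=> P0; rewrite /form_ord rcompE //; last exact: invX_nonconst.
have [R R0 ->] := poly_at_invX P0.
have Rn : R != 0 by apply: contraNneq R0 => ->; rewrite horner0.
have -> : poly_at 1 (rfrac 1 'X) / rfrac R ('X ^+ (size P).-1) = rfrac ('X ^+ (size P).-1) R.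
  rewrite /poly_at rmorph1 hornerC /rfrac mul1r invf_div //.
rewrite rordE ?expf_neq0 ?polyX_eq0 //; congr (_ - _).
have -> : mup 0 R = 0%N by rewrite mupNroot.
by rewrite subr0 -['X]subr0 -polyC0 mup_XsubCX eqxx.
Qed.

Lemma form_ord_finite P x : P != 0 -> form_ord (rfrac 1 P) (Some x) = - (mup x P)%:Z.
Proof.
move=> P0; rewrite /form_ord rordE ?oner_neq0 //.
have -> : mup x (1 : {poly k}) = 0%N by rewrite mupNroot ?root1.
by rewrite sub0r.
Qed.

(** In lowest terms a root of the numerator would be a finite zero of the form, so the numerator is
    constant. *)
Lemma form_inv_poly f M : f != 0 ->
  (forall Q, 0 < form_ord f Q -> Q = None) -> form_ord f None = M%:Z - 2 ->
  exists2 P : {poly k}, size P = M.+1 & f = rfrac 1 P.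
Proof.
move=> f0 fz fM; pose u := rnum f; pose v := rden f; have v0 : v != 0 := rden_neq0 f.
have fE : f = rfrac u v := rfrac_numden f.
have u0 : u != 0 by apply: contraNneq f0 => u0; rewrite fE u0 /rfrac tofrac0 mul0r.
have co : coprimep (u %/ gcdp u v) (v %/ gcdp u v) by rewrite coprimep_div_gcd ?u0.
set d := gcdp u v in co; have uE : u = u %/ d * d by rewrite divpK // dvdp_gcdl.
have vE : v = v %/ d * d by rewrite divpK // dvdp_gcdr.
move: uE vE co; move: (u %/ d) (v %/ d) => u' v' uE vE co.
have u'0 : u' != 0 by apply: contraNneq u0 => u'0; rewrite uE u'0 mul0r.
have v'0 : v' != 0 by apply: contraNneq v0 => v'0; rewrite vE v'0 mul0r.
have d0 : d != 0 by apply: contraNneq v0 => d0; rewrite vE d0 mulr0.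
have {}fE : f = rfrac u' v'.
  by rewrite fE uE vE; apply/eqP; rewrite rfrac_eq ?mulf_neq0 //; apply/eqP; ring.
have su : size u' = 1%N.
  apply/eqP/negPn/negP => /closed_rootP[x xu].
  have : 0 < form_ord f (Some x).
    rewrite /form_ord fE rordE //.
    have -> : mup x v' = 0%N by rewrite mupNroot // /root; exact: coprimep_root co xu.
    by rewrite subr0 ltz_nat -XsubC_dvd // dvdp_XsubCl.
  by move/fz.
have [c c0 u'E] : exists2 c, c != 0 & u' = c%:P.
  exists u'`_0; last by rewrite -size1_polyC ?su.
  by have := u'0; rewrite {1}[u']size1_polyC ?su // polyC_eq0.
have {}fE : f = rfrac 1 (c^-1 *: v').
  rewrite fE u'E; apply/eqP; rewrite rfrac_eq ?scaler_eq0 ?negb_or ?invr_eq0 ?c0 //.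
  by rewrite mul1r mul_polyC scalerA divff // scale1r.
exists (c^-1 *: v') => //; move: fM; rewrite fE form_ord_inf; last first.
  by rewrite scaler_eq0 negb_or invr_eq0 c0.
move=> /addIr [<-]; rewrite prednK // lt0n size_poly_eq0 scaler_eq0 negb_or invr_eq0 c0 //.
Qed.

Variables (p : nat) (pk : p \in [pchar k]).

(** Multiplying u / v by v^p, whose derivative is 0, makes it a polynomial without changing its
    logarithmic derivative. *)
Lemma logarithmic_poly P : P != 0 -> logarithmic (rfrac 1 P) ->
  exists2 F : {poly k}, F != 0 & F = P * F^`().
Proof.
have pP := pcharf_prime pk.
move=> P0 [G [G0 E]]; pose u := rnum G; pose v := rden G; have v0 : v != 0 := rden_neq0 G.
have GE : G = rfrac u v := rfrac_numden G.
have u0 : u != 0 by apply: contraNneq G0 => u0; rewrite GE u0 /rfrac tofrac0 mul0r.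
have {}E : u * v = P * (u^`() * v - u * v^`()).
  move: E; rewrite GE rderivE // {2}/rfrac => E; apply/eqP.
  have : rfrac 1 P = rfrac (u^`() * v - u * v^`()) (u * v).
    by rewrite E /rfrac expr2 !tofracM frac_dlog ?tofrac_neq0.
  by move/eqP; rewrite rfrac_eq ?mulf_neq0 // mul1r => /eqP ->; rewrite mulrC.
exists (u * v ^+ p.-1); first by rewrite mulf_neq0 ?expf_neq0.
rewrite derivM deriv_exp -scaler_nat.
have -> : (p.-1)%:R = - 1 :> k.
  by apply/eqP; rewrite -subr_eq0 opprK natr1 prednK ?prime_gt0 // (pcharf0 pk).
have vX : v ^+ p.-1 = v * v ^+ p.-2 by rewrite -exprS prednK // -subn1 subn_gt0 prime_gt1.
rewrite vX mulrA E scaleN1r; ring.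
Qed.

Lemma poly_logarithmic P F : P != 0 -> F != 0 -> F = P * F^`() -> logarithmic (rfrac 1 P).
Proof.
move=> P0 F0 E; exists (tofrac F); split; first by rewrite tofrac_neq0.
have -> : tofrac F = rfrac F 1 by rewrite /rfrac tofrac1 divr1.
rewrite rderivE ?oner_neq0 // derivC mulr0 subr0 mulr1 expr1n /rfrac tofrac1 !divr1 mul1r.
have F'0 : F^`() != 0 by apply: contraNneq F0 => F'0; rewrite E F'0 mulr0.
by rewrite {2}E tofracM invfM mulrCA divff ?mulr1 ?tofrac_neq0.
Qed.

(** The residue of dF/F at x is the multiplicity m of x in F. Writing P = (X - x) P0 gives m P0(x) =
    1 with P0(x) = P'(x), so P'(x) lies in the prime field and is nonzero. *)
Lemma log_root P F x : F != 0 -> F = P * F^`() -> root P x ->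
  P^`().[x] != 0 /\ P^`().[x] ^+ p = P^`().[x].
Proof.
move=> F0 E Px; have [m [g]] := multiplicity_XsubC F x; rewrite F0 /= => gx FE.
have [P0 PE] := factor_theorem _ _ Px.
have m0 : (0 < m)%N.
  rewrite lt0n; apply: contraNneq gx => m0; rewrite /root.
  have -> : g = F by rewrite FE m0 expr0 mulr1.
  by rewrite E hornerM (rootP Px) mul0r.
have dP : P^`().[x] = P0.[x].
  by rewrite PE derivM derivXsubC mulr1 hornerD hornerM hornerXsubC subrr mulr0 add0r.
have : g = P0 * (g^`() * ('X - x%:P) + m%:R *: g).
  have X0 : ('X - x%:P) ^+ m != 0 by rewrite expf_neq0 // polyXsubC_eq0.
  apply: (mulIf X0); rewrite -FE {1}E PE FE derivM deriv_exp derivXsubC mul1r -scaler_nat.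
  rewrite -(prednK m0) /= exprS -!mul_polyC; ring.
move/(congr1 (fun h : {poly k} => h.[x])); rewrite hornerM hornerD hornerM hornerXsubC subrr
  mulr0 add0r hornerZ.
rewrite mulrA -{1}[g.[x]]mul1r => /(mulIf gx) Em; rewrite dP.
have P00 : P0.[x] != 0 by apply: contra_eq_neq Em => ->; rewrite mul0r oner_neq0.
split=> //; apply: (@mulIf _ (m%:R ^+ p)).
  by rewrite expf_neq0 //; apply: contra_eq_neq Em => ->; rewrite mulr0 oner_neq0.
rewrite -exprMn -Em expr1n -(pFrobenius_autE pk) pFrobenius_aut_nat; exact: Em.
Qed.

End Forms.

(** * From spaces of forms to pencils *)

Section PrimeField.
Variables (p : nat) (K : fieldType) (pK : p \in [pchar K]).
Let pP := pcharf_prime pK.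

Lemma natr_expp m : m%:R ^+ p = m%:R :> K.
Proof. by rewrite -(pFrobenius_autE pK) pFrobenius_aut_nat. Qed.

Lemma natr_pchar_inj i j : (i < p)%N -> (j < p)%N -> i%:R = j%:R :> K -> i = j.
Proof.
wlog ij : i j / (i <= j)%N.
  by move=> W ip jp E; case: (leqP i j) => [/W|/ltnW/W] -> //.
move=> ip jp E; apply/eqP; rewrite eqn_leq ij /= -subn_eq0.
have : (j - i)%:R = 0 :> K by rewrite natrB // E subrr.
move/eqP; rewrite -(dvdn_pcharf pK); apply: contraLR => ji.
by rewrite gtnNdvd ?lt0n // (leq_ltn_trans (leq_subr _ _)).
Qed.

Lemma prod_XsubFp (a : K) : a != 0 ->
  'X ^+ p - a ^+ p.-1 *: 'X = \prod_(i < p) ('X - (i%:R * a)%:P).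
Proof.
move=> a0; pose rs := [seq i%:R * a | i <- iota 0 p].
have srs : size rs = p by rewrite size_map size_iota.
have sX : (size (a ^+ p.-1 *: 'X) < size ('X ^+ p : {poly K}))%N.
  by rewrite size_polyXn (leq_ltn_trans (size_scale_leq _ _)) // size_polyX ltnS prime_gt1.
have sL : size ('X ^+ p - a ^+ p.-1 *: 'X) = p.+1.
  by rewrite size_polyDl ?size_polyN // size_polyXn.
have := @all_roots_prod_XsubC _ ('X ^+ p - a ^+ p.-1 *: 'X) rs; rewrite srs sL => ->//.
- rewrite lead_coefDl ?size_polyN // lead_coefXn scale1r big_map.
  by rewrite -(big_mkord xpredT (fun i => 'X - (i%:R * a)%:P)) /index_iota subn0.
- apply/allP => x /mapP[i _ ->]; rewrite /root hornerD hornerN hornerZ hornerX hornerXn.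
  by rewrite exprMn natr_expp mulrCA -exprSr prednK ?prime_gt0 // subrr.
- rewrite uniq_rootsE map_inj_in_uniq ?iota_uniq // => i j; rewrite !mem_iota !add0n /= => ip
  jp.
  by move/(mulIf a0)/natr_pchar_inj; apply.
Qed.

Lemma prod_subFp (x a : K) : a != 0 ->
  x ^+ p - a ^+ p.-1 * x = \prod_(i < p) (x - i%:R * a).
Proof.
move=> a0; have := congr1 (fun f : {poly K} => f.[x]) (prod_XsubFp a0).
rewrite horner_prod hornerD hornerN hornerZ hornerX hornerXn => ->.
by apply: eq_bigr => i _; rewrite hornerXsubC.
Qed.

Lemma fixed_natr (x : K) : x ^+ p = x -> exists2 i, (i < p)%N & x = i%:R.
Proof.
move=> xp; have := prod_subFp x (oner_neq0 K); rewrite expr1n mul1r xp subrr => /esym/eqP.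
by case/prodf_eq0 => i _; rewrite mulr1 subr_eq0 => /eqP ->; exists i.
Qed.

End PrimeField.

Section Structure.
Variables (p : nat) (k : closedFieldType) (pk : p \in [pchar k]).
Let pP := pcharf_prime pk.
Hypothesis p_ge5 : (4 < p)%N.

Lemma prod_addFp (A1 A2 : {poly k}) : A1 != 0 ->
  \prod_(i < p) (A2 + i%:R * A1) = A2 * (A2 ^+ p.-1 - A1 ^+ p.-1).
Proof.
move=> A10; have pF : p \in [pchar {fraction {poly k}}].
  exact/(rmorph_pchar (@tofrac {poly k}))/(pchar_polyE pk).
apply/eqP; rewrite -tofrac_eq; apply/eqP.
have podd : odd p by have := even_prime pP; case=> // p2; move: p_ge5; rewrite p2.
have := prod_subFp pF (tofrac A2) (a := - tofrac A1); rewrite oppr_eq0 tofrac_eq0 => /(_ A10).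
rewrite exprNn -signr_odd; have -> : odd p.-1 = false by case: (p) podd => //= q /negbTE.
rewrite mul1r rmorph_prod => E.
transitivity (tofrac A2 ^+ p - tofrac A1 ^+ p.-1 * tofrac A2).
  rewrite E; apply: eq_bigr => i _; by rewrite rmorphD rmorphM rmorph_nat mulrN opprK.
rewrite tofracM tofracB !rmorphXn -{1}(prednK (prime_gt0 pP)) exprS; ring.
Qed.

Lemma prod_coprime_dvdp (I : eqType) (s : seq I) (F : I -> {poly k}) (D : {poly k}) : uniq s ->
  (forall i, i \in s -> F i %| D) ->
  (forall i j, i \in s -> j \in s -> i != j -> coprimep (F i) (F j)) ->
  \prod_(i <- s) F i %| D.
Proof.
elim: s => [|i s IH] /=; first by rewrite big_nil dvd1p.
case/andP=> is_ us dv co; rewrite big_cons Gauss_dvdp ?dv ?mem_head ?IH //=.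
- by move=> j js; rewrite dv // in_cons js orbT.
- by move=> j l js ls; apply: co; rewrite in_cons ?js ?ls orbT.
rewrite big_seq; elim/big_ind: _ => [|u v cu cv|j js]; first exact: coprimep1.
  by rewrite coprimepMr cu.
apply: co; rewrite ?mem_head // ?in_cons ?js ?orbT //.
by apply: contraNneq is_ => ->.
Qed.

Lemma size_prod_const (I : eqType) (s : seq I) (F : I -> {poly k}) a :
  (forall i, i \in s -> size (F i) = a.+1) -> size (\prod_(i <- s) F i) = (a * size s).+1.
Proof.
elim: s => [|i s IH] h; first by rewrite big_nil size_poly1 muln0.
have {}IH : size (\prod_(j <- s) F j) = (a * size s).+1.
  by apply: IH => j js; apply: h; rewrite in_cons js orbT.
have Fi := h i (mem_head _ _); rewrite big_cons size_mul ?Fi ?IH -?size_poly_eq0 ?Fi ?IH //=.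
by rewrite mulnS; lia.
Qed.

(** The last hypothesis says 1/P1 + i/P2 = 1/P. After removing D = gcd(P1, P2), each A2 + i A1 is
    coprime to A1 A2 and so divides D; these factors are pairwise coprime and their product over i
    != 0 is H. The degree 4p = p deg A2 then gives quartics. *)
Lemma log_pencil_of_forms (P1 P2 F1 F2 : {poly k}) :
  size P1 = (4 * p).+1 -> size P2 = (4 * p).+1 ->
  F1 != 0 -> F1 = P1 * F1^`() -> F2 != 0 -> F2 = P2 * F2^`() ->
  (forall i, (0 < i < p)%N -> exists2 P : {poly k}, size P = (4 * p).+1 &
     (P2 + i%:R * P1) * P = P1 * P2) ->
  exists Q1 Q2, [/\ log_pencil p Q1 Q2, P1 = Q1 * (Q2 ^+ p.-1 - Q1 ^+ p.-1)
     & P2 = Q2 * (Q2 ^+ p.-1 - Q1 ^+ p.-1)].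
Proof.
move=> s1 s2 F10 E1 F20 E2 comb.
have P10 : P1 != 0 by rewrite -size_poly_eq0 s1.
have P20 : P2 != 0 by rewrite -size_poly_eq0 s2.
have p0 := prime_gt0 pP.
have [A1 [A2 [D [co P1E P2E]]]] : exists A1 A2 D, [/\ coprimep A1 A2, P1 = A1 * D & P2 = A2 *
  D].
  exists (P1 %/ gcdp P1 P2), (P2 %/ gcdp P1 P2), (gcdp P1 P2).
  by rewrite coprimep_div_gcd ?P10 // !divpK ?dvdp_gcdl ?dvdp_gcdr.
have A10 : A1 != 0 by apply: contraNneq P10 => h; rewrite P1E h mul0r.
have A20 : A2 != 0 by apply: contraNneq P20 => h; rewrite P2E h mul0r.
have D0 : D != 0 by apply: contraNneq P20 => h; rewrite P2E h mulr0.
have sA : size A1 = size A2.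
  have := s1; rewrite -s2 P1E P2E !size_mul //.
  have : (0 < size D)%N by rewrite lt0n size_poly_eq0.
  by move: (size A1) (size A2) (size D) => x y z; clear; lia.
have combA i : (0 < i < p)%N -> A2 + i%:R * A1 %| D /\ size (A2 + i%:R * A1) = size A2.
  move=> ip; have [P sP E] := comb i ip; have [i0 i_p] := andP ip.
  have P0 : P != 0 by rewrite -size_poly_eq0 sP.
  have {}E : (A2 + i%:R * A1) * P = A1 * A2 * D.
    by apply: (mulfI D0); transitivity ((P2 + i%:R * P1) * P); [rewrite P1E P2E; ring |
      rewrite E P1E P2E; ring].
  have B0 : A2 + i%:R * A1 != 0.
    by apply/eqP => B0; move/eqP: E; rewrite B0 mul0r eq_sym !mulf_eq0 (negPf A10) (negPf
      A20) (negPf D0).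
  have iu : i%:R%:P != 0 :> {poly k} by rewrite polyC_eq0 (natr_small_neq0 pk).
  split; last first.
    have := congr1 (fun f : {poly k} => size f) E; rewrite /= mulrAC -P1E !size_mul // s1 sP.
    by move: (size (A2 + i%:R * A1)) (size A2) => x y; clear; lia.
  have c1 : coprimep (A2 + i%:R * A1) A1.
    by rewrite coprimep_sym addrC coprimep_addl_mul.
  have c2 : coprimep (A2 + i%:R * A1) A2.
    rewrite coprimep_sym -[A2 in X in coprimep _ X]mul1r coprimep_addl_mul.
    by rewrite -polyC_natr mul_polyC coprimepZr ?(natr_small_neq0 pk) // coprimep_sym.
  by rewrite -(@Gauss_dvdpr _ _ (A1 * A2)) ?coprimepMr ?c1 ?c2 // -E dvdp_mulr.
pose H := A2 ^+ p.-1 - A1 ^+ p.-1.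
have HE : H = \prod_(1 <= i < p) (A2 + i%:R * A1).
  apply: (mulfI A20); rewrite /H -prod_addFp //.
  rewrite -(big_mkord xpredT (fun i => A2 + i%:R * A1)) big_ltn //.
  by rewrite mul0r addr0.
have HD : H %| D.
  rewrite HE; apply: prod_coprime_dvdp; first exact: iota_uniq.
    by move=> i; rewrite mem_index_iota => /combA[].
  move=> i j; rewrite !mem_index_iota => /andP[i0 ip] /andP[j0 jp] ij.
  have d0 : i%:R - j%:R != 0 :> k.
    by rewrite subr_eq0; apply: contra_neq ij => /(natr_pchar_inj pk); apply.
  rewrite (_ : A2 + j%:R * A1 = 1 * (A2 + i%:R * A1) + (j%:R - i%:R)%:P * A1); last first.
    by rewrite polyCB !polyC_natr; ring.
  rewrite coprimep_addl_mul mul_polyC coprimepZr; last by rewrite subr_eq0 eq_sym -subr_eq0.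
  by rewrite coprimep_sym addrC coprimep_addl_mul.
have [E ED] := dvdpP _ _ HD.
have H0 : H != 0 by apply: contraNneq D0 => h; rewrite ED h mulr0.
(* At a root x of E the derivatives of P1 and P2 are e A1(x) and e A2(x), nonzero elements of the
   prime field. Their (p-1)-th powers are 1, so H(x) = 0, and then e = 0. *)
have EC : size E = 1%N.
  apply/eqP/negPn/negP => /closed_rootP[x /rootP Ex].
  have [|r10 r1p] := log_root pk F10 E1 (x := x); first by rewrite /root P1E ED !hornerM Ex
    mul0r mulr0.
  have [|r20 r2p] := log_root pk F20 E2 (x := x); first by rewrite /root P2E ED !hornerM Ex
    mul0r mulr0.
  have r1E : P1^`().[x] = E^`().[x] * H.[x] * A1.[x].
    by rewrite P1E ED !derivM !(hornerD, hornerM) Ex; ring.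
  have r2E : P2^`().[x] = E^`().[x] * H.[x] * A2.[x].
    by rewrite P2E ED !derivM !(hornerD, hornerM) Ex; ring.
  set e := E^`().[x] * H.[x] in r1E r2E.
  have e0 : e != 0 by apply: contraNneq r10 => h; rewrite r1E h mul0r.
  have a10 : A1.[x] != 0 by apply: contraNneq r10 => h; rewrite r1E h mulr0.
  have a20 : A2.[x] != 0 by apply: contraNneq r20 => h; rewrite r2E h mulr0.
  have pw (y : k) : y != 0 -> y ^+ p = y -> y ^+ p.-1 = 1.
    by move=> y0 yp; apply: (mulfI y0); rewrite -exprS prednK // yp mulr1.
  have Hx : H.[x] = 0.
    apply/eqP; rewrite -(mulrI_eq0 _ (mulfI (expf_neq0 p.-1 e0))); apply/eqP.
    rewrite /H hornerD hornerN !horner_exp mulrBr -!exprMn -r1E -r2E !pw // subrr //.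
  by case/negP: e0; rewrite /e Hx mulr0.
have pA2 : (0 < size A2)%N by rewrite lt0n size_poly_eq0.
have sH : size H = ((size A2).-1 * p.-1).+1.
  rewrite HE (@size_prod_const _ _ _ (size A2).-1) ?size_iota ?subn1 // => i.
  by rewrite mem_index_iota prednK // => /combA[].
have E0 : E != 0 by rewrite -size_poly_eq0 EC.
have sA2 : size A2 = 5%N.
  have := s2; rewrite P2E ED !size_mul ?mulf_neq0 // EC sH.
  have pE : p = p.-1.+1 by rewrite prednK.
  rewrite [X in (4 * X).+1]pE; move: pA2; move: (p.-1) (size A2) => q [|s] //= _ Es.
  have : (s * q.+1 == 4 * q.+1)%N by apply/eqP; rewrite mulnS; move: (s * q)%N Es => x;
    clear; lia.
  by rewrite eqn_pmul2r // => /eqP ->.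
(* Scaling A1 and A2 by c multiplies A_i H by c^p, which absorbs the constant E. *)
pose c := proot pk E`_0.
have EE : E = (c ^+ p)%:P by rewrite /c prootK -size1_polyC ?EC.
have c0 : c != 0.
  by apply: contraNneq E0 => h; rewrite EE h expr0n (gtn_eqF p0).
exists (c *: A1), (c *: A2).
have pX (u : {poly k}) : u ^+ p = u * u ^+ p.-1 by rewrite -exprS prednK.
have cX : c ^+ p = c * c ^+ p.-1 by rewrite -exprS prednK.
have P1E' : P1 = c *: A1 * ((c *: A2) ^+ p.-1 - (c *: A1) ^+ p.-1).
  by rewrite P1E ED EE cX !exprZn -!mul_polyC polyCM /H; ring.
have P2E' : P2 = c *: A2 * ((c *: A2) ^+ p.-1 - (c *: A1) ^+ p.-1).
  by rewrite P2E ED EE cX !exprZn -!mul_polyC polyCM /H; ring.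
have sc1 : size (c *: A1) = 5%N by rewrite size_scale // sA.
have sc2 : size (c *: A2) = 5%N by rewrite size_scale.
split=> //; split=> //.
- by rewrite coprimepZl // coprimepZr.
- have <- : (c *: A2) * P1 = c *: A1 * (c *: A2) ^+ p - c *: A2 * (c *: A1) ^+ p.
    by rewrite P1E' !pX; ring.
  rewrite size_mul ?P10 // -?size_poly_eq0 ?sc2 // s1; clear; lia.
exists P1, F1; split=> //.
by rewrite P1E' !pX; ring.
Qed.

End Structure.

(** * Roots of additive polynomials and translations *)

Lemma Fp_comb2 p (k : fieldType) (a : 'I_2 -> k) (c : 'I_2 -> 'F_p) :
  Fp_comb a c = (c ord0)%:R * a ord0 + (c (lift ord0 ord0))%:R * a (lift ord0 ord0).
Proof. by rewrite /Fp_comb !big_ord_recl big_ord0 addr0 !mulr_natl. Qed.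

Section AdditiveRoots.
Variables (p : nat) (k : closedFieldType) (pk : p \in [pchar k]).
Let pP := pcharf_prime pk.

(** As W != 0, the derivative is a nonzero constant and there are p^2 distinct roots. A nonzero root
    and a second one off its line span p^2 roots, hence all of them. *)
Lemma additive_poly_roots (N V W : k) : N != 0 -> W != 0 ->
  exists a : 'I_2 -> k, Fp_free p a /\
    forall x, N * x ^+ (p ^ 2) + V * x ^+ p + W * x = 0 <-> Fp_span p a x.
Proof.
move=> N0 W0; pose L : {poly k} := N *: 'X ^+ (p ^ 2) + V *: 'X ^+ p + W *: 'X.
have p1 := prime_gt1 pP; have p0 := prime_gt0 pP.
have LE x : L.[x] = N * x ^+ (p ^ 2) + V * x ^+ p + W * x.
  by rewrite !(hornerD, hornerZ, hornerXn, hornerX).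
have LD x y : L.[x + y] = L.[x] + L.[y].
  rewrite !LE !(exprDp pk) (_ : (p ^ 2 = p * p)%N) ?mulnn // !exprM !(exprDp pk); ring.
have LM x y : y ^+ p = y -> L.[y * x] = y * L.[x].
  move=> yp; rewrite !LE (_ : (p ^ 2 = p * p)%N) ?mulnn // !exprM !exprMn !yp; ring.
have sL : size L = (p ^ 2).+1.
  have pp : (p < p ^ 2)%N by rewrite -mulnn -{1}[p]muln1 ltn_pmul2l.
  rewrite /L -addrA size_polyDl size_scale ?size_polyXn //.
  rewrite (leq_ltn_trans (size_polyD _ _)) // gtn_max !(leq_ltn_trans (size_scale_leq _ _))
    ?size_polyXn ?size_polyX ?ltnS //.
  exact: ltn_trans p1 pp.
have L0 : L != 0 by rewrite -size_poly_eq0 sL.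
have dL : L^`() = W%:P.
  rewrite !derivD !derivZ !derivXn derivX -!scaler_nat natrX (pcharf0 pk).
  by rewrite expr0n /= !scale0r !scaler0 !add0r alg_polyC.
have [s Ls] := closed_field_poly_normal L.
have lc0 : lead_coef L != 0 by rewrite lead_coef_eq0.
have us : uniq s.
  rewrite -separable_prod_XsubC unlock.
  have := dL; rewrite Ls derivZ => /(congr1 (fun f => (lead_coef L)^-1 *: f)).
  rewrite scalerA mulVf // scale1r => ->; rewrite -mul_polyC -polyCM.
  by rewrite -alg_polyC coprimepZr ?coprimep1 // mulf_neq0 ?invr_eq0.
have ss : size s = (p ^ 2)%N.
  by apply: succn_inj; rewrite -sL [in RHS]Ls size_scale // size_prod_XsubC.
have rs x : x \in s -> L.[x] = 0.
  by move=> xs; apply/rootP; rewrite Ls rootZ // root_prod_XsubC.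
have ex (u : seq k) : (size u < p ^ 2)%N -> exists2 x, x \in s & x \notin u.
  move=> su; apply/allPn/negP => /allP /(uniq_leq_size us); rewrite ss leqNgt su //.
have [|x1 x1s x10] := ex [:: 0]; first by rewrite -mulnn (leq_trans p1) // leq_pmulr.
have [|x2 x2s x21] := ex [seq j%:R * x1 | j <- iota 0 p].
  by rewrite size_map size_iota -mulnn -{1}[p]muln1 ltn_pmul2l.
rewrite inE in x10.
have fr y0 y1 : y0 ^+ p = y0 -> y1 ^+ p = y1 -> y0 * x1 + y1 * x2 = 0 -> y0 = 0 /\ y1 = 0.
  move=> h0 h1 E; have [y10|y10] := eqVneq y1 0.
    by move: E; rewrite y10 mul0r addr0 => /eqP; rewrite mulf_eq0 (negPf x10) orbF => /eqP ->.
  have [|j jp jE] := fixed_natr pk (x := - (y0 / y1)).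
    rewrite -mulN1r exprMn expr_div_n h0 h1; congr (_ * _).
    have := natr_expp pk p.-1; have -> // : p.-1%:R = -1 :> k.
    by apply/eqP; rewrite -subr_eq0 opprK natr1 prednK // (pcharf0 pk).
  case/negP: x21; apply/mapP; exists j; first by rewrite mem_iota.
  apply: (mulfI y10); rewrite -jE.
  have -> : y1 * (- (y0 / y1) * x1) = - (y0 * x1) by field.
  by apply/eqP; rewrite -addr_eq0 addrC E.
have valF (c : 'F_p) : (c < p)%N by rewrite -[X in (_ < X)%N](Fp_cast pP) ltn_ord.
exists (fun i => if i == 0 then x1 else x2); split.
  move=> c; rewrite Fp_comb2 /= => E.
  have [E0 E1] := fr _ _ (natr_expp pk _) (natr_expp pk _) E.
  have z (d : 'F_p) : d%:R = 0 :> k -> d = 0.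
    by move=> d0; apply: val_inj; apply: (natr_pchar_inj pk); rewrite ?valF.
  move=> i; apply: z; case: (unliftP 0 i) => [j ->|-> //].
  by rewrite (ord1 j).
move=> x; rewrite -LE; split=> [Lx|[c ->]]; last first.
  rewrite Fp_comb2 /= LD !LM ?natr_expp //.
  by rewrite !rs // !mulr0 addr0.
pose S := [seq i%:R * x1 + j%:R * x2 | i <- iota 0 p, j <- iota 0 p].
have : x \in S.
  apply/negPn/negP => xS.
  have uS : uniq (x :: S).
    rewrite /= xS; apply: allpairs_uniq; rewrite ?iota_uniq // => -[i j] [i' j'] /=.
    move=> /allpairsP[[a b] /= [+ + [-> ->]]] /allpairsP[[a' b'] /= [+ + [-> ->]]].
    rewrite !mem_iota /= !add0n => ap bp a'p b'p E.
    have sub m m' : (m%:R - m'%:R) ^+ p = m%:R - m'%:R :> k.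
      rewrite -(pFrobenius_autE pk) (pFrobenius_autB_comm _ (mulrC _ _)) !pFrobenius_autE.
      by rewrite !natr_expp.
    have [|] := fr _ _ (sub a a') (sub b b').
      transitivity (a%:R * x1 + b%:R * x2 - (a'%:R * x1 + b'%:R * x2)); first by ring.
      by rewrite E subrr.
    move=> /eqP; rewrite subr_eq0 => /eqP /(natr_pchar_inj pk ap a'p) -> /eqP.
    by rewrite subr_eq0 => /eqP /(natr_pchar_inj pk bp b'p) ->.
  have rS : all (root L) (x :: S).
    apply/allP => y; rewrite inE => /orP[/eqP -> |/allpairsP[[i j] /= [_ _ ->]]]; first
      exact/rootP.
    by apply/rootP; rewrite LD !LM ?natr_expp // !rs // !mulr0 addr0.
  have := max_poly_roots L0 rS uS; rewrite sL /= size_allpairs !size_iota mulnn ltnn //.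
case/allpairsP => [[i j] /= [+ + ->]]; rewrite !mem_iota /= !add0n => ip jp.
exists (fun l => if l == 0 then i%:R else j%:R).
rewrite Fp_comb2 /=.
by rewrite !val_Fp_nat // !modn_small.
Qed.

End AdditiveRoots.

(** * Pullback of forms along translations *)

Section Translation.
Variables (k : closedFieldType) (t : k).

Definition transl_mx : 'M[k]_2 := \matrix_(i, j) (if i == j then 1 else if i == 0 then t else
  0).
Local Notation A := transl_mx.

Lemma transl_unit : A \in unitmx.
Proof.
rewrite unitmxE -det_tr det_trig; first by rewrite big1 ?unitr1 // => i _; rewrite !mxE eqxx.
apply/is_trig_mxP => i j ij; rewrite !mxE -val_eqE /= (gtn_eqF ij).
by case: (unliftP 0 j) ij => [l ->|->].
Qed.

Lemma transl_inf : mobius_pt A None = None.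
Proof. by rewrite /mobius_pt !mxE /= eqxx. Qed.

Lemma transl_fun : mobius_fun A = tofrac ('X + t%:P).
Proof.
by rewrite /mobius_fun !mxE /= scale1r scale0r add0r /rfrac tofrac1 divr1.
Qed.

Lemma poly_at_tofrac (u q : {poly k}) : poly_at u (tofrac q) = tofrac (u \Po q).
Proof. by rewrite /poly_at /comp_poly map_poly_comp horner_map. Qed.

Lemma pullback_transl (u v : {poly k}) : v != 0 ->
  pullback A (rfrac u v) = rfrac (u \Po ('X + t%:P)) (v \Po ('X + t%:P)).
Proof.
move=> v0; rewrite /pullback transl_fun.
have -> : rderiv (tofrac ('X + t%:P)) = 1.
  have -> : tofrac ('X + t%:P) = rfrac ('X + t%:P) 1 by rewrite /rfrac tofrac1 divr1.
  rewrite rderivE ?oner_neq0 // derivD derivX !derivC addr0 mulr1 mulr0 subr0 expr1n.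
  by rewrite /rfrac tofrac1 divr1.
rewrite mulr1 rcompE //; first by rewrite !poly_at_tofrac.
move=> c; rewrite tofrac_eq; apply/eqP => /(congr1 (fun f : {poly k} => size f)) /=.
by rewrite size_XaddC => E; have := size_polyC_leq1 c; rewrite -E.
Qed.

Lemma comp_transl_neq0 (v : {poly k}) : v != 0 -> v \Po ('X + t%:P) != 0.
Proof. by rewrite -!size_poly_eq0 size_comp_XaddC. Qed.

Lemma pullback_translD f g : pullback A (f + g) = pullback A f + pullback A g.
Proof.
have E (u v u' v' : {poly k}) : v != 0 -> v' != 0 -> rfrac u v + rfrac u' v' = rfrac (u * v'
  + u' * v) (v * v').
  by move=> v0 v0'; rewrite /rfrac addf_div ?tofrac_neq0 // tofracD !tofracM.
rewrite [f]rfrac_numden [g]rfrac_numden E ?rden_neq0 // !pullback_transl ?mulf_neq0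
  ?rden_neq0 //.
by rewrite E ?comp_transl_neq0 ?rden_neq0 // comp_polyD !comp_polyM.
Qed.

Lemma pullback_transl_eq0 f : pullback A f = 0 -> f = 0.
Proof.
rewrite [f]rfrac_numden pullback_transl ?rden_neq0 // => /eqP.
rewrite /rfrac mulf_eq0 invr_eq0 !tofrac_eq0 (negPf (comp_transl_neq0 (rden_neq0 f))) orbF.
rewrite -size_poly_eq0 size_comp_XaddC size_poly_eq0 => /eqP ->.
by rewrite tofrac0 mul0r.
Qed.

Lemma pullback_transl0 : pullback A 0 = 0.
Proof. by apply: (addrI (pullback A 0)); rewrite -pullback_translD !addr0. Qed.

Lemma pullback_translMn f m : pullback A (f *+ m) = pullback A f *+ m.
Proof. by elim: m => [|m IH]; rewrite ?mulr0n ?pullback_transl0 // !mulrS pullback_translD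
  IH. Qed.

Lemma pullback_Fp_comb p n (w : 'I_n -> ratfun k) (c : 'I_n -> 'F_p) :
  pullback A (Fp_comb w c) = Fp_comb (fun i => pullback A (w i)) c.
Proof.
rewrite /Fp_comb (big_morph _ pullback_translD pullback_transl0).
by apply: eq_bigr => i _; rewrite pullback_translMn.
Qed.

End Translation.

Lemma inv_natr_comb (K : fieldType) (x y : K) m1 m2 : x != 0 -> y != 0 ->
  (1 / x) *+ m1 + (1 / y) *+ m2 = (m1%:R * y + m2%:R * x) / (x * y).
Proof.
move=> x0 y0; rewrite -[1 / x *+ m1]mulr_natl -[1 / y *+ m2]mulr_natl; field.
by apply/andP.
Qed.

(** * The pencil of a space of forms *)

Section Lspaces.
Variables (p : nat) (k : closedFieldType) (pk : p \in [pchar k]).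
Let pP := pcharf_prime pk.

Lemma rfrac1_Fp_comb (P1 P2 : {poly k}) (m1 m2 : nat) : P1 != 0 -> P2 != 0 ->
  rfrac 1 P1 *+ m1 + rfrac 1 P2 *+ m2 = rfrac (m1%:R * P2 + m2%:R * P1) (P1 * P2).
Proof.
move=> P10 P20; rewrite /rfrac tofracD !tofracM !tofrac1 !rmorph_nat.
by rewrite inv_natr_comb ?tofrac_neq0.
Qed.

Lemma Lspace_pencil (Om : ratfun k -> Prop) : (4 < p)%N -> Lspace p (4 * p) 2 Om ->
  exists (w : 'I_2 -> ratfun k) (P1 P2 Q1 Q2 : {poly k}),
    [/\ Fp_free p w, forall v, Om v <-> Fp_span p w v,
        w ord0 = rfrac 1 P1 & w (lift ord0 ord0) = rfrac 1 P2] /\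
    [/\ log_pencil p Q1 Q2, P1 != 0, P2 != 0,
        P1 = Q1 * (Q2 ^+ p.-1 - Q1 ^+ p.-1) & P2 = Q2 * (Q2 ^+ p.-1 - Q1 ^+ p.-1)] /\
    exists F1 F2 : {poly k}, [/\ F1 != 0, F1 = P1 * F1^`(), F2 != 0 & F2 = P2 * F2^`()].
Proof.
move=> p5 [_ _ [w [wf Omw]] H].
pose c (i j : 'F_p) (l : 'I_2) := if l == ord0 then i else j.
have cE i j : Fp_comb w (c i j) = w ord0 *+ i + w (lift ord0 ord0) *+ j.
  by rewrite /Fp_comb !big_ord_recl big_ord0 addr0.
have nz i j : (i != 0) || (j != 0) -> Fp_comb w (c i j) != 0.
  move=> ij; apply/eqP => /wf E; move: ij.
  by have := E ord0; have := E (lift ord0 ord0); rewrite /c /= => -> ->; rewrite !eqxx.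
have key i j : (i != 0) || (j != 0) -> exists2 P : {poly k}, size P = (4 * p).+1 &
    Fp_comb w (c i j) = rfrac 1 P /\ exists2 F : {poly k}, F != 0 & F = P * F^`().
  move=> ij; have Oc : Om (Fp_comb w (c i j)) by apply/Omw; exists (c i j).
  have [lg fz fo] := H _ Oc (nz _ _ ij).
  have [P sP PE] := form_inv_poly (nz _ _ ij) fz fo; exists P => //; split=> //.
  have P0 : P != 0 by rewrite -size_poly_eq0 sP.
  by apply: (logarithmic_poly pk P0); rewrite -PE.
have v1 : (1 : 'F_p) = 1%N :> nat by rewrite -[1]/(1%:R) val_Fp_nat // modn_small ?prime_gt1.
have [|P1 s1 [P1E [F1 F10 EF1]]] := key 1 0; first by rewrite oner_neq0.
have [|P2 s2 [P2E [F2 F20 EF2]]] := key 0 1; first by rewrite oner_neq0 orbT.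
rewrite cE v1 mulr0n addr0 mulr1n in P1E; rewrite cE v1 mulr0n add0r mulr1n in P2E.
have P10 : P1 != 0 by rewrite -size_poly_eq0 s1.
have P20 : P2 != 0 by rewrite -size_poly_eq0 s2.
have [|Q1 [Q2 [LP Q1E Q2E]]] := @log_pencil_of_forms p k pk p5 P1 P2 F1 F2 s1 s2 F10 EF1 F20
  EF2.
  move=> i /andP[i0 ip]; have [|P sP [PE _]] := key 1 i%:R; first by rewrite oner_neq0.
  exists P => //; move: PE; rewrite cE v1 val_Fp_nat // modn_small // P1E P2E.
  rewrite rfrac1_Fp_comb // mul1r => /eqP.
  rewrite rfrac_eq ?mulf_neq0 // -?size_poly_eq0 ?sP // mul1r => /eqP; exact.
exists w, P1, P2, Q1, Q2; split; first by split.
by split=> //; exists F1, F2; split.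
Qed.

End Lspaces.

(** * Equivalence with a standard space in characteristic five *)

Section Standard.
Variables (k : closedFieldType) (k5 : 5%N \in [pchar k]).

Lemma Lspace_transl (Om : ratfun k -> Prop) M n t : Lspace 5 M n Om ->
  Lspace 5 M n (fun g => exists2 f, Om f & g = pullback (transl_mx t) f).
Proof.
case=> M1 n0 [w [wf Omw]] H; split=> //.
  exists (fun i => pullback (transl_mx t) (w i)); split.
    by move=> c; rewrite -pullback_Fp_comb => /pullback_transl_eq0/wf.
  move=> v; split=> [[f /Omw[c ->] ->]|[c ->]].
    by exists c; rewrite pullback_Fp_comb.
  by exists (Fp_comb w c); [apply/Omw; exists c | rewrite pullback_Fp_comb].
move=> g [f Of ->] g0; have f0 : f != 0.
  by apply: contraNneq g0 => ->; rewrite pullback_transl0.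
have [lg fz fo] := H f Of f0; have [P sP fE] := form_inv_poly f0 fz fo.
have P0 : P != 0 by rewrite -size_poly_eq0 sP.
have T0 := comp_transl_neq0 t P0.
have -> : pullback (transl_mx t) f = rfrac 1 (P \Po ('X + t%:P)).
  by rewrite fE pullback_transl // comp_polyC.
split.
- have [F F0 EF] := logarithmic_poly k5 P0 (eq_ind f (@logarithmic k) lg _ fE).
  apply: (@poly_logarithmic _ _ (F \Po ('X + t%:P))) => //; first exact: comp_transl_neq0.
  by rewrite deriv_comp derivD derivX derivC addr0 mulr1 -comp_polyM -EF.
- case=> // x; rewrite form_ord_finite // oppr_gt0 => h; exfalso; move: h.
  by rewrite ltNge.
- by rewrite form_ord_inf // size_comp_XaddC sP.
Qed.

(** The poles of the space are the zeros of L = Q2 P1 = Q1 P2, and after translation X L is additive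
    of degree 25. *)
Lemma standard_of_pencil (Om : ratfun k -> Prop) : Lspace 5 (4 * 5) 2 Om ->
  exists Om' : ratfun k -> Prop, standard_Lspace 5 2 Om' /\ equivalent_spaces Om Om'.
Proof.
move=> OL; have [w [P1 [P2 [Q1 [Q2 [[wf Omw w0 w1] [[LP P10 P20 P1E P2E] [F1 [F2 [F10 EF1 F20
  EF2]]]]]]]]]] := Lspace_pencil k5 isT OL.
have [_ [t [m11 [m12 [m21 [m22 [Q1t Q2t mE]]]]]]] := log_pencil_class k5 isT LP.
exists (fun g => exists2 f, Om f & g = pullback (transl_mx t) f); split; last first.
  by exists (transl_mx t); split=> //; [exact: transl_unit | exact: transl_inf].
split; first exact: Lspace_transl.
pose tr f : {poly k} := f \Po ('X + t%:P).
pose N := m11 * m21 ^+ 5 - m21 * m11 ^+ 5; pose V := m11 * m22 ^+ 5 - m21 * m12 ^+ 5.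
pose W := m12 * m22 ^+ 5 - m22 * m12 ^+ 5.
have [L LD] : exists L, L = Q1 * Q2 ^+ 5 - Q2 * Q1 ^+ 5 by eexists.
have c5 := pchar_polyE k5.
have LE : tr L = N *: 'X ^+ 24 + V *: 'X ^+ 4 + W%:P.
  rewrite /tr LD comp_polyB (comp_polyM Q1 (Q2 ^+ 5)) (comp_polyM Q2 (Q1 ^+ 5))
    !comp_poly_expn Q1t Q2t !(exprDp c5).
  rewrite -!mul_polyC /N /V /W.
  (* The coefficient of X^20 is the only obstruction to additivity; [mE] kills it. *)
  transitivity ((m12 * m21 ^+ 5 - m22 * m11 ^+ 5)%:P * 'X ^+ 20 +
   ((m11 * m21 ^+ 5 - m21 * m11 ^+ 5)%:P * 'X^24 + (m11 * m22 ^+ 5 - m21 * m12 ^+ 5)%:P *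
     'X^4 + (m12 * m22 ^+ 5 - m22 * m12 ^+ 5)%:P)); first by ring.
  by rewrite mE subrr mul0r add0r.
have LP1 : L = Q2 * P1 by rewrite P1E LD /=; ring.
have LP2 : L = Q1 * P2 by rewrite P2E LD /=; ring.
have [s1 s2 co sL _] := LP; rewrite -LD in sL.
have N0 : N != 0.
  apply/eqP => N0; have : (tr L)`_24 = 0.
    by rewrite LE N0 scale0r add0r coefD coefZ coefXn coefC /= mulr0 addr0.
  have := lead_coefE (tr L); rewrite size_comp_XaddC sL /= => <- /eqP.
  by rewrite lead_coef_eq0 -size_poly_eq0 size_comp_XaddC sL.
(* For W = 0 the point t would be a multiple root of L. One of Q1, Q2 does not vanish at t, so t
   would be a multiple root of P2 or P1, against [log_root]. *)
have W0 : W != 0.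
  apply/eqP => W0.
  have L0 : L.[t] = 0.
    have : (tr L).[0] = 0 by rewrite LE W0 !(hornerD, hornerZ, hornerXn, hornerC) !expr0n /=
      !mulr0 !addr0.
    by rewrite /tr horner_comp hornerD hornerX hornerC add0r.
  have L'0 : L^`().[t] = 0.
    have : (tr L)^`().[0] = 0.
      rewrite LE !derivD !derivZ !derivXn derivC -!scaler_nat addr0 hornerD !hornerZ !hornerXn.
      by rewrite !expr0n /= !mulr0 addr0.
    have dX : ('X + t%:P)^`() = 1 :> {poly k} by rewrite derivD derivX derivC addr0.
    by rewrite /tr deriv_comp dX mulr1 horner_comp hornerD hornerX hornerC add0r.
  have [Q2z|Q2n] := eqVneq Q2.[t] 0.
    have Q1n : Q1.[t] != 0.
      by move: co; rewrite coprimep_sym => /coprimep_root; apply; apply/rootP.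
    have P2t : P2.[t] = 0 by move/eqP: L0; rewrite LP2 hornerM mulf_eq0 (negPf Q1n) => /eqP.
    have [|/eqP h _] := log_root k5 F20 EF2 (x := t); first exact/rootP.
    apply: h; move/eqP: L'0; rewrite LP2 derivM hornerD !hornerM P2t mulr0 add0r mulf_eq0
      (negPf Q1n) => /eqP //.
  have P1t : P1.[t] = 0 by move/eqP: L0; rewrite LP1 hornerM mulf_eq0 (negPf Q2n) => /eqP.
  have [|/eqP h _] := log_root k5 F10 EF1 (x := t); first exact/rootP.
  by apply: h; move/eqP: L'0; rewrite LP1 derivM hornerD !hornerM P1t mulr0 add0r mulf_eq0
    (negPf Q2n) => /eqP.
have [a [af aE]] := additive_poly_roots k5 V N0 W0.
exists a; split=> // x.
have tx : L.[x + t] = N * x ^+ 24 + V * x ^+ 4 + W.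
  have := congr1 (fun f : {poly k} => f.[x]) LE.
  by rewrite /tr horner_comp !(hornerD, hornerZ, hornerXn, hornerX, hornerC).
have rootx : L.[x + t] = 0 <-> Fp_span 5 a x /\ x != 0.
  rewrite tx -aE; split=> [E|[E x0]]; last first.
    by apply: (mulfI x0); rewrite mulr0 -[RHS]E; ring.
  split; last by apply: contra_eq_neq E => ->; rewrite !expr0n /= !mulr0 !add0r.
  by transitivity (x * (N * x ^+ 24 + V * x ^+ 4 + W)); [ring | rewrite E mulr0].
rewrite -rootx; split.
  case=> g [[f /Omw[c ->] ->] g0 gx].
  have PP : P1 * P2 != 0 by rewrite mulf_neq0.
  move: g0 gx; rewrite /Fp_comb !big_ord_recl big_ord0 addr0 w0 w1 rfrac1_Fp_comb //.
  move: (_ * P2 + _) => u; rewrite pullback_transl // => g0.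
  have T0 := comp_transl_neq0 t PP.
  have u0 : u \Po ('X + t%:P) != 0.
    by apply: contraNneq g0 => ->; rewrite /rfrac tofrac0 mul0r.
  rewrite /form_ord rordE // => h.
  have : root ((P1 * P2) \Po ('X + t%:P)) x.
    by apply: contraTT h => /mupNroot ->; rewrite subr0 -leNgt.
  rewrite /root horner_comp hornerD hornerX hornerC hornerM mulf_eq0 => /orP[] /eqP h0.
    by rewrite LP1 hornerM h0 mulr0.
  by rewrite LP2 hornerM h0 mulr0.
move=> Lx.
have pole P l : P != 0 -> w l = rfrac 1 P -> P.[x + t] = 0 ->
  poles (fun g => exists2 f, Om f & g = pullback (transl_mx t) f) x.
  move=> P0 wl Px; exists (pullback (transl_mx t) (w l)).
  have T0 := comp_transl_neq0 t P0.
  have E : pullback (transl_mx t) (w l) = rfrac 1 (P \Po ('X + t%:P)).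
    by rewrite wl pullback_transl // comp_polyC.
  split.
  - exists (w l) => //; apply/Omw; exists (fun j => if j == l then 1 else 0).
    rewrite /Fp_comb (bigD1 l) //= eqxx big1 ?addr0 // => j /negPf ->; exact: mulr0n.
  - by rewrite E /rfrac tofrac1 mul1r invr_eq0 tofrac_eq0.
  - rewrite E form_ord_finite // oppr_lt0 ltz_nat -XsubC_dvd // dvdp_XsubCl.
    by rewrite /root horner_comp hornerD hornerX hornerC Px.
(* A root of L = Q2 P1 is a root of P1, or a root of Q2 and hence of its multiple P2. *)
move/eqP: (Lx); rewrite LP1 hornerM mulf_eq0 => /orP[] /eqP h0; last exact: pole w0 h0.
by apply: pole w1 _ => //; rewrite P2E hornerM h0 mul0r.
Qed.

End Standard.

Theorem theorem7p1 (p : nat) (p_prime : prime p) (k : closedFieldType)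
    (char_k : p \in [pchar k]) (Om : ratfun k -> Prop)
    (Om_L : Lspace p (4 * p)%N 2 Om) :
  p \in [:: 2%N; 3%N; 5%N] /\
  (p = 5%N -> exists Om' : ratfun k -> Prop,
     standard_Lspace p 2 Om' /\ equivalent_spaces Om Om').
Proof.
split; last by move=> p5; subst p; exact: standard_of_pencil.
have [p5|p5] := ltnP 4 p.
  have [w [P1 [P2 [Q1 [Q2 [_ [[LP _ _ _ _] _]]]]]]] := Lspace_pencil char_k p5 Om_L.
  by have [-> _] := log_pencil_class char_k p5 LP.
by move: p_prime p5; clear; case: p => [|[|[|[|[|]]]]].
Qed.
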